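(* Let $t>0$ and let $g$ be a measurable function on $\mathbb{C}^n$ such that $gK_t(\cdot,w)\in L^2(\mathbb{C}^n,d\mu_t)$ for all $w\in\mathbb{C}^n$. If the Toeplitz operator $T_g$ is bounded on $\mathcal{H}_t(\mathbb{C}^n)$, then $$\|g*q_s\|_\infty\le c(s)\,\|T_g\|\qquad\text{for all } s\in\left(\tfrac18\sinh 4t,\ \tfrac12\sinh 4t\right).$$ Conversely, if $\|g*q_s\|_\infty<\infty$ for some $0<s<\tfrac18\sinh 4t$, then $T_g$ is bounded, and moreover $$\|T_g\|\le c(s)\,\|g*q_s\|_\infty .$$ Here the constants $c(s)$ do not depend on $g$.
   Context: Write $z=x+iy\in\mathbb{C}^n$ with $x,y\in\mathbb{R}^n$ and let $d\mu_t(z)=U_t(x,y)\,dx\,dy$ with $U_t(x,y)=4^n(\sinh 4t)^{-n/2}e^{\tanh(2t)|x|^2-\coth(2t)|y|^2}$. The Hermite-Bergman space $\mathcal{H}_t(\mathbb{C}^n)$ is the Hilbert space of entire functions on $\mathbb{C}^n$ that are square integrable with respect to $d\mu_t$, and $K_t(z,w)$ is its reproducing kernel. The Toeplitz operator with symbol $g$ is the densely defined operator $T_gf(z)=\int_{\mathbb{C}^n}g(w)f(w)K_t(z,w)\,d\mu_t(w)$ (i.e. $T_gf=P(gf)$ with $P$ the orthogonal projection of $L^2(\mathbb{C}^n,d\mu_t)$ onto $\mathcal{H}_t(\mathbb{C}^n)$), defined in particular on the span of the functions $K_t(\cdot,w)$; bounded means that it extends to a bounded operator on $\mathcal{H}_t(\mathbb{C}^n)$,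 with operator norm $\|T_g\|$. For $s>0$, $q_s(z)=(4\pi s)^{-n}e^{-\frac{1}{4s}|z|^2}$ is the heat kernel on $\mathbb{C}^n\cong\mathbb{R}^{2n}$, and $*$ is convolution on $\mathbb{R}^{2n}$; under the integrability assumption on $g$, $g*q_s$ is well defined for $0<s<\frac12\sinh 4t$. *)

(* Defs.v *)
From HB Require Import structures.
From mathcomp Require Import all_boot all_order all_algebra.
From mathcomp Require Import complex.
From mathcomp Require Import all_classical all_reals all_analysis.
From mathcomp Require Import measurable_realfun.

Set Implicit Arguments.
Unset Strict Implicit.
Unset Printing Implicit Defensive.

Import Order.TTheory GRing.Theory Num.Theory.
Import numFieldNormedType.Exports.

Local Open Scope classical_set_scope.
Local Open Scope ring_scope.

(* Lebesgue measure on n.-tuple R as an iterated product. Sigma-finiteness of the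
   product is proved by hand: the canonical instance for \x that requires only
   sigma-finite factors is shadowed in the library. *)
Section lebesgue_tuple_step.
Context {R : realType} (n : nat).
Variable m : {sigma_finite_measure set (n.-tuple R) -> \bar R}.
Local Notation mR := (@lebesgue_measure R).

Definition cons_coord (p : measurableTypeR R * n.-tuple R) : n.+1.-tuple R :=
  [tuple of p.1 :: p.2].

Lemma measurable_cons_coord : measurable_fun setT cons_coord.
Proof. exact: measurable_cons. Qed.

Definition uncons_coord (v : n.+1.-tuple R) : measurableTypeR R * n.-tuple R :=
  (thead v, [tuple of behead v]).

Lemma measurable_uncons_coord : measurable_fun setT uncons_coord.
Proof.
apply: measurable_fun_pair; last exact: measurable_behead.
exact: measurable_tnth.
Qed.

Lemma cons_coordK : cancel cons_coord uncons_coord.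
Proof. by case=> x v; congr pair; apply/val_inj. Qed.

Lemma uncons_coordK : cancel uncons_coord cons_coord.
Proof. by move=> v; rewrite [RHS]tuple_eta. Qed.

Definition lebesgue_tupleS : set (n.+1.-tuple R) -> \bar R :=
  pushforward (mR \x m)%E cons_coord.

Let lebesgue_tupleS0 : lebesgue_tupleS set0 = 0%E.
Proof. by rewrite /lebesgue_tupleS /pushforward preimage_set0 measure0. Qed.

Let lebesgue_tupleS_ge0 A : (0 <= lebesgue_tupleS A)%E.
Proof. exact: (measure_ge0 (mR \x m)%E). Qed.

Let measurable_preimage_cons A :
  measurable A -> measurable (cons_coord @^-1` A).
Proof.
by move=> mA; rewrite -[X in measurable X]setTI; exact: measurable_cons_coord.
Qed.

Let lebesgue_tupleS_sigma_additive : semi_sigma_additive lebesgue_tupleS.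
Proof.
move=> F mF tF mUF; rewrite /lebesgue_tupleS /pushforward preimage_bigcup.
apply: measure_semi_sigma_additive.
- by move=> k; exact: measurable_preimage_cons.
- apply/trivIsetP => /= i j _ _ ij; rewrite -preimage_setI.
  by move/trivIsetP : tF => /(_ _ _ _ _ ij) ->//; rewrite preimage_set0.
- by rewrite -preimage_bigcup; exact: measurable_preimage_cons.
Qed.

HB.instance Definition _ := isMeasure.Build _ _ _ lebesgue_tupleS
  lebesgue_tupleS0 lebesgue_tupleS_ge0 lebesgue_tupleS_sigma_additive.

Let lebesgue_tupleS_sigma_finite : sigma_finite setT lebesgue_tupleS.
Proof.
have /sigma_finiteP[F [FT ndF Foo]] := sigma_finiteT mR.
have /sigma_finiteP[G [GT ndG Goo]] := sigma_finiteT m.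
exists (fun k => uncons_coord @^-1` (F k `*` G k)).
  apply/seteqP; split=> // v _.
  have [i _ Fi] : (\bigcup_i F i) (uncons_coord v).1 by rewrite -FT.
  have [j _ Gj] : (\bigcup_i G i) (uncons_coord v).2 by rewrite -GT.
  exists (maxn i j) => //; split.
    by move: Fi; exact/subsetPset/ndF/leq_maxl.
  by move: Gj; exact/subsetPset/ndG/leq_maxr.
move=> k; have [mF Fk] := Foo k; have [mG Gk] := Goo k; split.
  rewrite -[X in measurable X]setTI; apply: measurable_uncons_coord => //.
  exact: measurableX.
rewrite /lebesgue_tupleS /pushforward (_ : _ @^-1` _ = F k `*` G k).
  by rewrite product_measure1E// lte_mul_pinfty// ge0_fin_numE.
by rewrite -comp_preimage (_ : _ \o _ = id)//; apply/funext/cons_coordK.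
Qed.

HB.instance Definition _ := Measure_isSigmaFinite.Build _ _ _ lebesgue_tupleS
  lebesgue_tupleS_sigma_finite.

End lebesgue_tuple_step.

Fixpoint lebesgue_tuple (R : realType) (n : nat) :
    {sigma_finite_measure set (n.-tuple R) -> \bar R} :=
  match n with
  | 0 => \d_([tuple] : 0.-tuple R)
  | k.+1 => lebesgue_tupleS (lebesgue_tuple R k)
  end.

Definition sinh {R : realType} (u : R) : R := (expR u - expR (- u)) / 2.
Definition cosh {R : realType} (u : R) : R := (expR u + expR (- u)) / 2.
Definition tanh {R : realType} (u : R) : R := sinh u / cosh u.
Definition coth {R : realType} (u : R) : R := cosh u / sinh u.

Section hermite_bergman.
Context {R : realType} (n : nat).
Local Notation C := R[i].
Local Notation Cn := 'rV[R[i]]_n.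
Local Notation Rn := (n.-tuple R).

Definition cabs (z : C) : R := ComplexField.Normc.normc z.

Definition sqn (x : Rn) : R := \sum_(j < n) tnth x j ^+ 2.

Definition csqn (z : Cn) : R := \sum_(j < n) cabs (z ord0 j) ^+ 2.

Definition cvec (p : Rn * Rn) : Cn := \row_j (tnth p.1 j +i* tnth p.2 j)%C.

Definition leb : {measure set (Rn * Rn) -> \bar R} :=
  (lebesgue_tuple R n \x lebesgue_tuple R n)%E.

(* Lebesgue measurability (the completed sigma-algebra), not just Borel. The
   integral below takes the supremum over Borel simple functions, which agrees
   with the integral for the completed measure on such functions. *)
Definition cmeasurable (f : Cn -> C) : Prop :=
  forall B : set R, measurable B ->
    completed_algebra_gen leb [set p | B (complex.Re (f (cvec p)))] /\
    completed_algebra_gen leb [set p | B (complex.Im (f (cvec p)))].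

(* Meant for integrable f: Rintegral is a total operator. *)
Definition cintegral (f : Rn * Rn -> C) : C :=
  ((\int[leb]_p complex.Re (f p))%R +i* (\int[leb]_p complex.Im (f p))%R)%C.

Definition Ut (t : R) (p : Rn * Rn) : R :=
  4 ^+ n * (sinh (4 * t) `^ (- (n%:R / 2))) *
  expR (tanh (2 * t) * sqn p.1 - coth (2 * t) * sqn p.2).

Definition cintegral_mu (t : R) (f : Cn -> C) : C :=
  cintegral (fun p => f (cvec p) * (Ut t p)%:C%C).

Definition sqint (t : R) (f : Cn -> C) : \bar R :=
  (\int[leb]_p (cabs (f (cvec p)) ^+ 2 * Ut t p)%:E)%E.

Definition L2mu (t : R) : set (Cn -> C) :=
  [set f | cmeasurable f /\ (sqint t f < +oo)%E].

Definition normL2 (t : R) (f : Cn -> C) : R := Num.sqrt (fine (sqint t f)).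

(* Complex Frechet differentiability: 'rV[C]_n and C^o are normed modules over
   the complex field. *)
Definition entire (f : Cn -> C) : Prop :=
  forall z, differentiable (f : Cn -> C^o) z.

Definition Ht (t : R) : set (Cn -> C) := [set f | entire f /\ L2mu t f].

Definition is_reproducing_kernel (t : R) (K : Cn -> Cn -> C) : Prop :=
  forall w, Ht t (K^~ w) /\
    forall f, Ht t f -> f w = cintegral_mu t (fun z => f z * (K z w)^*%C).

(* xget is harmless: a reproducing kernel is unique when it exists. *)
Definition Kt (t : R) : Cn -> Cn -> C :=
  xget (fun _ _ => 0) [set K | is_reproducing_kernel t K].

Definition toeplitz (t : R) (g : Cn -> C) (f : Cn -> C) : Cn -> C :=
  fun z => cintegral_mu t (fun w => g w * f w * Kt t z w).

(* The natural domain; it contains every Kt t ^~ w as soon as all the functions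
   g * Kt t ^~ w are in L2mu t. *)
Definition toeplitz_dom (t : R) (g : Cn -> C) : set (Cn -> C) :=
  [set f | Ht t f /\ L2mu t (fun w => g w * f w)].

Definition bounded_operator (t : R) (S : (Cn -> C) -> (Cn -> C)) : Prop :=
  [/\ forall f, Ht t f -> Ht t (S f),
      forall (a : C) f h, Ht t f -> Ht t h ->
        S (fun z => a * f z + h z) = (fun z => a * S f z + S h z)
    & exists M : R, forall f, Ht t f -> normL2 t (S f) <= M * normL2 t f].

Definition operator_norm (t : R) (S : (Cn -> C) -> (Cn -> C)) : R :=
  sup [set r | exists f, [/\ Ht t f, normL2 t f <= 1 & r = normL2 t (S f)]].

(* S, restricted to the Hermite-Bergman space, is the (unique) bounded
   extension of the Toeplitz operator with symbol g. *)
Definition bounded_extension (t : R) (g : Cn -> C)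
    (S : (Cn -> C) -> (Cn -> C)) : Prop :=
  bounded_operator t S /\
  forall f, toeplitz_dom t g f -> S f = toeplitz t g f.

Definition heat_kernel (s : R) (z : Cn) : R :=
  (4 * pi * s) ^- n * expR (- (csqn z / (4 * s))).

Definition heat_conv (g : Cn -> C) (s : R) (z : Cn) : C :=
  cintegral (fun p => g (cvec p) * (heat_kernel s (z - cvec p))%:C%C).

Definition norm_infty (f : Cn -> C) : \bar R :=
  ('N[leb]_+oo [ (fun p => (cabs (f (cvec p)))%:E) ])%E.

End hermite_bergman.

(* Main.v *)
Require Import Defs.
From HB Require Import structures.
From mathcomp Require Import all_boot all_order all_algebra.
From mathcomp Require Import complex.
From mathcomp Require Import all_classical all_reals all_analysis.
From mathcomp Require Import measurable_realfun ess_sup_inf ring lra.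

(** Write [al] for 1 / sinh 4t. The density of the measure is a constant times
    |Mt z|^2 exp (- al |z|^2), where [Mt] is entire without zeros ([UtE]). So
    multiplication by [Mt] carries the Hermite-Bergman space onto a Fock space;
    the reproducing kernel is explicit ([Kf], [KtE]), and up to factors in one
    variable the Toeplitz operator has the integral kernel
      bker z u = int g(w) exp (al <w,u> + al <z,w> - al |w|^2) dw.
    Both inequalities compare this kernel with Gaussian averages of the symbol.

    From the operator to the averages. The kernel is an inner product of T_g K_u
    with K_z, hence |bker z u| <= (pi/al)^n ||T_g|| exp (al (|z|^2 + |u|^2) / 2)
    ([bker_bound]). For real [a] and [b], integrate the kernel at the points
    z0 + b om and z0 + a om against a Gaussian in om. Fubini's theorem gives the
    integral of g against exp (- al (1 - a b) |w - z0|^2), and the bound on the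
    kernel integrates to a finite number when |a| = |b| < 1, since the linear
    terms in om cancel ([heat_integral_bound]). The product a b ranges over
    ]-1, 1[. The rate al (1 - a b) equals 1/(4s), the rate of the heat kernel, for
    some such pair as soon as s > sinh 4t / 8; the upper end s < sinh 4t / 2 is
    where g is still integrable against that Gaussian.

    From the averages to the operator. Let 1/gam = 1/al - 4s. The exponential of
    - al <w-z, w-u> is a composition of the heat kernel centred at w with the
    exponential of - gam <zeta-z, zeta-u> ([gaussian_composition]), so the kernel
    is an integral of g * q_s. If g * q_s is bounded this yields
      |bker z u| <= B exp (al (|z|^2 + |u|^2) / 2 - c |z - u|^2)
    with c = (2 al - gam) / 4 ([bker_decay]), and c > 0 means s < sinh 4t / 8.
    On the Fock side T_g is then dominated by convolution with an integrable
    Gaussian, and Young's inequality bounds it ([gauss_young],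
    [toeplitz_bounded]). That T_g f is entire follows by differentiation under
    the integral sign, the domination coming from the square integrability of g
    times every exponential of a linear form ([symbol_l1_finite],
    [entire_laplace]).

    Foundations. The reproducing formula of the Fock space comes from the mean
    value property for a Gaussian weight ([gaussian_mean_value]), that is, from
    the rotation invariance of Lebesgue measure and the mean value property on
    circles. The latter is Goursat's theorem on a rectangle in logarithmic
    coordinates ([goursat], [circle_mean]). A Lebesgue measurable symbol agrees
    with a Borel one off a null set, which none of the integrals sees
    ([cmeasurable_approx], [integral_off_null]). *)

Set Implicit Arguments.
Unset Strict Implicit.
Unset Printing Implicit Defensive.

Import Order.TTheory GRing.Theory Num.Theory.
Import numFieldNormedType.Exports.

Local Open Scope classical_set_scope.
Local Open Scope ring_scope.

(** * Lebesgue measure on tuples *)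

Lemma lebesgue_measure_shift (R : realType) (a : R) (A : set R) :
  measurable A ->
  pushforward (@lebesgue_measure R) (+%R a : _ -> measurableTypeR R) A =
  lebesgue_measure A.
Proof.
have mt : measurable_fun setT (+%R a : measurableTypeR R -> measurableTypeR R).
  by apply: measurable_funD => //; exact: measurable_cst.
move=> mA; apply/esym.
apply: (@lebesgue_measure_unique _ (pushforward (@lebesgue_measure R) (+%R a : _ -> measurableTypeR R))) => //= _ [[u v]] _ <-.
rewrite /pushforward/= (_ : _ @^-1` _ = `]u - a, v - a]%classic); last first.
  by apply/seteqP; split => x /=; rewrite !in_itv /= ltrBlDl lerBrDl.
rewrite !lebesgue_measure_itv/= !lte_fin ltrD2r -!EFinB.
by rewrite opprD addrACA opprK addNr addr0.
Qed.

Lemma ge0_integral_shift (R : realType) (a : R) (f : R -> \bar R) :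
  measurable_fun setT f -> (forall x, (0 <= f x)%E) ->
  (\int[lebesgue_measure]_x f (a + x)%R = \int[lebesgue_measure]_x f x)%E.
Proof.
move=> mf f0.
have mt : measurable_fun setT (+%R a : measurableTypeR R -> measurableTypeR R).
  by apply: measurable_funD => //; exact: measurable_cst.
rewrite -[LHS](@ge0_integral_pushforward _ _ _ _ _ _ mt lebesgue_measure setT f)//.
by apply: eq_measure_integral => A mA _; exact/lebesgue_measure_shift.
Qed.

Section tuple_integral.
Context {R : realType}.

Definition tadd n (a v : n.-tuple R) : n.-tuple R :=
  [tuple tnth a i + tnth v i | i < n].

Lemma measurable_tadd n d (T : measurableType d) (f g : T -> n.-tuple R) :
  measurable_fun setT f -> measurable_fun setT g ->
  measurable_fun setT (fun x => tadd (f x) (g x)).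
Proof.
move=> mf mg; apply/measurable_fun_tnthP => i.
rewrite (_ : _ \o _ = fun x => tnth (f x) i + tnth (g x) i).
  by apply: measurable_funD;
    apply: (measurableT_comp (measurable_tnth i)).
by apply/funext => x /=; rewrite tnth_mktuple.
Qed.

Lemma ge0_integral_tupleS n (f : n.+1.-tuple R -> \bar R) :
  measurable_fun setT f -> (forall v, (0 <= f v)%E) ->
  (\int[lebesgue_tuple R n.+1]_v f v =
   \int[lebesgue_measure]_x \int[lebesgue_tuple R n]_v f [tuple of x :: v])%E.
Proof.
move=> mf f0 /=.
rewrite (@ge0_integral_pushforward _ _ _ _ _ _ (@measurable_cons_coord R n)
  (lebesgue_measure \x lebesgue_tuple R n)%E setT f)// fubini_tonelli1 //; last by move=> x; exact: f0.
by apply: measurableT_comp => //; exact: measurable_cons_coord.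
Qed.

Lemma ge0_integral_tadd n (a : n.-tuple R) (f : n.-tuple R -> \bar R) :
  measurable_fun setT f -> (forall v, (0 <= f v)%E) ->
  (\int[lebesgue_tuple R n]_v f (tadd a v) = \int[lebesgue_tuple R n]_v f v)%E.
Proof.
elim: n a f => [|n IH] a f mf f0.
  by apply: eq_integral => v _; congr f; apply/eq_from_tnth => -[].
have mfa : measurable_fun setT (fun v => f (tadd a v)).
  apply: measurableT_comp => //; apply: measurable_tadd => //; exact: measurable_cst.
rewrite !ge0_integral_tupleS//.
pose g x := (\int[lebesgue_tuple R n]_v f [tuple of x :: v])%E.
have mfc : measurable_fun setT (fun p : measurableTypeR R * n.-tuple R => f [tuple of p.1 :: p.2]).
  by apply: measurableT_comp => //; exact: measurable_cons_coord.
rewrite -(@ge0_integral_shift R (thead a) g).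
- apply: eq_integral => x _; rewrite /g.
  rewrite -(IH [tuple of behead a] (fun v => f [tuple of thead a + x :: v])).
  + apply: eq_integral => v _; congr f; apply/eq_from_tnth => i.
    rewrite tnth_mktuple.
    case: (unliftP ord0 i) => [j ->|->]; last by rewrite !tnth0.
    by rewrite !tnthS tnth_mktuple tnth_behead; congr (tnth _ _ + _); apply/val_inj => /=; rewrite inordK // ltnS.
  + exact: (measurable_fun_pair2 _ mfc).
  + by move=> v.
- exact: (@measurable_fun_fubini_tonelli_F _ _ _ _ _ (lebesgue_tuple R n) _ mfc).
- by move=> x; apply: integral_ge0.
Qed.

(** Normalization of the normal density of variance 1 / (2 d). *)
Lemma integral_gauss (d : R) : 0 < d ->
  (\int[lebesgue_measure]_x (expR (- (d * x ^+ 2)))%:E = (Num.sqrt (pi / d))%:E)%E.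
Proof.
move=> d0.
pose s : R := Num.sqrt (2 * d)^-1.
have s0 : s != 0 by rewrite gt_eqF // sqrtr_gt0 invr_gt0 mulr_gt0.
have s2 : s ^+ 2 = (2 * d)^-1 by rewrite sqr_sqrtr // invr_ge0 mulr_ge0 // ltW.
have := integral_normal_pdf 0 s.
have -> : (fun x => (normal_pdf 0 s x)%:E) =
   (fun x => (normal_peak s)%:E * (expR (- (d * x ^+ 2)))%:E)%E.
  apply/funext => x; rewrite normal_pdfE // EFinM /normal_fun subr0.
  congr (_ * (expR _)%:E)%E; rewrite s2; field; lra.
rewrite ge0_integralZl//.
- rewrite /normal_peak s2 => h.
  have -> : Num.sqrt (pi / d) = (Num.sqrt ((2 * d)^-1 * pi *+ 2)).
    congr Num.sqrt; field; lra.
  have p0 : Num.sqrt ((2 * d)^-1 * pi *+ 2) != 0.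
    by rewrite gt_eqF // sqrtr_gt0 mulrn_wgt0 // mulr_gt0 ?pi_gt0 // invr_gt0 mulr_gt0.
  by rewrite -[RHS]mule1 -h muleA -EFinM divff // mul1e.
- apply/measurable_EFinP; apply: measurableT_comp => //.
  apply: measurableT_comp => //; apply: measurable_funM => //; exact: measurable_cst.
- by rewrite lee_fin normal_peak_ge0.
Qed.

Lemma measurable_sqn n : measurable_fun setT (@sqn R n).
Proof.
rewrite (_ : @sqn R n = fun x => \sum_(j < n) tnth x j ^+ 2) //.
by apply: measurable_sum => i; apply: measurable_funX; exact: measurable_tnth.
Qed.

Lemma sqn_cons n x (v : n.-tuple R) :
  sqn [tuple of x :: v] = x ^+ 2 + sqn v.
Proof.
rewrite /sqn big_ord_recl tnth0; congr (_ + _).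
by apply: eq_bigr => i _; rewrite tnthS.
Qed.

Lemma integral_tuple_gauss n (d : R) : 0 < d ->
  (\int[lebesgue_tuple R n]_v (expR (- (d * sqn v)))%:E =
   (Num.sqrt (pi / d) ^+ n)%:E)%E.
Proof.
move=> d0; elim: n => [|n IH].
  rewrite /= integral_dirac //=.
    by rewrite diracT mul1e /sqn big_ord0 mulr0 oppr0 expR0 expr0.
  apply/measurable_EFinP; apply: measurableT_comp => //; apply: measurableT_comp => //.
  apply: measurable_funM => //; exact: measurable_sqn.
have mg k : measurable_fun setT (fun v => (expR (- (d * @sqn R k v)))%:E).
  apply/measurable_EFinP; apply: measurableT_comp => //; apply: measurableT_comp => //.
  apply: measurable_funM => //; exact: measurable_sqn.
rewrite ge0_integral_tupleS //.
under eq_integral do under eq_integral do rewrite sqn_cons mulrDr opprD expRD EFinM.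
transitivity (\int[lebesgue_measure]_x ((expR (- (d * x ^+ 2)))%:E *
   (Num.sqrt (pi / d) ^+ n)%:E))%E.
  apply: eq_integral => x _; rewrite ge0_integralZl ?IH //.
  exact: mg.
rewrite ge0_integralZr.
- by rewrite integral_gauss // -EFinM exprS.
- exact: measurableT.
- apply/measurable_EFinP; apply: measurableT_comp => //.
  apply: measurableT_comp => //; apply: measurable_funM => //; exact: measurable_cst.
- by move=> x _; rewrite lee_fin expR_ge0.
- by rewrite lee_fin exprn_ge0 // sqrtr_ge0.
Qed.

End tuple_integral.

(** * Lebesgue measure on the complex space *)

Section measure_preserving.
Context {R : realType} d (T : measurableType d) (mu : {measure set T -> \bar R}).

(** Invariance of [mu] under [phi], tested on integrals of nonnegative functions. *)
Definition preserves (phi : T -> T) :=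
  measurable_fun setT phi /\
  forall f : T -> \bar R, measurable_fun setT f -> (forall x, (0 <= f x)%E) ->
    (\int[mu]_x f (phi x) = \int[mu]_x f x)%E.

Lemma preserves_comp phi psi :
  preserves phi -> preserves psi -> preserves (phi \o psi).
Proof.
move=> [mphi pphi] [mpsi ppsi]; split; first exact: measurableT_comp.
move=> f mf f0.
have /= -> := ppsi (f \o phi) (measurableT_comp mf mphi) (fun x => f0 _).
exact: pphi.
Qed.

End measure_preserving.

Section product_sigma_finite.
Context {R : realType} d1 d2 (T1 : measurableType d1) (T2 : measurableType d2).
Variables (m1 : {sigma_finite_measure set T1 -> \bar R})
          (m2 : {sigma_finite_measure set T2 -> \bar R}).

(** The product carries its sigma-finiteness along, so that it can be a factor of a
    further product in Fubini's theorem. *)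
Definition sfprod : set (T1 * T2) -> \bar R := (m1 \x m2)%E.

HB.instance Definition _ := Measure.on sfprod.

Let sfprod_sigma_finite : sigma_finite setT sfprod.
Proof.
have /sigma_finiteP[F [FT ndF Foo]] := sigma_finiteT m1.
have /sigma_finiteP[G [GT ndG Goo]] := sigma_finiteT m2.
exists (fun k => F k `*` G k).
  apply/seteqP; split=> // v _.
  have [i _ Fi] : (\bigcup_i F i) v.1 by rewrite -FT.
  have [j _ Gj] : (\bigcup_i G i) v.2 by rewrite -GT.
  exists (maxn i j) => //; split.
    by move: Fi; exact/subsetPset/ndF/leq_maxl.
  by move: Gj; exact/subsetPset/ndG/leq_maxr.
move=> k; have [mF Fk] := Foo k; have [mG Gk] := Goo k; split.
  exact: measurableX.
by rewrite /sfprod product_measure1E// lte_mul_pinfty// ge0_fin_numE.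
Qed.

HB.instance Definition _ := Measure_isSigmaFinite.Build _ _ _ sfprod
  sfprod_sigma_finite.

End product_sigma_finite.

Section plane.
Context {R : realType} (n : nat).
Local Notation Rn := (n.-tuple R).
Local Notation mR := (lebesgue_tuple R n).

Definition lebC : {sigma_finite_measure set (Rn * Rn)%type -> \bar R} :=
  sfprod mR mR.

Definition tscale (k : R) (v : Rn) : Rn := [tuple k * tnth v i | i < n].

Lemma measurable_tscale d (T : measurableType d) (f : T -> Rn) k :
  measurable_fun setT f -> measurable_fun setT (fun x => tscale k (f x)).
Proof.
move=> mf; apply/measurable_fun_tnthP => i.
rewrite (_ : _ \o _ = fun x => k * tnth (f x) i).
  apply: measurable_funM; first exact: measurable_cst.
  exact: (measurableT_comp (measurable_tnth i)).
by apply/funext => x /=; rewrite tnth_mktuple.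
Qed.

Definition shear1 k (p : Rn * Rn) : Rn * Rn := (tadd (tscale k p.2) p.1, p.2).
Definition shear2 k (p : Rn * Rn) : Rn * Rn := (p.1, tadd (tscale k p.1) p.2).

(** A shear acts on each fibre by a translation. *)
Lemma preserves_shear1 k : preserves lebC (shear1 k).
Proof.
have ms : measurable_fun setT (shear1 k).
  apply: measurable_fun_pair => //; apply: measurable_tadd => //.
  exact: measurable_tscale.
split=> // f mf f0.
rewrite (@fubini_tonelli2 _ _ _ _ _ mR mR (f \o shear1 k)) //; last 2 first.
- exact: measurableT_comp.
- by move=> x; exact: f0.
rewrite (@fubini_tonelli2 _ _ _ _ _ mR mR f) //.
apply: eq_integral => y _; rewrite /fubini_G /shear1 /=.
by rewrite (@ge0_integral_tadd _ n (tscale k y) (fun x => f (x, y)))//; exact: (measurable_fun_pair1 _ mf).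
Qed.

Lemma preserves_shear2 k : preserves lebC (shear2 k).
Proof.
have ms : measurable_fun setT (shear2 k).
  apply: measurable_fun_pair => //; apply: measurable_tadd => //.
  exact: measurable_tscale.
split=> // f mf f0.
rewrite (@fubini_tonelli1 _ _ _ _ _ mR mR (f \o shear2 k)) //; last 2 first.
- exact: measurableT_comp.
- by move=> x; exact: f0.
rewrite (@fubini_tonelli1 _ _ _ _ _ mR mR f) //.
apply: eq_integral => y _; rewrite /fubini_F /shear2 /=.
by rewrite (@ge0_integral_tadd _ n (tscale k y) (fun x => f (y, x)))//; exact: (measurable_fun_pair2 _ mf).
Qed.

Definition translate (a p : Rn * Rn) : Rn * Rn := (tadd a.1 p.1, tadd a.2 p.2).

Lemma preserves_translate a : preserves lebC (translate a).
Proof.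
have ms : measurable_fun setT (translate a).
  by apply: measurable_fun_pair => //; apply: measurable_tadd => //; exact: measurable_cst.
split=> // f mf f0.
rewrite (@fubini_tonelli1 _ _ _ _ _ mR mR (f \o translate a)) //; last 2 first.
- exact: measurableT_comp.
- by move=> x; exact: f0.
rewrite (@fubini_tonelli1 _ _ _ _ _ mR mR f) //.
rewrite -(@ge0_integral_tadd _ n a.1 (fubini_F mR f)).
- apply: eq_integral => y _; rewrite /fubini_F /translate /=.
  rewrite (@ge0_integral_tadd _ n a.2 (fun x => f (tadd a.1 y, x)))//; exact: (measurable_fun_pair2 _ mf).
- exact: measurable_fun_fubini_tonelli_F.
- by move=> v; apply: integral_ge0.
Qed.

Definition rotate c s (p : Rn * Rn) : Rn * Rn :=
  ([tuple c * tnth p.1 i - s * tnth p.2 i | i < n],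
   [tuple s * tnth p.1 i + c * tnth p.2 i | i < n]).

(** A rotation with [1 + c != 0] is a composite of three shears of slopes
    [- s / (1 + c)], [s] and [- s / (1 + c)]; the half turn is the square of a
    quarter turn. *)
Lemma preserves_rotate c s : c ^+ 2 + s ^+ 2 = 1 -> preserves lebC (rotate c s).
Proof.
have gen c' s' : c' ^+ 2 + s' ^+ 2 = 1 -> 1 + c' != 0 -> preserves lebC (rotate c' s').
  move=> cs c1; pose k := - (s' / (1 + c')).
  rewrite (_ : rotate c' s' = shear1 k \o (shear2 s' \o shear1 k)).
    apply: preserves_comp; [exact: preserves_shear1|apply: preserves_comp];
      [exact: preserves_shear2|exact: preserves_shear1].
  have k1 : k * (1 + c') = - s' by rewrite /k mulNr divfK.
  have k2 : k * s' = c' - 1.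
    apply: (mulIf c1); rewrite mulrAC k1; lra.
  apply/funext => -[x y]; congr pair; apply/eq_from_tnth => i;
    rewrite /= !tnth_mktuple /= ?tnth_mktuple /= ?tnth_mktuple;
    set a := tnth x i; set b := tnth y i.
  - have := congr1 ( *%R (k * b + a)) k2; have := congr1 ( *%R b) k1; lra.
  - have := congr1 ( *%R b) k2; lra.
(* The slopes of the shears have the denominator [1 + c]. *)
move=> cs; have [c1|c1] := eqVneq (1 + c) 0; last exact: gen.
have {}c1 : c = -1 by lra.
have s0 : s = 0 by apply/eqP; rewrite -sqrf_eq0; apply/eqP; move: cs; rewrite c1; lra.
rewrite (_ : rotate c s = rotate 0 1 \o rotate 0 1).
  by apply: preserves_comp; apply: gen; rewrite ?addr0 ?oner_eq0 //; ring.
apply/funext => -[x y]; congr pair; apply/eq_from_tnth => i;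
    rewrite !tnth_mktuple /= ?tnth_mktuple c1 s0; ring.
Qed.

Lemma csqn_cvec (p : Rn * Rn) : csqn (cvec p) = sqn p.1 + sqn p.2.
Proof.
rewrite /csqn /sqn -big_split /=; apply: eq_bigr => j _.
by rewrite mxE /cabs /= sqr_sqrtr // addr_ge0 ?sqr_ge0.
Qed.

Lemma integral_csqn_gauss (d : R) : 0 < d ->
  (\int[lebC]_p (expR (- (d * csqn (cvec p))))%:E = ((pi / d) ^+ n)%:E)%E.
Proof.
move=> d0.
have mg' : measurable_fun setT (fun v : Rn => expR (- (d * sqn v))).
  apply: measurableT_comp => //; apply: measurableT_comp => //.
  by apply: measurable_funM => //; exact: measurable_sqn.
have mg : measurable_fun setT (fun v : Rn => (expR (- (d * sqn v)))%:E).
  exact/measurable_EFinP.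
under eq_integral do rewrite csqn_cvec mulrDr opprD expRD EFinM.
have mm : measurable_fun setT (fun p : Rn * Rn =>
    (expR (- (d * sqn p.1)))%:E * (expR (- (d * sqn p.2)))%:E)%E.
  apply/measurable_EFinP; apply: measurable_funM.
  + exact: (measurableT_comp mg' measurable_fst).
  + exact: (measurableT_comp mg' measurable_snd).
rewrite (@fubini_tonelli1 _ _ _ _ _ mR mR _ mm) //.
rewrite /fubini_F /=.
transitivity (\int[mR]_x ((expR (- (d * sqn x)))%:E *
   (Num.sqrt (pi / d) ^+ n)%:E))%E.
  apply: eq_integral => x _; rewrite ge0_integralZl ?integral_tuple_gauss //.
rewrite ge0_integralZr //.
- by rewrite integral_tuple_gauss // -EFinM -exprMn -expr2 sqr_sqrtr // divr_ge0 ?pi_ge0 // ltW.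
Qed.

End plane.

(** * Integration of complex-valued functions *)

Section complex_modulus.
Context {R : realType}.
Implicit Types z w : R[i].

Lemma cabs_ge0 z : 0 <= cabs z.
Proof. by case: z => a b; rewrite /cabs /= sqrtr_ge0. Qed.

Lemma cabsM z w : cabs (z * w) = cabs z * cabs w.
Proof. exact: ComplexField.Normc.normcM. Qed.

Lemma cabs0 : cabs (0 : R[i]) = 0.
Proof. exact: ComplexField.Normc.normc0. Qed.

Lemma cabs1 : cabs (1 : R[i]) = 1.
Proof. exact: ComplexField.Normc.normc1. Qed.

Lemma cabsN z : cabs (- z) = cabs z.
Proof. exact: normcN. Qed.

Lemma cabsD z w : cabs (z + w) <= cabs z + cabs w.
Proof. exact: le_normcD. Qed.

Lemma cabsB z w : cabs (z - w) = cabs (w - z).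
Proof. by rewrite -cabsN opprB. Qed.

Lemma cabs_sqr z : cabs z ^+ 2 = complex.Re z ^+ 2 + complex.Im z ^+ 2.
Proof. by case: z => a b; rewrite /cabs /= sqr_sqrtr // addr_ge0 ?sqr_ge0. Qed.

Lemma cabs_real (r : R) : cabs r%:C%C = `|r|.
Proof. by rewrite /cabs /= expr0n /= addr0 sqrtr_sqr. Qed.

Lemma cabs_conj z : cabs z^*%C = cabs z.
Proof. by case: z => a b; rewrite /cabs /= sqrrN. Qed.

Lemma le_Re_cabs z : `|complex.Re z| <= cabs z.
Proof.
rewrite -(@ler_pXn2r _ 2) ?nnegrE ?cabs_ge0 // cabs_sqr real_normK ?num_real //.
by rewrite lerDl sqr_ge0.
Qed.

Lemma le_Im_cabs z : `|complex.Im z| <= cabs z.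
Proof.
rewrite -(@ler_pXn2r _ 2) ?nnegrE ?cabs_ge0 // cabs_sqr real_normK ?num_real //.
by rewrite lerDr sqr_ge0.
Qed.

Lemma cabs_le_ReIm z : cabs z <= `|complex.Re z| + `|complex.Im z|.
Proof.
rewrite -(@ler_pXn2r _ 2) ?nnegrE ?cabs_ge0 ?addr_ge0 // cabs_sqr sqrrD.
by rewrite !real_normK ?num_real // lerD2r lerDl mulrn_wge0 // mulr_ge0.
Qed.

Lemma mulcJ z : z * z^*%C = (cabs z ^+ 2)%:C%C.
Proof.
rewrite cabs_sqr; case: z => a b /=; simpc.
by congr (_ +i* _)%C; ring.
Qed.

Lemma ReM z w : complex.Re (z * w) =
  complex.Re z * complex.Re w - complex.Im z * complex.Im w.
Proof. by case: z w => a b [c d]. Qed.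

Lemma ImM z w : complex.Im (z * w) =
  complex.Re z * complex.Im w + complex.Im z * complex.Re w.
Proof. by case: z w => a b [c d]. Qed.

Lemma ReD z w : complex.Re (z + w) = complex.Re z + complex.Re w.
Proof. by case: z w => a b [c d]. Qed.

Lemma ImD z w : complex.Im (z + w) = complex.Im z + complex.Im w.
Proof. by case: z w => a b [c d]. Qed.

Lemma ReN z : complex.Re (- z) = - complex.Re z.
Proof. by case: z => a b. Qed.

Lemma ImN z : complex.Im (- z) = - complex.Im z.
Proof. by case: z => a b. Qed.

Lemma complex_eta z : (complex.Re z +i* complex.Im z)%C = z.
Proof. by case: z. Qed.

End complex_modulus.

Section complex_measurability.
Context {R : realType} d (T : measurableType d).
Implicit Types f g : T -> R[i].

Definition Cmeas f :=
  measurable_fun setT (fun x => complex.Re (f x)) /\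
  measurable_fun setT (fun x => complex.Im (f x)).

Lemma Cmeas_cst (c : R[i]) : Cmeas (fun=> c).
Proof. by split; exact: measurable_cst. Qed.

Lemma CmeasD f g : Cmeas f -> Cmeas g -> Cmeas (fun x => f x + g x).
Proof.
move=> [rf jf] [rg jg]; split.
- under eq_fun do rewrite ReD; exact: measurable_funD.
- under eq_fun do rewrite ImD; exact: measurable_funD.
Qed.

Lemma CmeasN f : Cmeas f -> Cmeas (fun x => - f x).
Proof.
move=> [rf jf]; split.
- under eq_fun do rewrite ReN; exact: measurableT_comp.
- under eq_fun do rewrite ImN; exact: measurableT_comp.
Qed.

Lemma CmeasB f g : Cmeas f -> Cmeas g -> Cmeas (fun x => f x - g x).
Proof. by move=> mf mg; apply: CmeasD => //; exact: CmeasN. Qed.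

Lemma CmeasM f g : Cmeas f -> Cmeas g -> Cmeas (fun x => f x * g x).
Proof.
move=> [rf jf] [rg jg]; split.
- under eq_fun do rewrite ReM; apply: measurable_funB; exact: measurable_funM.
- under eq_fun do rewrite ImM; apply: measurable_funD; exact: measurable_funM.
Qed.

Lemma Cmeas_conj f : Cmeas f -> Cmeas (fun x => (f x)^*%C).
Proof.
move=> [rf jf]; split.
- by rewrite (_ : (fun x => _) = (fun x => complex.Re (f x))) //; apply/funext => x; case: (f x).
- rewrite (_ : (fun x => _) = (fun x => - complex.Im (f x))); first exact: measurableT_comp.
  by apply/funext => x; case: (f x).
Qed.

Lemma Cmeas_real (f : T -> R) : measurable_fun setT f -> Cmeas (fun x => (f x)%:C%C).
Proof. by move=> mf; split => //; exact: measurable_cst. Qed.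

Lemma Cmeas_sum (I : Type) (r : seq I) (F : I -> T -> R[i]) :
  (forall i, Cmeas (F i)) -> Cmeas (fun x => \sum_(i <- r) F i x).
Proof.
move=> mF; elim: r => [|i r IH].
  by under eq_fun do rewrite big_nil; exact: Cmeas_cst.
by under eq_fun do rewrite big_cons; exact: CmeasD.
Qed.

Lemma measurable_cabs f : Cmeas f -> measurable_fun setT (fun x => cabs (f x)).
Proof.
move=> [rf jf].
rewrite (_ : (fun x => _) = (@Num.sqrt R \o (fun x => complex.Re (f x) ^+ 2 + complex.Im (f x) ^+ 2))).
  apply: measurableT_comp; last by apply: measurable_funD; exact: measurable_funX.
  by apply: continuous_measurable_fun; exact: sqrt_continuous.
by apply/funext => x /=; rewrite -cabs_sqr sqrtr_sqr ger0_norm // cabs_ge0.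
Qed.

End complex_measurability.

Lemma Cmeas_comp {R : realType} d1 d2 (T1 : measurableType d1) (T2 : measurableType d2)
  (f : T2 -> R[i]) (h : T1 -> T2) :
  Cmeas f -> measurable_fun setT h -> Cmeas (fun x => f (h x)).
Proof. by move=> [rf jf] mh; split; [exact: (measurableT_comp rf)|exact: (measurableT_comp jf)]. Qed.

Section complex_integral.
Context {R : realType} d (T : measurableType d) (mu : {measure set T -> \bar R}).
Implicit Types f g : T -> R[i].

Definition Cint f : R[i] :=
  ((\int[mu]_x complex.Re (f x))%R +i* (\int[mu]_x complex.Im (f x))%R)%C.

Definition Cintegrable f :=
  Cmeas f /\ (\int[mu]_x (cabs (f x))%:E < +oo)%E.

Lemma Cintegrable_le f (g : T -> R) : Cmeas f -> measurable_fun setT g ->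
  (forall x, cabs (f x) <= g x) -> (\int[mu]_x (g x)%:E < +oo)%E ->
  Cintegrable f.
Proof.
move=> mf mg fg gy; split => //; apply: le_lt_trans gy.
apply: ge0_le_integral => //.
- by move=> x _; rewrite lee_fin cabs_ge0.
- exact/measurable_EFinP/measurable_cabs.
- exact/measurable_EFinP.
- by move=> x _; rewrite lee_fin.
Qed.

Lemma integrable_real_le (f g : T -> R) : measurable_fun setT f ->
  measurable_fun setT g -> (forall x, `|f x| <= g x) ->
  (\int[mu]_x (g x)%:E < +oo)%E -> mu.-integrable setT (EFin \o f).
Proof.
move=> mf mg fg gy; apply/integrableP; split; first exact/measurable_EFinP.
apply: le_lt_trans gy; apply: ge0_le_integral => //.
- by apply: measurableT_comp => //; exact/measurable_EFinP.
- exact/measurable_EFinP.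
- by move=> x _ /=; rewrite lee_fin.
Qed.

Lemma Cintegrable_Re f : Cintegrable f ->
  mu.-integrable setT (EFin \o (fun x => complex.Re (f x))).
Proof.
move=> [[rf jf] fy]; apply: (integrable_real_le rf _ _ fy).
  exact: measurable_cabs.
by move=> x; exact: le_Re_cabs.
Qed.

Lemma Cintegrable_Im f : Cintegrable f ->
  mu.-integrable setT (EFin \o (fun x => complex.Im (f x))).
Proof.
move=> [[rf jf] fy]; apply: (integrable_real_le jf _ _ fy).
  exact: measurable_cabs.
by move=> x; exact: le_Im_cabs.
Qed.

Lemma Cintegrable_cabs f : Cintegrable f ->
  mu.-integrable setT (EFin \o (fun x => cabs (f x))).
Proof.
move=> [mf fy]; apply: (integrable_real_le _ _ _ fy).
- exact: measurable_cabs.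
- exact: measurable_cabs.
- by move=> x; rewrite ger0_norm // cabs_ge0.
Qed.

Lemma CintegrableM (c : R[i]) f : Cintegrable f -> Cintegrable (fun x => c * f x).
Proof.
move=> [mf fy]; split; first by apply: CmeasM => //; exact: Cmeas_cst.
under eq_integral do rewrite cabsM EFinM.
rewrite ge0_integralZl_EFin //.
- by rewrite lte_mul_pinfty // lee_fin cabs_ge0.
- by move=> x _; rewrite lee_fin cabs_ge0.
- exact/measurable_EFinP/measurable_cabs.
- exact: cabs_ge0.
Qed.

Lemma CintegrableD f g : Cintegrable f -> Cintegrable g ->
  Cintegrable (fun x => f x + g x).
Proof.
move=> [mf fy] [mg gy].
apply: (@Cintegrable_le _ (fun x => cabs (f x) + cabs (g x))).
- exact: CmeasD.
- by apply: measurable_funD; exact: measurable_cabs.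
- by move=> x; exact: cabsD.
- under eq_integral do rewrite EFinD.
  rewrite ge0_integralD //.
  + by rewrite lte_add_pinfty.
  + by move=> x _; rewrite lee_fin cabs_ge0.
  + exact/measurable_EFinP/measurable_cabs.
  + by move=> x _; rewrite lee_fin cabs_ge0.
  + exact/measurable_EFinP/measurable_cabs.
Qed.

Lemma eq_Cint f g : f =1 g -> Cint f = Cint g.
Proof. by move=> /funext ->. Qed.

Lemma CintD f g : Cintegrable f -> Cintegrable g ->
  Cint (fun x => f x + g x) = Cint f + Cint g.
Proof.
move=> If Ig; rewrite /Cint /=; simpc; congr (_ +i* _)%C.
- under eq_Rintegral do rewrite ReD.
  by rewrite RintegralD //; exact: Cintegrable_Re.
- under eq_Rintegral do rewrite ImD.
  by rewrite RintegralD //; exact: Cintegrable_Im.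
Qed.

Lemma CintZ (c : R[i]) f : Cintegrable f -> Cint (fun x => c * f x) = c * Cint f.
Proof.
move=> If; have iR := Cintegrable_Re If; have iI := Cintegrable_Im If.
have iZ (k : R) (h : T -> R) : mu.-integrable setT (EFin \o h) ->
    mu.-integrable setT (EFin \o (fun x => k * h x)).
  move=> ih; rewrite (_ : _ \o _ = (fun x => k%:E * (h x)%:E)%E) //.
  by apply: integrableZl.
rewrite /Cint; case: c => a b /=; simpc; congr (_ +i* _)%C.
- under eq_Rintegral do rewrite ReM /=.
  rewrite RintegralB //; [|exact: iZ|exact: iZ].
  by rewrite !RintegralZl.
- under eq_Rintegral do rewrite ImM /=.
  rewrite RintegralD //; [|exact: iZ|exact: iZ].
  by rewrite !RintegralZl.
Qed.

Lemma Cint_conj f : Cintegrable f ->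
  Cint (fun x => (f x)^*%C) = (Cint f)^*%C.
Proof.
move=> If; rewrite /Cint /=; congr (_ +i* _)%C.
  by apply: eq_Rintegral => x _; case: (f x).
rewrite -mulN1r -RintegralZl //; last exact: Cintegrable_Im.
by apply: eq_Rintegral => x _; rewrite mulN1r; case: (f x).
Qed.

(** Rotating the value of the integral onto the positive half-line reduces the
    triangle inequality to the one for real parts. *)
Lemma cabs_Cint f : Cintegrable f ->
  ((cabs (Cint f))%:E <= \int[mu]_x (cabs (f x))%:E)%E.
Proof.
move=> If; set I := Cint f.
have iC := Cintegrable_cabs If.
have E : (\int[mu]_x cabs (f x))%R%:E = (\int[mu]_x (cabs (f x))%:E)%E.
  by rewrite fineK //; exact: integrable_fin_num iC.
have [I0|I0] := eqVneq (cabs I) 0.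
  by rewrite I0; apply: integral_ge0 => x _; rewrite lee_fin cabs_ge0.
pose c := (I^*)%C * ((cabs I)^-1)%:C%C.
have cI : c * I = (cabs I)%:C%C.
  rewrite /c mulrAC [(I^*)%C * I]mulrC mulcJ -rmorphM /=.
  by congr (_%:C)%C; rewrite expr2 mulfK.
have c1 : cabs c = 1.
  by rewrite /c cabsM cabs_conj cabs_real ger0_norm ?invr_ge0 ?cabs_ge0 // divff.
have If' := CintegrableM c If.
have : complex.Re (Cint (fun x => c * f x)) = cabs I by rewrite CintZ // cI.
move=> <-; rewrite -E lee_fin /Cint /=.
apply: le_Rintegral => //; first exact: Cintegrable_Re.
move=> x _; apply: le_trans (ler_norm _) _; apply: le_trans (le_Re_cabs _) _.
by rewrite cabsM c1 mul1r.
Qed.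

(** The real and imaginary parts have a sign, so they are split into positive and
    negative parts before the invariance applies. *)
Lemma Cint_preserves f phi : preserves mu phi -> Cmeas f ->
  Cint (fun x => f (phi x)) = Cint f.
Proof.
move=> [mphi pphi] [rf jf].
have H (h : T -> R) : measurable_fun setT h ->
    (\int[mu]_x h (phi x))%R = (\int[mu]_x h x)%R.
  move=> mh; rewrite /Rintegral integralE [in RHS]integralE.
  have mE : measurable_fun setT (EFin \o h) by exact/measurable_EFinP.
  congr (fine (_ - _)).
  - rewrite -(pphi (fun x => ((EFin \o h) ^\+ x)%E)) //.
      by apply: eq_integral => x _; rewrite !funeposE.
    exact: measurable_funepos.
  - rewrite -(pphi (fun x => ((EFin \o h) ^\- x)%E)) //.
      by apply: eq_integral => x _; rewrite !funenegE.
    exact: measurable_funeneg.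
by rewrite /Cint; congr (_ +i* _)%C; [apply: (H (fun x => complex.Re (f x)))|apply: (H (fun x => complex.Im (f x)))].
Qed.

Lemma Cintegrable_preserves f phi : preserves mu phi -> Cintegrable f ->
  Cintegrable (fun x => f (phi x)).
Proof.
move=> [mphi pphi] [mf fy]; split; first exact: (Cmeas_comp mf).
rewrite (pphi (fun x => (cabs (f x))%:E)) //.
- exact/measurable_EFinP/measurable_cabs.
- by move=> x; rewrite lee_fin cabs_ge0.
Qed.

End complex_integral.

Section complex_fubini.
Context {R : realType} d1 d2 (T1 : measurableType d1) (T2 : measurableType d2).
Variables (m1 : {sigma_finite_measure set T1 -> \bar R})
          (m2 : {sigma_finite_measure set T2 -> \bar R}).
Implicit Types f : T1 * T2 -> R[i].

Let Rfub (h : T1 * T2 -> R) : (m1 \x m2)%E.-integrable setT (EFin \o h) ->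
  (\int[m1]_x \int[m2]_y h (x, y))%R = (\int[m2]_y \int[m1]_x h (x, y))%R.
Proof.
move=> ih; have mh := measurable_int _ ih.
rewrite /Rintegral; congr fine.
transitivity (\int[m1]_x \int[m2]_y (EFin \o h) (x, y))%E.
  apply: ae_eq_integral => //.
  - apply/measurable_EFinP; apply: (measurableT_comp (fine_measurable measurableT)).
    exact: (measurable_fubini_F ih).
  - exact: (measurable_fubini_F ih).
  - have := ae_integrable1 ih; apply: filterS => x ix _.
    by rewrite /= fineK //; exact: integrable_fin_num ix.
rewrite (Fubini ih); apply: ae_eq_integral => //.
- exact: (measurable_fubini_G ih).
- apply/measurable_EFinP; apply: (measurableT_comp (fine_measurable measurableT)).
  exact: (measurable_fubini_G ih).
- have := ae_integrable2 ih; apply: filterS => x ix _.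
  by rewrite /= fineK //; exact: integrable_fin_num ix.
Qed.

Lemma Cfubini f : Cintegrable (m1 \x m2)%E f ->
  Cint m1 (fun x => Cint m2 (fun y => f (x, y))) =
  Cint m2 (fun y => Cint m1 (fun x => f (x, y))).
Proof.
move=> If; rewrite /Cint /=; congr (_ +i* _)%C.
- exact: (Rfub (Cintegrable_Re If)).
- exact: (Rfub (Cintegrable_Im If)).
Qed.

Lemma Cmeas_fubini1 f : Cintegrable (m1 \x m2)%E f ->
  Cmeas (fun x => Cint m2 (fun y => f (x, y))).
Proof.
move=> If; split.
- apply: (measurableT_comp (fine_measurable measurableT)).
  exact: (measurable_fubini_F (Cintegrable_Re If)).
- apply: (measurableT_comp (fine_measurable measurableT)).
  exact: (measurable_fubini_F (Cintegrable_Im If)).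
Qed.

Lemma Cmeas_fubini2 f : Cintegrable (m1 \x m2)%E f ->
  Cmeas (fun y => Cint m1 (fun x => f (x, y))).
Proof.
move=> If; split.
- apply: (measurableT_comp (fine_measurable measurableT)).
  exact: (measurable_fubini_G (Cintegrable_Re If)).
- apply: (measurableT_comp (fine_measurable measurableT)).
  exact: (measurable_fubini_G (Cintegrable_Im If)).
Qed.

Lemma Cintegrable_prod12 f : Cmeas f ->
  (\int[m1]_x \int[m2]_y (cabs (f (x, y)))%:E < +oo)%E ->
  Cintegrable (m1 \x m2)%E f.
Proof.
move=> mf fy; split => //; rewrite fubini_tonelli1 //.
- exact/measurable_EFinP/measurable_cabs.
- by move=> x; rewrite lee_fin cabs_ge0.
Qed.

Lemma Cintegrable_prod21 f : Cmeas f ->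
  (\int[m2]_y \int[m1]_x (cabs (f (x, y)))%:E < +oo)%E ->
  Cintegrable (m1 \x m2)%E f.
Proof.
move=> mf fy; split => //; rewrite fubini_tonelli2 //.
- exact/measurable_EFinP/measurable_cabs.
- by move=> x; rewrite lee_fin cabs_ge0.
Qed.

End complex_fubini.

(** * Complex exponential and Hermitian product *)

Section complex_exponential.
Context {R : realType}.
Implicit Types (z w : R[i]).

Definition cexp z : R[i] :=
  (expR (complex.Re z) * cos (complex.Im z) +i*
   (expR (complex.Re z) * sin (complex.Im z)))%C.

Lemma cexp0 : cexp 0 = 1.
Proof. by rewrite /cexp /= expR0 cos0 sin0 mulr1 mulr0. Qed.

Lemma cexpD z w : cexp (z + w) = cexp z * cexp w.
Proof.
case: z w => a b [c d]; rewrite /cexp /= expRD cosD sinD; simpc.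
by congr (_ +i* _)%C; ring.
Qed.

Lemma cexp_conj z : cexp z^*%C = (cexp z)^*%C.
Proof. by case: z => a b; rewrite /cexp /= cosN sinN mulrN. Qed.

Lemma cexp_real (x : R) : cexp x%:C%C = (expR x)%:C%C.
Proof. by rewrite /cexp /= cos0 sin0 mulr1 mulr0. Qed.

Lemma cabs_cexp z : cabs (cexp z) = expR (complex.Re z).
Proof.
case: z => a b; rewrite /cexp /cabs /= !exprMn -mulrDr cos2Dsin2 mulr1.
by rewrite sqrtr_sqr ger0_norm // expR_ge0.
Qed.

Lemma cexp_neq0 z : cexp z != 0.
Proof.
apply/eqP => z0; have := cabs_cexp z; rewrite z0 cabs0 => /eqP.
by rewrite eq_sym gt_eqF // expR_gt0.
Qed.

Lemma cexpN z : cexp (- z) = (cexp z)^-1.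
Proof.
by apply: (mulIf (cexp_neq0 z)); rewrite -cexpD addNr cexp0 mulVf // cexp_neq0.
Qed.

Lemma Cmeas_cexp d (T : measurableType d) (f : T -> R[i]) :
  Cmeas f -> Cmeas (fun x => cexp (f x)).
Proof.
move=> [rf jf]; split => /=; apply: measurable_funM; apply: measurableT_comp => //.
- by apply: continuous_measurable_fun; exact: continuous_cos.
- by apply: continuous_measurable_fun; exact: continuous_sin.
Qed.

Lemma mean_value_at0 (f df : R -> R) (x : R) : (forall y : R, is_derive y 1 f (df y)) ->
  exists2 xi, `|xi| <= `|x| & f x - f 0 = df xi * x.
Proof.
move=> fdf.
have cf a b : {within `[a, b], continuous f}.
  apply: derivable_within_continuous => y _; exact: (@ex_derive _ _ _ _ _ _ _ (fdf y)).
have [x0|x0] := leP 0 x.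
  have [c /[!in_itv]/= /andP[c0 cx] E] := MVT_segment x0 (fun y _ => fdf y) (cf _ _).
  by exists c; rewrite ?ger0_norm // E subr0.
have [c /[!in_itv]/= /andP[cx c0] E] := MVT_segment (ltW x0) (fun y _ => fdf y) (cf _ _).
exists c; first by rewrite ler0_norm // ltr0_norm // lerN2.
by rewrite -[LHS]opprB E sub0r mulrN opprK.
Qed.

Lemma expR_sub1_le (x : R) : `|expR x - 1| <= `|x| * expR `|x|.
Proof.
have [xi xix] := mean_value_at0 x (fun y => @is_derive_expR R y).
rewrite expR0 => ->; rewrite normrM mulrC ler_wpM2l //.
by rewrite ger0_norm ?expR_ge0 // ler_expR (le_trans _ xix) // ler_norm.
Qed.

Lemma expR_taylor1_le (x : R) : `|expR x - 1 - x| <= `|x| ^+ 2 * expR `|x|.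
Proof.
have [xi xix] := mean_value_at0 x (fun y => @is_derive_expR R y).
rewrite expR0 => ->; rewrite -{2}[x]mul1r -mulrBl normrM mulrC expr2 -mulrA ler_wpM2l //.
apply: le_trans (expR_sub1_le xi) _.
by rewrite ler_pM ?expR_ge0 // ler_expR.
Qed.

Lemma sin_le_norm (x : R) : `|sin x| <= `|x|.
Proof.
have [xi _] := mean_value_at0 x (fun y => @is_derive_sin R y).
rewrite sin0 subr0 => ->; rewrite normrM ler_piMl //.
by rewrite ler_norml cos_geN1 cos_le1.
Qed.

Lemma cos_taylor_le (x : R) : `|cos x - 1| <= `|x| ^+ 2.
Proof.
have [xi xix] := mean_value_at0 x (fun y => @is_derive_cos R y).
rewrite cos0 => ->; rewrite normrM normrN expr2 ler_wpM2r //.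
by apply: le_trans (sin_le_norm xi) _.
Qed.

Lemma cos_sub1_le (x : R) : `|cos x - 1| <= `|x|.
Proof.
have [xi _] := mean_value_at0 x (fun y => @is_derive_cos R y).
rewrite cos0 => ->; rewrite normrM normrN ler_piMl //.
by rewrite ler_norml sin_geN1 sin_le1.
Qed.

Lemma sin_taylor_le (x : R) : `|sin x - x| <= `|x| ^+ 2.
Proof.
have [xi xix] := mean_value_at0 x (fun y => @is_derive_sin R y).
rewrite sin0 subr0 => ->; rewrite -{2}[x]mul1r -mulrBl normrM expr2 ler_wpM2r //.
exact: le_trans (cos_sub1_le xi) _.
Qed.

(** Both Taylor remainders, at a point and under an integral sign, are controlled
    by this bound, so its growth in [z] matters but the constant does not. *)
Lemma cexp_taylor1_le z :
  cabs (cexp z - 1 - z) <= 3 * cabs z ^+ 2 * expR (cabs z).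
Proof.
case: z => x y; set z := (x +i* y)%C; set E := expR `|x|.
have E0 : 0 <= E by exact: expR_ge0.
have Ez : E <= expR (cabs z) by rewrite ler_expR; exact: (le_Re_cabs z).
have xE : expR x <= E by rewrite ler_expR ler_norm.
have h1 : `|expR x * cos y - 1 - x| <= `|x| ^+ 2 * E + E * `|y| ^+ 2.
  rewrite (_ : _ - x = (expR x - 1 - x) + expR x * (cos y - 1)); last by ring.
  apply: le_trans (ler_normD _ _) _; apply: lerD; first exact: expR_taylor1_le.
  by rewrite normrM ger0_norm ?expR_ge0 // ler_pM ?expR_ge0 // cos_taylor_le.
have h2 : `|expR x * sin y - y| <= E * `|y| ^+ 2 + `|x| * `|y| * E.
  rewrite (_ : _ - y = expR x * (sin y - y) + (expR x - 1) * y); last by ring.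
  apply: le_trans (ler_normD _ _) _; apply: lerD.
    by rewrite normrM ger0_norm ?expR_ge0 // ler_pM ?expR_ge0 // sin_taylor_le.
  by rewrite normrM mulrAC ler_wpM2r // expR_sub1_le.
apply: le_trans (cabs_le_ReIm _) _.
have -> : complex.Re (cexp z - 1 - z) = expR x * cos y - 1 - x by [].
have -> : complex.Im (cexp z - 1 - z) = expR x * sin y - y by rewrite /= subr0.
apply: le_trans (lerD h1 h2) _.
apply: le_trans (_ : 3 * cabs z ^+ 2 * E <= _); last first.
  by rewrite ler_wpM2l // mulr_ge0 // sqr_ge0.
rewrite cabs_sqr /= -(real_normK (num_real x)) -(real_normK (num_real y)).
have := sqr_ge0 (`|x| - `|y|); set a := `|x|; set b := `|y| => ab.
have : 0 <= (a ^+ 2 * 2 + b ^+ 2 - a * b) * E.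
  apply: mulr_ge0 => //; have := sqr_ge0 a; nra.
lra.
Qed.

End complex_exponential.


Section hermitian_product.
Context {R : realType} (n : nat).
Local Notation Cn := 'rV[R[i]]_n.
Implicit Types (z w u v : Cn) (a b : R[i]).

Definition hdot z w : R[i] := \sum_(j < n) z ord0 j * ((w ord0 j)^*)%C.

Lemma hdotDl z w u : hdot (z + w) u = hdot z u + hdot w u.
Proof. by rewrite -big_split; apply: eq_bigr => j _; rewrite mxE mulrDl. Qed.

Lemma hdotDr z w u : hdot z (w + u) = hdot z w + hdot z u.
Proof. by rewrite -big_split; apply: eq_bigr => j _; rewrite mxE rmorphD mulrDr. Qed.

Lemma hdotZl a z w : hdot (a *: z) w = a * hdot z w.
Proof. by rewrite mulr_sumr; apply: eq_bigr => j _; rewrite mxE mulrA. Qed.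

Lemma hdotZr a z w : hdot z (a *: w) = (a^*)%C * hdot z w.
Proof. by rewrite mulr_sumr; apply: eq_bigr => j _; rewrite mxE rmorphM mulrCA. Qed.

Lemma hdotNl z w : hdot (- z) w = - hdot z w.
Proof. by rewrite -scaleN1r hdotZl mulN1r. Qed.

Lemma hdotNr z w : hdot z (- w) = - hdot z w.
Proof. by rewrite -scaleN1r hdotZr rmorphN rmorph1 mulN1r. Qed.

Lemma hdotC z w : hdot z w = ((hdot w z)^*)%C.
Proof.
rewrite rmorph_sum; apply: eq_bigr => j _.
by rewrite rmorphM /= conjcK mulrC.
Qed.

Lemma hdotxx z : hdot z z = (csqn z)%:C%C.
Proof. by rewrite rmorph_sum; apply: eq_bigr => j _; rewrite mulcJ. Qed.

Lemma hdot0l w : hdot 0 w = 0.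
Proof. by rewrite -(scale0r (0 : Cn)) hdotZl mul0r. Qed.

Lemma hdot0r w : hdot w 0 = 0.
Proof. by rewrite hdotC hdot0l conjc0. Qed.

Lemma csqn_ge0 z : 0 <= csqn z.
Proof. by apply: sumr_ge0 => j _; rewrite sqr_ge0. Qed.

Lemma csqnE z : csqn z = complex.Re (hdot z z).
Proof. by rewrite hdotxx. Qed.

(** Bilinear, in contrast to [hdot z z]: [csq] is holomorphic in [z]. *)
Definition csq z : R[i] := \sum_(j < n) z ord0 j * z ord0 j.

Section measurable_vectors.
Context d (T : measurableType d).
Implicit Types phi psi : T -> Cn.

Definition Vmeas phi := forall j, Cmeas (fun t => phi t ord0 j).

Lemma Vmeas_cst v : Vmeas (fun=> v).
Proof. by move=> j; exact: Cmeas_cst. Qed.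

Lemma VmeasD phi psi : Vmeas phi -> Vmeas psi -> Vmeas (fun t => phi t + psi t).
Proof. by move=> mp mq j; under eq_fun do rewrite mxE; exact: CmeasD. Qed.

Lemma VmeasN phi : Vmeas phi -> Vmeas (fun t => - phi t).
Proof. by move=> mp j; under eq_fun do rewrite mxE; exact: CmeasN. Qed.

Lemma VmeasB phi psi : Vmeas phi -> Vmeas psi -> Vmeas (fun t => phi t - psi t).
Proof. by move=> mp mq; apply: VmeasD => //; exact: VmeasN. Qed.

Lemma VmeasZ (f : T -> R[i]) phi : Cmeas f -> Vmeas phi -> Vmeas (fun t => f t *: phi t).
Proof. by move=> mf mp j; under eq_fun do rewrite mxE; exact: CmeasM. Qed.

Lemma Cmeas_hdot phi psi : Vmeas phi -> Vmeas psi -> Cmeas (fun t => hdot (phi t) (psi t)).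
Proof. by move=> mp mq; apply: Cmeas_sum => j; apply: CmeasM => //; exact: Cmeas_conj. Qed.

Lemma Cmeas_csq phi : Vmeas phi -> Cmeas (fun t => csq (phi t)).
Proof. by move=> mp; apply: Cmeas_sum => j; exact: CmeasM. Qed.

Lemma measurable_csqn_comp phi : Vmeas phi -> measurable_fun setT (fun t => csqn (phi t)).
Proof.
move=> mp; rewrite (_ : (fun t => _) = fun t => complex.Re (hdot (phi t) (phi t))).
  exact: (Cmeas_hdot mp mp).1.
by apply/funext => t; rewrite csqnE.
Qed.

Lemma Vmeas_cvec (f : T -> n.-tuple R * n.-tuple R) :
  measurable_fun setT f -> Vmeas (fun t => cvec (f t)).
Proof.
move=> mf j; split; under eq_fun do rewrite mxE /=.
- exact: (measurableT_comp (measurable_tnth j) (measurableT_comp measurable_fst mf)).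
- exact: (measurableT_comp (measurable_tnth j) (measurableT_comp measurable_snd mf)).
Qed.

End measurable_vectors.
End hermitian_product.

(** * Holomorphic functions: differentiability and measurability *)

Section complex_topology.
Context {R : realType}.
Local Notation C := R[i].

Lemma normCE (z : C) : `|z| = (cabs z)%:C%C.
Proof. by case: z => a b; rewrite normc_def. Qed.

Lemma posC (e : C) : 0 < e -> exists2 r : R, 0 < r & e = r%:C%C.
Proof.
case: e => a b; rewrite ltcE /= => /andP[/eqP -> a0].
by exists a.
Qed.

(** Differentiability with a guessed differential, the remainder being estimated
    by hand. *)
Lemma differentiable_intro (K : numFieldType) (V W : normedModType K)
    (f L : V -> W) (x : V) : linear L -> continuous L ->
  (forall e : K, 0 < e -> \forall h \near (0 : V),
     `|f (h + x) - f x - L h| <= e * `|h|) ->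
  differentiable f x.
Proof.
move=> lin_L Lc H; pose LM := GRing.isLinear.Build _ _ _ _ _ lin_L.
pose LL : {linear V -> W} := HB.pack L LM.
have key : f \o shift x = cst (f x) + LL +o_ (0 : V) id.
  apply/eqaddoP => e e0; near=> h; rewrite /= opprD addrA.
  by near: h; exact: H.
have dE := @diff_unique _ _ _ _ LL _ Lc key.
by apply/diff_locallyP; rewrite dE.
Unshelve. all: by end_near. Qed.

(** Complex differentiability with all moduli in the real field, the form in which
    the Cauchy-Riemann equations are read off. *)
Definition Cdiff1 (H : C -> C) (u : C) := exists D : C, forall e : R, 0 < e ->
  exists2 r : R, 0 < r & forall v, cabs (v - u) < r ->
    cabs (H v - H u - D * (v - u)) <= e * cabs (v - u).

Lemma differentiable_Cdiff1 (H : C^o -> C^o) u : differentiable H u -> Cdiff1 H u.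
Proof.
move=> dH; exists ('d H u 1) => e e0.
have /eqaddoP/(_ e%:C%C) := diff_locally dH.
rewrite ltcR => /(_ e0) /nbhs_ballP[r0 /= r00 Hr].
have [r r0' rE] := posC r00; exists r => // v vr.
have := Hr (v - u); rewrite -ball_normE /= sub0r normrN normCE rE ltcR => /(_ vr).
rewrite !normCE -rmorphM lecR.
have -> : (H \o shift u - (cst (H u) + 'd H u)) (v - u) =
    H (v - u + u) - (H u + 'd H u (v - u)) by [].
rewrite subrK opprD addrA.
suff -> : 'd H u (v - u) = 'd H u 1 * (v - u) by [].
by rewrite -[in LHS](mulr1 (v - u)) linearZ /= mulrC.
Qed.

Lemma cexp_differentiable (u : C^o) : differentiable (cexp : C^o -> C^o) u.
Proof.
pose d (h : C^o) : C^o := h *: (cexp u : C^o).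
have lin_d : linear d by move=> ? ? ?; rewrite /d scalerDl scalerA.
apply: (@differentiable_intro _ _ _ _ d _ lin_d); first exact: scalel_continuous.
move=> e /posC[r r0 ->].
pose M := cabs (cexp u) * (3 * expR 1) + 1.
have M0 : 0 < M by rewrite ltr_wpDl // !mulr_ge0 ?cabs_ge0 ?expR_ge0.
pose del := Num.min 1 (r / M).
have d0 : 0 < del by rewrite lt_min ltr01 divr_gt0.
apply/nbhs_ballP; exists del%:C%C; first by rewrite /= ltcR.
move=> h; rewrite -ball_normE /= sub0r normrN !normCE ltcR lt_min => /andP[h1 hr].
rewrite -rmorphM lecR cexpD.
rewrite (_ : _ - _ - _ = cexp u * (cexp h - 1 - h)); last first.
  by rewrite /d /GRing.scale /=; ring.
rewrite cabsM.
apply: le_trans (_ : cabs (cexp u) * (3 * cabs h ^+ 2 * expR 1) <= _).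
  rewrite ler_wpM2l ?cabs_ge0 //; apply: le_trans (cexp_taylor1_le h) _.
  by rewrite ler_wpM2l ?ler_expR ?(ltW h1) // mulr_ge0 // sqr_ge0.
have -> : cabs (cexp u) * (3 * cabs h ^+ 2 * expR 1) =
   (cabs (cexp u) * (3 * expR 1) * cabs h) * cabs h by ring.
rewrite ler_wpM2r ?cabs_ge0 //.
apply: le_trans (_ : M * cabs h <= _).
  by rewrite ler_wpM2r ?cabs_ge0 // lerDl.
by rewrite mulrC -ler_pdivlMr // ltW.
Qed.

Section vectors.
Variable n : nat.
Local Notation Cn := 'rV[C]_n.

Lemma le_coord_norm (h : Cn) j : `|h ord0 j| <= `|h|.
Proof.
have [//|hl] := real_leP (normr_real (h ord0 j)) (normr_real h).
have : ball_ (fun x : Cn => `|x|) 0 `|h ord0 j| h by rewrite /ball_ /= sub0r normrN.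
rewrite -mx_norm_ball => -[_ /(_ ord0 j)].
by rewrite -ball_normE /= mxE sub0r normrN ltxx.
Qed.

Lemma continuous_eps (F : Cn -> C) (z : Cn) : entire F ->
  forall e : R, 0 < e -> exists2 r : R, 0 < r &
    forall v : Cn, (forall j, cabs (v ord0 j - z ord0 j) < r) -> cabs (F v - F z) < e.
Proof.
move=> /(_ z) /differentiable_continuous /cvgrPdist_lt Fc e e0.
have := Fc e%:C%C; rewrite ltcR => /(_ e0) /nbhs_ballP[r0 /= r00 Hr].
have [r r0' rE] := posC r00; exists r => // v vr.
have := Hr v; rewrite normCE ltcR cabsB; apply; split => // i j.
by rewrite -ball_normE /= normCE rE ltcR cabsB ord1.
Qed.

(** Rounding every coordinate down to a multiple of [2^-k] makes a vector take
    countably many values, so a continuous function is a pointwise limit of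
    measurable step functions. *)
Definition fgrid (k : nat) (x : R) : R := (Num.floor (x * 2 ^+ k))%:~R / 2 ^+ k.

Lemma fgrid_dist k x : `|fgrid k x - x| <= 2 ^- k.
Proof.
have k0 : (0 : R) < 2 ^+ k by rewrite exprn_gt0.
have h2 := floor_le (x * 2 ^+ k); have := floorD1_gt (x * 2 ^+ k).
rewrite intrD1 /fgrid; set m : R := _%:~R in h2 *; set c : R := 2 ^+ k in k0 h2 * => h1.
have -> : m / c - x = (m - x * c) / c by field; rewrite gt_eqF.
rewrite normrM (gtr0_norm (x := c^-1)) ?invr_gt0 // ler_pdivrMr // mulVf ?gt_eqF //.
by rewrite ler_norml; apply/andP; split; lra.
Qed.

Definition grid (k : nat) (z : Cn) : Cn :=
  \row_j (fgrid k (complex.Re (z ord0 j)) +i* fgrid k (complex.Im (z ord0 j)))%C.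

Definition gridZ k (z : Cn) : {ffun 'I_n -> int * int} :=
  [ffun j => (Num.floor (complex.Re (z ord0 j) * 2 ^+ k),
              Num.floor (complex.Im (z ord0 j) * 2 ^+ k))].

Definition gridV k (m : {ffun 'I_n -> int * int}) : Cn :=
  \row_j ((m j).1%:~R / 2 ^+ k +i* ((m j).2%:~R / 2 ^+ k))%C.

Lemma grid_gridZ k z : grid k z = gridV k (gridZ k z).
Proof. by apply/rowP => j; rewrite !mxE ffunE. Qed.

Lemma grid_dist k z j : cabs (grid k z ord0 j - z ord0 j) <= 2 ^- k * 2.
Proof.
apply: le_trans (cabs_le_ReIm _) _; rewrite mxE mulr_natr mulr2n.
by case: (z ord0 j) => a b /=; apply: lerD; exact: fgrid_dist.
Qed.

Lemma measurable_floor_eq d (T : measurableType d) (f : T -> R) (k : nat) (a : int) :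
  measurable_fun setT f -> measurable [set t | Num.floor (f t * 2 ^+ k) = a].
Proof.
move=> mf.
have mg : measurable_fun setT (fun t => f t * 2 ^+ k).
  by apply: measurable_funM => //; exact: measurable_cst.
have := mg measurableT _ (measurable_itv `[a%:~R, (a + 1)%:~R[).
rewrite setTI; congr measurable; apply/seteqP; split => t /=; rewrite in_itv /=.
  by move=> h; apply: floor_def.
by move=> <-; rewrite floor_le floorD1_gt.
Qed.

Lemma measurable_gridZ d (T : measurableType d) (phi : T -> Cn) k m :
  Vmeas phi -> measurable [set t | gridZ k (phi t) = m].
Proof.
move=> mp.
rewrite (_ : [set t | _] = \bigcap_(j in [set: 'I_n])
   ([set t | Num.floor (complex.Re (phi t ord0 j) * 2 ^+ k) = (m j).1] `&`
    [set t | Num.floor (complex.Im (phi t ord0 j) * 2 ^+ k) = (m j).2])).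
  apply: fin_bigcap_measurable; first exact: finite_finset.
  by move=> j _; apply: measurableI; apply: measurable_floor_eq; have [] := mp j.
apply/seteqP; split => t /=.
  by move=> <- j _ /=; rewrite ffunE.
move=> h; apply/ffunP => j; rewrite ffunE; have [/= -> ->] := h j I.
by case: (m j).
Qed.

(** The values on the grid are measurable step functions, and they converge
    pointwise by continuity. *)
Lemma Cmeas_entire d (T : measurableType d) (F : Cn -> C) (phi : T -> Cn) :
  entire F -> Vmeas phi -> Cmeas (fun t => F (phi t)).
Proof.
move=> cF mp.
have step k (p : C -> R) : measurable_fun setT (fun t => p (F (grid k (phi t)))).
  move=> _ B mB; rewrite setTI.
  pose A i := if unpickle i is Some m then
     [set t | gridZ k (phi t) = m /\ B (p (F (gridV k m)))] else set0.
  rewrite (_ : _ @^-1` _ = \bigcup_i A i).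
    apply: bigcupT_measurable => i; rewrite /A; case: unpickle => [m|//].
    have [Bm|Bm] := pselect (B (p (F (gridV k m)))).
      rewrite (_ : [set t | _] = [set t | gridZ k (phi t) = m]); first exact: measurable_gridZ.
      by apply/seteqP; split => t /=; [case|split].
    rewrite (_ : [set t | _] = set0) //.
    by apply/seteqP; split => t //= [].
  apply/seteqP; split => t /=.
    rewrite grid_gridZ => Bt; exists (pickle (gridZ k (phi t))) => //.
    by rewrite /A pickleK.
  move=> [i _]; rewrite /A; case: unpickle => [m|//] /= [<-].
  by rewrite grid_gridZ.
have lim (p : C -> R) : (forall z w, `|p z - p w| <= cabs (z - w)) -> forall t,
    p (F (grid k (phi t))) @[k --> \oo] --> p (F (phi t)).
  move=> hp t; apply/cvgrPdist_lt => e e0.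
  have [r r0 H] := continuous_eps (phi t) cF e0.
  have r2 : 0 < r / 2 by rewrite divr_gt0.
  near=> k; rewrite distrC; apply: le_lt_trans (hp _ _) _; apply: H => j.
  apply: le_lt_trans (grid_dist _ _ _) _; rewrite -ltr_pdivlMr // -div1r.
  near: k; exact: near_infty_natSinv_expn_lt (PosNum r2).
split.
- apply: (measurable_fun_cvg (h := fun k t => complex.Re (F (grid k (phi t))))).
    by move=> k; exact: step.
  move=> t _; apply: lim => z w.
  by rewrite -(ReN w) -ReD; exact: le_Re_cabs.
- apply: (measurable_fun_cvg (h := fun k t => complex.Im (F (grid k (phi t))))).
    by move=> k; exact: step.
  move=> t _; apply: lim => z w.
  by rewrite -(ImN w) -ImD; exact: le_Im_cabs.
Unshelve. all: by end_near. Qed.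

End vectors.
End complex_topology.

(** * Circle means of entire functions *)

Section interval_integral.
Context {R : realType}.
Implicit Types (f : R -> R) (a b m M : R).

(** The interval is half open so that adjacent integrals add up without overlap. *)
Definition Iint a b f : R := (\int[@lebesgue_measure R]_(x in `[a, b[) f x)%R.

Lemma integrable_cont f a b : continuous f ->
  (@lebesgue_measure R).-integrable `[a, b[ (EFin \o f).
Proof.
move=> cf; apply: (@integrableS _ _ _ lebesgue_measure `[a, b]) => //.
  by apply: subset_itvl; rewrite bnd_simp.
apply: continuous_compact_integrable; first exact: segment_compact.
by apply: continuous_subspaceT.
Qed.

Lemma Iint_split f a m b : continuous f -> a <= m -> m <= b ->
  Iint a b f = Iint a m f + Iint m b f.
Proof.
move=> cf am mb; rewrite /Iint (@itv_bndbnd_setU _ _ _ (BLeft m)) ?bnd_simp //.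
rewrite Rintegral_setU //=.
- by rewrite -itv_bndbnd_setU ?bnd_simp //; exact: integrable_cont.
- apply/disj_setPS => y [/=]; rewrite 2!in_itv/= => /andP[_ yx] /andP[].
  by rewrite leNgt yx.
Qed.

Lemma Iint_cst a b (c : R) : a <= b -> Iint a b (fun=> c) = c * (b - a).
Proof.
move=> ab; rewrite /Iint Rintegral_cst //= lebesgue_measure_itv /= lte_fin.
rewrite lt_neqAle ab andbT; have [->|_] := eqVneq a b.
  by rewrite /= subrr.
by [].
Qed.

Lemma Iint_bound f a b c M : continuous f -> a <= b ->
  (forall x, a <= x <= b -> `|f x - c| <= M) ->
  `|Iint a b f - c * (b - a)| <= M * (b - a).
Proof.
move=> cf ab H.
have cc (k : R) : continuous ((fun=> k) : R -> R) by exact: cst_continuous.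
have h1 : Iint a b f <= Iint a b (fun=> c + M).
  apply: le_Rintegral => //; [exact: integrable_cont|exact: integrable_cont|].
  move=> x /=; rewrite in_itv /= => /andP[ax xb].
  by have := H x; rewrite ax ltW //= ler_distl => /(_ isT)/andP[].
have h2 : Iint a b (fun=> c - M) <= Iint a b f.
  apply: le_Rintegral => //; [exact: integrable_cont|exact: integrable_cont|].
  move=> x /=; rewrite in_itv /= => /andP[ax xb].
  by have := H x; rewrite ax ltW //= ler_distl => /(_ isT)/andP[].
move: h1 h2; rewrite !Iint_cst // => h1 h2.
by rewrite ler_distl -mulrBl -mulrDl h1 h2.
Qed.

End interval_integral.

Section goursat.
Context {R : realType}.
Variables U V : R -> R -> R.

(** Real differentiability of [W] at [(x, y)] with partial derivatives [a] and [b]. *)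
Definition Rdiff2 (W : R -> R -> R) (x y a b : R) :=
  forall e, 0 < e -> exists2 r : R, 0 < r & forall x' y',
    `|x' - x| < r -> `|y' - y| < r ->
    `|W x' y' - W x y - a * (x' - x) - b * (y' - y)| <=
      e * (`|x' - x| + `|y' - y|).

(** One half of the Cauchy-Riemann equations: the form [U dx - V dy] is closed. *)
Hypothesis UV : forall x y, exists a b c,
  Rdiff2 U x y a (- b) /\ Rdiff2 V x y b c.

Lemma Rdiff2_continuous1 (W : R -> R -> R) x y a b : Rdiff2 W x y a b ->
  {for x, continuous (fun s => W s y)}.
Proof.
move=> dW; apply/cvgrPdist_lt => e e0.
have [r r0 Hr] := dW 1 ltr01.
pose M := `|a| + 1.
have M0 : 0 < M by rewrite ltr_wpDl.
have d0 : 0 < Num.min r (e / M) by rewrite lt_min r0 divr_gt0.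
near=> s.
have : `|x - s| < Num.min r (e / M) by near: s; exact: cvgr_dist_lt.
rewrite distrC lt_min => /andP[sr sM].
have := Hr s y sr; rewrite subrr normr0 => /(_ r0); rewrite mulr0 subr0 addr0 mul1r => h.
rewrite distrC.
apply: le_lt_trans (_ : `|W s y - W x y - a * (s - x)| + `|a * (s - x)| < e).
  by apply: le_trans (ler_normD _ _); rewrite subrK.
apply: le_lt_trans (lerD h (lexx _)) _.
rewrite normrM -{1}[`|s - x|]mul1r -mulrDl addrC -/M mulrC.
by rewrite -ltr_pdivlMr.
Unshelve. all: by end_near. Qed.

Lemma Rdiff2_swap (W : R -> R -> R) x y a b : Rdiff2 W x y a b ->
  Rdiff2 (fun s t => W t s) y x b a.
Proof.
move=> dW e e0; have [r r0 Hr] := dW e e0; exists r => // x' y' hx hy.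
by rewrite addrAC [X in _ <= _ * X]addrC; exact: Hr.
Qed.

Let cU y : continuous (U^~ y).
Proof.
move=> x; have [a [b [c [hU hV]]]] := UV x y.
exact: Rdiff2_continuous1 hU.
Qed.

Let cV x : continuous (V x).
Proof.
move=> y; have [a [b [c [hU hV]]]] := UV x y.
exact: (Rdiff2_continuous1 (Rdiff2_swap hV)).
Qed.

(** The integral of [U dx - V dy] along the boundary of the rectangle with
    lower left corner [(x, y)] and side lengths [p] and [q]. *)
Definition boundary_int x y p q : R :=
  Iint x (x + p) (U^~ y) - Iint x (x + p) (U^~ (y + q))
  - Iint y (y + q) (V (x + p)) + Iint y (y + q) (V x).

Let J := boundary_int.

(** The integrals along the interior edges cancel in pairs. *)
Lemma boundary_int_quarter x y p q : 0 <= p -> 0 <= q ->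
  J x y (p * 2) (q * 2) =
  J x y p q + J (x + p) y p q + J x (y + q) p q + J (x + p) (y + q) p q.
Proof.
move=> p0 q0; rewrite /J /boundary_int.
have sx y' : Iint x (x + p * 2) (U^~ y') = Iint x (x + p) (U^~ y') + Iint (x + p) (x + p + p) (U^~ y').
  by rewrite (_ : x + p * 2 = x + p + p); [apply: Iint_split => //; lra|ring].
have sy x' : Iint y (y + q * 2) (V x') = Iint y (y + q) (V x') + Iint (y + q) (y + q + q) (V x').
  by rewrite (_ : y + q * 2 = y + q + q); [apply: Iint_split => //; lra|ring].
rewrite !sx !sy (_ : x + p * 2 = x + p + p); last by ring.
rewrite (_ : y + q * 2 = y + q + q); last by ring.
ring.
Qed.

(** The first-order parts of [U] and [V] at [(x, y)] contribute nothing, because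
    the form is closed there; only the remainders are left. *)
Lemma boundary_int_local x y (e : R) : 0 < e -> exists2 r, 0 < r &
  forall x' y' p q, x' <= x <= x' + p -> y' <= y <= y' + q -> p < r -> q < r ->
    `|J x' y' p q| <= 2 * e * (p + q) ^+ 2.
Proof.
move=> e0; have [a [b [c [hU hV]]]] := UV x y.
have [r1 r10 H1] := hU e e0; have [r2 r20 H2] := hV e e0.
exists (Num.min r1 r2); first by rewrite lt_min r10.
move=> x' y' p q /andP[x1 x2] /andP[y1 y2]; rewrite !lt_min => /andP[p1 p2] /andP[q1 q2].
have p0 : 0 <= p by lra. have q0 : 0 <= q by lra.
have near s (d : R) u v : u <= s <= u + d -> u <= v <= u + d -> `|v - s| <= d.
  by move=> /andP[? ?] /andP[? ?]; rewrite ler_norml; apply/andP; split; lra.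
have BU : `|Iint x' (x' + p) (fun s => U s y' - U s (y' + q)) - b * q * (x' + p - x')| <= 2 * e * (p + q) * (x' + p - x').
  apply: Iint_bound; [|lra|].
    by move=> s; apply: cvgB; exact: cU.
  move=> s xs.
  have s1 : `|s - x| <= p by apply: (near _ _ x') => //; rewrite x1.
  have t1 : `|y' - y| <= q by apply: (near _ _ y'); rewrite ?y1 // lexx lerDl.
  have t2 : `|y' + q - y| <= q by apply: (near _ _ y'); rewrite ?y1 // lexx lerDl q0.
  have A1 := H1 s y' (le_lt_trans s1 p1) (le_lt_trans t1 q1).
  have A2 := H1 s (y' + q) (le_lt_trans s1 p1) (le_lt_trans t2 q1).
  have A3 : e * (`|s - x| + `|y' - y|) <= e * (p + q) by rewrite ler_wpM2l ?(ltW e0) // lerD.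
  have A4 : e * (`|s - x| + `|y' + q - y|) <= e * (p + q) by rewrite ler_wpM2l ?(ltW e0) // lerD.
  move: (le_trans A1 A3) (le_trans A2 A4); rewrite !ler_norml => /andP[? ?] /andP[? ?].
  by apply/andP; split; lra.
have BV : `|Iint y' (y' + q) (fun t => V (x' + p) t - V x' t) - b * p * (y' + q - y')| <= 2 * e * (p + q) * (y' + q - y').
  apply: Iint_bound; [|lra|].
    by move=> s; apply: cvgB; exact: cV.
  move=> t yt.
  have t1 : `|t - y| <= q by apply: (near _ _ y') => //; rewrite y1.
  have s1 : `|x' - x| <= p by apply: (near _ _ x'); rewrite ?x1 // lexx lerDl.
  have s2 : `|x' + p - x| <= p by apply: (near _ _ x'); rewrite ?x1 // lexx lerDl p0.
  have A1 := H2 x' t (le_lt_trans s1 p2) (le_lt_trans t1 q2).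
  have A2 := H2 (x' + p) t (le_lt_trans s2 p2) (le_lt_trans t1 q2).
  have A3 : e * (`|x' - x| + `|t - y|) <= e * (p + q) by rewrite ler_wpM2l ?(ltW e0) // lerD.
  have A4 : e * (`|x' + p - x| + `|t - y|) <= e * (p + q) by rewrite ler_wpM2l ?(ltW e0) // lerD.
  move: (le_trans A1 A3) (le_trans A2 A4); rewrite !ler_norml => /andP[? ?] /andP[? ?].
  by apply/andP; split; lra.
have EU : Iint x' (x' + p) (fun s => U s y' - U s (y' + q)) =
    Iint x' (x' + p) (U^~ y') - Iint x' (x' + p) (U^~ (y' + q)).
  by apply: RintegralB => //; exact: integrable_cont.
have EV : Iint y' (y' + q) (fun t => V (x' + p) t - V x' t) =
    Iint y' (y' + q) (V (x' + p)) - Iint y' (y' + q) (V x').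
  by apply: RintegralB => //; exact: integrable_cont.
have -> : J x' y' p q = (Iint x' (x' + p) (fun s => U s y' - U s (y' + q)) - b * q * (x' + p - x'))
   - (Iint y' (y' + q) (fun t => V (x' + p) t - V x' t) - b * p * (y' + q - y')).
  by rewrite /J /boundary_int EU EV; ring.
apply: le_trans (ler_normB _ _) _; apply: le_trans (lerD BU BV) _.
rewrite le_eqVlt; apply/orP; left; apply/eqP; ring.
Qed.

(** The bisection moves to the right by at most half of the current width, so the
    left ends converge to a point of every interval. *)
Lemma nested_limit (x : nat -> R) (w : R) : 0 <= w ->
  (forall k, x k <= x k.+1 <= x k + w / 2 ^+ k.+1) ->
  exists l, forall k, x k <= l <= x k + w / 2 ^+ k.
Proof.
move=> w0 H.
have up k m : x k <= x (k + m)%N.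
  elim: m => [|m IH]; first by rewrite addn0.
  by rewrite addnS; apply: le_trans IH _; case/andP: (H (k + m)%N).
have dn k m : x (k + m)%N + w / 2 ^+ (k + m) <= x k + w / 2 ^+ k.
  elim: m => [|m IH]; first by rewrite addn0.
  rewrite addnS; apply: le_trans IH; case/andP: (H (k + m)%N) => _.
  have -> : w / 2 ^+ (k + m) = w / 2 ^+ (k + m).+1 * 2.
    by rewrite exprS; field; rewrite expf_neq0.
  lra.
have wk k : 0 <= w / 2 ^+ k by rewrite divr_ge0 // exprn_ge0.
have ub k : ubound (range x) (x k + w / 2 ^+ k).
  move=> _ [m _ <-]; have [km|/ltnW mk] := leqP k m.
    by apply: le_trans (dn k (m - k)%N); rewrite subnKC // lerDl.
  apply: le_trans (_ : x k <= _); last by rewrite lerDl.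
  by have := up m (k - m)%N; rewrite subnKC.
exists (sup (range x)) => k; apply/andP; split.
  by apply: ub_le_sup; [exists (x 0%N + w / 2 ^+ 0); exact: ub|exists k].
by apply: ge_sup; [exists (x 0%N); exists 0%N|exact: ub].
Qed.

Section bisection.
Variables a c w h : R.
Hypotheses (w0 : 0 <= w) (h0 : 0 <= h).

Let P k := w / 2 ^+ k.
Let Q k := h / 2 ^+ k.

Let PS k : P k = P k.+1 * 2.
Proof. by rewrite /P exprS; field; rewrite expf_neq0. Qed.
Let QS k : Q k = Q k.+1 * 2.
Proof. by rewrite /Q exprS; field; rewrite expf_neq0. Qed.
Let P0 k : 0 <= P k. Proof. by rewrite divr_ge0 // exprn_ge0. Qed.
Let Q0 k : 0 <= Q k. Proof. by rewrite divr_ge0 // exprn_ge0. Qed.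

(** The lower left corner of a quarter with at least a quarter of the boundary
    integral; if the first three fail, the last one does it. *)
Let next k (z : R * R) : R * R :=
  let p := P k.+1 in let q := Q k.+1 in
  let L := `|J z.1 z.2 (P k) (Q k)| / 4 in
  if L <= `|J z.1 z.2 p q| then z
  else if L <= `|J (z.1 + p) z.2 p q| then (z.1 + p, z.2)
  else if L <= `|J z.1 (z.2 + q) p q| then (z.1, z.2 + q)
  else (z.1 + p, z.2 + q).

Let nextJ k z : `|J z.1 z.2 (P k) (Q k)| / 4 <=
  `|J (next k z).1 (next k z).2 (P k.+1) (Q k.+1)|.
Proof.
rewrite /next; set L := _ / 4; case: ifPn => //=; rewrite -ltNge => l1.
case: ifPn => //=; rewrite -ltNge => l2.
case: ifPn => //=; rewrite -ltNge => l3.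
rewrite leNgt; apply/negP => l4.
have : `|J z.1 z.2 (P k) (Q k)| < 4 * L.
  rewrite {1}PS {1}QS boundary_int_quarter //.
  apply: le_lt_trans (ler_normD _ _) _; have := ler_normD (J z.1 z.2 (P k.+1) (Q k.+1) + J (z.1 + P k.+1) z.2 (P k.+1) (Q k.+1)) (J z.1 (z.2 + Q k.+1) (P k.+1) (Q k.+1)).
  have := ler_normD (J z.1 z.2 (P k.+1) (Q k.+1)) (J (z.1 + P k.+1) z.2 (P k.+1) (Q k.+1)).
  lra.
by rewrite /L; lra.
Qed.

Let next1 k z : z.1 <= (next k z).1 <= z.1 + P k.+1.
Proof.
have := P0 k.+1; rewrite /next; case: ifP => _ /=; [|case: ifP => _ /=; [|case: ifP => _ /=]]; move=> ?; apply/andP; split; lra.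
Qed.

Let next2 k z : z.2 <= (next k z).2 <= z.2 + Q k.+1.
Proof.
have := Q0 k.+1; rewrite /next; case: ifP => _ /=; [|case: ifP => _ /=; [|case: ifP => _ /=]]; move=> ?; apply/andP; split; lra.
Qed.

Fixpoint corner k := if k is k'.+1 then next k' (corner k') else (a, c).

Let cornerJ k : `|J a c w h| / 4 ^+ k <= `|J (corner k).1 (corner k).2 (P k) (Q k)|.
Proof.
elim: k => [|k IH]; first by rewrite /P /Q !expr0 !divr1.
apply: le_trans (nextJ k (corner k)).
rewrite exprSr invfM mulrA ler_pM2r //.
Qed.

(** Bisection: the quarters carrying the largest boundary integral keep at least
    the fraction [4^-k] of it, while near their common point the boundary integral
    is at most an arbitrarily small multiple of the area scale [4^-k]. *)
Lemma goursat : boundary_int a c w h = 0.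
Proof.
apply: contrapT => /eqP J0; rewrite -/(J _ _ _ _) in J0.
have Jpos : 0 < `|J a c w h| by rewrite normr_gt0.
have [x Hx] := @nested_limit (fun k => (corner k).1) w w0 (fun k => next1 k (corner k)).
have [y Hy] := @nested_limit (fun k => (corner k).2) h h0 (fun k => next2 k (corner k)).
pose D := 4 * ((w + h) ^+ 2 + 1).
have D0 : 0 < D by rewrite mulr_gt0 // ltr_wpDl // sqr_ge0.
pose e := `|J a c w h| / D.
have e0 : 0 < e by rewrite divr_gt0.
have [r r0 Hr] := boundary_int_local x y e0.
have wh : 0 < w + h + 1 by rewrite ltr_wpDl // addr_ge0.
have [k kr] : exists k : nat, 1 / 2 ^+ k < r / (w + h + 1).
  have rp : 0 < r / (w + h + 1) by rewrite divr_gt0.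
  have [k _ Hk] := near_infty_natSinv_expn_lt (PosNum rp).
  by exists k; apply: Hk => /=.
have k0 : (0 : R) < 2 ^+ k by rewrite exprn_gt0.
have small u : 0 <= u -> u <= w + h -> u / 2 ^+ k < r.
  move=> u0 uwh; rewrite -[u]mul1r mulrAC.
  apply: le_lt_trans (_ : 1 / 2 ^+ k * (w + h + 1) < r); last by rewrite -ltr_pdivlMr.
  by rewrite ler_wpM2l ?divr_ge0 //; lra.
have := Hr _ _ (P k) (Q k) (Hx k) (Hy k) (small _ w0 _) (small _ h0 _).
rewrite lerDl lerDr => /(_ h0 w0); apply/negP; rewrite -ltNge.
apply: lt_le_trans (cornerJ k).
rewrite /P /Q -mulrDl exprMn exprVn -exprM muln2 -addnn exprD -exprMn -natrM.
rewrite mulrA ltr_pM2r; last by rewrite invr_gt0 exprn_gt0.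
rewrite -[ltRHS](divfK (lt0r_neq0 D0)) -/e /D.
have := mulr_ge0 (ltW e0) (sqr_ge0 (w + h)); lra.
Qed.

End bisection.

End goursat.

Section circle_mean.
Context {R : realType}.
Local Notation C := R[i].
Variable phi : C -> C.
Hypothesis dphi : forall u, differentiable (phi : C^o -> C^o) u.

Let H (u : C) := phi (cexp u).

Let dH u : Cdiff1 H u.
Proof.
apply: (@differentiable_Cdiff1 R H).
exact: (@differentiable_comp _ _ _ _ (cexp : C^o -> C^o) (phi : C^o -> C^o) u (@cexp_differentiable R u) (dphi _)).
Qed.

Let W (k : C) (x y : R) := complex.Re (k * H (x +i* y)%C).

Let Rdiff2W (k D : C) (x y : R) :
  (forall e : R, 0 < e -> exists2 r : R, 0 < r & forall v, cabs (v - (x +i* y)%C) < r ->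
    cabs (H v - H (x +i* y)%C - D * (v - (x +i* y)%C)) <= e * cabs (v - (x +i* y)%C)) ->
  Rdiff2 (W k) x y (complex.Re (k * D)) (complex.Re ('i%C * k * D)).
Proof.
move=> hD e e0.
have M0 : 0 < cabs k + 1 by rewrite ltr_wpDl // cabs_ge0.
have [r r0 Hr] := hD (e / (cabs k + 1)) (divr_gt0 e0 M0).
exists (r / 2); first by rewrite divr_gt0.
move=> x' y' hx hy.
set u := (x +i* y)%C; set v := (x' +i* y')%C.
have vu : v - u = ((x' - x) +i* (y' - y))%C by [].
have vle : cabs (v - u) <= `|x' - x| + `|y' - y| by rewrite vu; exact: cabs_le_ReIm.
have vr : cabs (v - u) < r by apply: le_lt_trans vle _; lra.
have -> : W k x' y' - W k x y - complex.Re (k * D) * (x' - x) - complex.Re ('i%C * k * D) * (y' - y)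
   = complex.Re (k * (H v - H u - D * (v - u))).
  rewrite /W -/u -/v vu; case: (H v) => a b; case: (H u) => a' b'.
  by case: (k) => k1 k2; case: (D) => d1 d2 /=; ring.
apply: le_trans (le_Re_cabs _) _; rewrite cabsM.
apply: le_trans (_ : (cabs k + 1) * (e / (cabs k + 1) * cabs (v - u)) <= _).
  apply: ler_pM; rewrite ?cabs_ge0 //; first by rewrite lerDl.
  exact: Hr.
rewrite mulrA mulrCA divff ?gt_eqF // mulr1 ler_wpM2l //; exact: ltW.
Qed.

Let UVW k x y : exists a b c,
  Rdiff2 (W ('i%C * k)) x y a (- b) /\ Rdiff2 (W k) x y b c.
Proof.
have [D hD] := dH (x +i* y)%C.
exists (complex.Re ('i%C * k * D)), (complex.Re (k * D)), (complex.Re ('i%C * k * D)).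
split; last exact: Rdiff2W.
have := Rdiff2W ('i%C * k) hD.
suff -> : complex.Re ('i%C * ('i%C * k) * D) = - complex.Re (k * D) by [].
by case: (k) D {hD} => a b [d1 d2] /=; ring.
Qed.

Let cW k x : continuous (W k x).
Proof.
move=> y; have [a [b [c [_ hV]]]] := UVW k x y.
exact: (Rdiff2_continuous1 (Rdiff2_swap hV)).
Qed.

Let circle_const k x w : 0 <= w ->
  Iint 0 (0 + pi *+ 2) (W k (x + w)) = Iint 0 (0 + pi *+ 2) (W k x).
Proof.
move=> w0; have pi0 : 0 <= (pi : R) *+ 2 by rewrite mulrn_wge0 // pi_ge0.
have := goursat (UVW k) x 0 w0 pi0; rewrite /boundary_int.
have -> : (W ('i%C * k))^~ (0 + pi *+ 2) = (W ('i%C * k))^~ 0.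
  by apply/funext => s; rewrite /W /H /cexp /= cosD2pi sinD2pi.
rewrite subrr sub0r => h; apply/eqP; rewrite eq_sym -subr_eq0 addrC; apply/eqP.
exact: h.
Qed.

(** In the coordinates [u = log z] the function has period [2 pi i], so Goursat's
    theorem on a rectangle of height [2 pi] shows that the mean over a circle does
    not depend on the radius; then the radius tends to [0]. *)
Lemma circle_mean k :
  Iint 0 (pi *+ 2) (fun s => complex.Re (k * phi (cexp (0 +i* s)%C))) =
  complex.Re (k * phi 0) * (pi *+ 2).
Proof.
have pi0 : 0 < (pi : R) *+ 2 by rewrite mulrn_wgt0 // pi_gt0.
apply/eqP; rewrite -subr_eq0 -normr_eq0 eq_le normr_ge0 andbT.
apply/ler_addgt0Pr => e e0; rewrite add0r.
pose e' := e / (pi *+ 2) / (cabs k + 1).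
have M0 : 0 < cabs k + 1 by rewrite ltr_wpDl // cabs_ge0.
have e'0 : 0 < e' by rewrite !divr_gt0.
have [D hD] := differentiable_Cdiff1 (dphi 0).
have [r r0 Hr] := hD 1 ltr01.
pose N := 1 + cabs D.
have N0 : 0 < N by rewrite ltr_wpDr // cabs_ge0.
(* On the circle of radius [m] the values of [phi] differ from [phi 0] by at most
   [N * m]; the bound [m <= 1] makes [- ln m] a width for the rectangle. *)
pose m := Num.min 1 (Num.min (r / 2) (e' / N)).
have m0 : 0 < m by rewrite !lt_min ltr01 !divr_gt0.
have m1 : m <= 1 by rewrite ge_min lexx.
have mr : m < r.
  apply: le_lt_trans (_ : r / 2 < r); last by lra.
  by rewrite /m !ge_min lexx orbT.
have mN : N * m <= e' by rewrite mulrC -ler_pdivlMr // /m !ge_min lexx !orbT.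
have lnm : 0 <= - ln m by rewrite oppr_ge0 ln_le0.
have -> : Iint 0 (pi *+ 2) (fun s => complex.Re (k * phi (cexp (0 +i* s)%C))) =
  Iint 0 (pi *+ 2) (W k (ln m)).
  by have := circle_const k (ln m) lnm; rewrite add0r subrr.
have -> : pi *+ 2 = (pi *+ 2 - 0 : R) by rewrite subr0.
apply: le_trans (_ : e / (pi *+ 2) * (pi *+ 2 - 0) <= _); last first.
  by rewrite subr0 divfK // gt_eqF.
rewrite {1}subr0; apply: Iint_bound; [exact: cW|exact: ltW|].
move=> s _; rewrite /W /H; set v := cexp _.
have vm : cabs v = m by rewrite cabs_cexp /= lnK.
rewrite -ReN -ReD -mulrBr.
apply: le_trans (le_Re_cabs _) _; rewrite cabsM.
apply: le_trans (_ : (cabs k + 1) * e' <= _); last by rewrite /e' mulrC divfK // gt_eqF.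
apply: ler_pM; rewrite ?cabs_ge0 //; first by rewrite lerDl.
apply: le_trans mN.
have := Hr v; rewrite !subr0 vm => /(_ mr); rewrite mul1r => h.
have -> : phi v - phi 0 = (phi v - phi 0 - D * v) + D * v by rewrite subrK.
apply: le_trans (cabsD _ _) _; rewrite cabsM vm /N mulrDl mul1r.
exact: lerD.
Qed.

End circle_mean.

(** * Gaussian integrals and the reproducing formula *)

Lemma ge0_integralZ (R : realType) d (T : measurableType d)
    (mu : {measure set T -> \bar R}) (k : R) (g : T -> R) :
  measurable_fun setT g -> (forall x, 0 <= g x) -> 0 <= k ->
  (\int[mu]_x (k * g x)%:E = k%:E * \int[mu]_x (g x)%:E)%E.
Proof.
move=> mg g0 k0; rewrite -ge0_integralZl_EFin //.
  by move=> x _; rewrite lee_fin.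
exact/measurable_EFinP.
Qed.

Lemma integral_mul_lty (R : realType) d (T : measurableType d)
    (mu : {measure set T -> \bar R}) (a b : T -> R) :
  measurable_fun setT a -> measurable_fun setT b ->
  (forall x, 0 <= a x) -> (forall x, 0 <= b x) ->
  (\int[mu]_x (a x ^+ 2)%:E < +oo)%E -> (\int[mu]_x (b x ^+ 2)%:E < +oo)%E ->
  (\int[mu]_x (a x * b x)%:E < +oo)%E.
Proof.
move=> ma mb a0 b0 ay bY.
have ma2 : measurable_fun setT (fun x => a x ^+ 2) by exact: measurable_funX.
have mb2 : measurable_fun setT (fun x => b x ^+ 2) by exact: measurable_funX.
apply: (@le_lt_trans _ _ (\int[mu]_x ((a x ^+ 2)%:E + (b x ^+ 2)%:E))%E).
  apply: ge0_le_integral => //.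
  - by move=> x _; rewrite lee_fin mulr_ge0.
  - by apply/measurable_EFinP; exact: measurable_funM.
  - by apply: emeasurable_funD; exact/measurable_EFinP.
  - move=> x _; rewrite -EFinD lee_fin.
    by have := sqr_ge0 (a x - b x); have := mulr_ge0 (a0 x) (b0 x); nra.
rewrite ge0_integralD //.
- exact: lte_add_pinfty.
- by move=> x _; rewrite lee_fin sqr_ge0.
- exact/measurable_EFinP.
- by move=> x _; rewrite lee_fin sqr_ge0.
- exact/measurable_EFinP.
Qed.

Section gaussian_algebra.
Context {R : realType} (n : nat).
Local Notation C := R[i].
Local Notation Cn := 'rV[C]_n.
Local Notation Rn := (n.-tuple R).
Local Notation leb := (lebC n).

Definition uncvec (z : Cn) : Rn * Rn :=
  ([tuple complex.Re (z ord0 j) | j < n], [tuple complex.Im (z ord0 j) | j < n]).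

Lemma uncvecK : cancel uncvec (@cvec R n).
Proof. by move=> z; apply/rowP => j; rewrite mxE !tnth_mktuple complex_eta. Qed.

Lemma cvec_translate a p : cvec (translate a p) = cvec a + cvec p :> Cn.
Proof. by apply/rowP => j; rewrite !mxE !tnth_mktuple. Qed.

Lemma cvec_rotate s (p : Rn * Rn) :
  cvec (rotate (cos s) (sin s) p) = cexp (0 +i* s)%C *: cvec p.
Proof.
apply/rowP => j; rewrite !mxE !tnth_mktuple /cexp /= expR0 !mul1r; simpc.
by rewrite [X in (_ +i* X)%C]addrC.
Qed.

Lemma csqnD (z w : Cn) : csqn (z + w) = csqn z + 2 * complex.Re (hdot z w) + csqn w.
Proof.
rewrite !csqnE hdotDl !hdotDr !ReD (hdotC w z).
have -> : complex.Re ((hdot z w)^*)%C = complex.Re (hdot z w) by case: (hdot z w).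
ring.
Qed.

Lemma csqnZ (a : C) (z : Cn) : csqn (a *: z) = cabs a ^+ 2 * csqn z.
Proof.
rewrite csqnE hdotZl hdotZr mulrA mulcJ hdotxx -rmorphM /=.
by [].
Qed.

Lemma csqnN (z : Cn) : csqn (- z) = csqn z.
Proof. by rewrite -scaleN1r csqnZ cabsN cabs1 expr1n mul1r. Qed.

Lemma csqnB (z w : Cn) : csqn (z - w) = csqn z - 2 * complex.Re (hdot z w) + csqn w.
Proof. by rewrite csqnD csqnN hdotNr ReN mulrN. Qed.

Lemma csqn_distC (z w : Cn) : csqn (z - w) = csqn (w - z).
Proof. by rewrite -csqnN opprB. Qed.

Lemma Re_hdotC (z w : Cn) : complex.Re (hdot w z) = complex.Re (hdot z w).
Proof. by rewrite hdotC; case: (hdot z w). Qed.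

Lemma ReZ (a : R) (z : C) : complex.Re (a%:C%C * z) = a * complex.Re z.
Proof. by case: z => x y /=; rewrite mul0r subr0. Qed.

Lemma ImZ (a : R) (z : C) : complex.Im (a%:C%C * z) = a * complex.Im z.
Proof. by case: z => x y /=; rewrite mul0r addr0. Qed.

Lemma gauss_square (d : R) (z A : Cn) : 0 < d ->
  - (d * csqn z) + 2 * complex.Re (hdot z A) =
  csqn A / d - d * csqn (z - (d^-1)%:C%C *: A).
Proof.
move=> d0; rewrite csqnB csqnZ cabs_real hdotZr.
have -> : ((d^-1)%:C%C^*)%C = (d^-1)%:C%C by rewrite conjc_real.
rewrite ReZ ger0_norm ?invr_ge0 ?ltW //; field; lra.
Qed.

Lemma measurable_gauss_comp d (T : measurableType d) (phi : T -> Cn) (k : R) :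
  Vmeas phi -> measurable_fun setT (fun t => expR (- (k * csqn (phi t)))).
Proof.
move=> mp; apply: measurableT_comp => //; apply: measurableT_comp => //.
apply: measurable_funM; first exact: measurable_cst.
exact: measurable_csqn_comp.
Qed.

Lemma Vmeas_id : Vmeas (fun p : Rn * Rn => cvec p : Cn).
Proof. by apply: (@Vmeas_cvec R n _ _ id); exact: measurable_id. Qed.

Lemma integral_gauss_shift (d : R) (m : Cn) : 0 < d ->
  (\int[leb]_p (expR (- (d * csqn (cvec p - m))))%:E = ((pi / d) ^+ n)%:E)%E.
Proof.
move=> d0; rewrite -(integral_csqn_gauss n d0).
have [_ pt] := preserves_translate (uncvec m).
rewrite -(pt (fun p => (expR (- (d * csqn (cvec p - m))))%:E)).
- by apply: eq_integral => p _; rewrite cvec_translate uncvecK addrC addKr.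
- apply/measurable_EFinP; apply: measurable_gauss_comp.
  by apply: VmeasB; [exact: Vmeas_id|exact: Vmeas_cst].
- by move=> p; rewrite lee_fin expR_ge0.
Qed.

(** Completing the square moves the centre to [d^-1 A]. *)
Lemma integral_gauss_linear (d : R) (A : Cn) : 0 < d ->
  (\int[leb]_p (expR (- (d * csqn (cvec p)) + 2 * complex.Re (hdot (cvec p) A)))%:E
   = (expR (csqn A / d) * (pi / d) ^+ n)%:E)%E.
Proof.
move=> d0.
under eq_integral do rewrite gauss_square // expRD.
rewrite (@ge0_integralZ _ _ _ leb) ?expR_ge0 //.
- by rewrite integral_gauss_shift.
- apply: measurable_gauss_comp.
  by apply: VmeasB; [exact: Vmeas_id|exact: Vmeas_cst].
Qed.

End gaussian_algebra.

Section holomorphy.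
Context {R : realType} (n : nat).
Local Notation C := R[i].
Local Notation Cn := 'rV[C]_n.
Implicit Types F G : Cn -> C.

Lemma entireM F G : entire F -> entire G -> entire (fun z => F z * G z).
Proof. by move=> dF dG z; exact: (@differentiableM _ _ (F : Cn -> C^o) (G : Cn -> C^o) z (dF z) (dG z)). Qed.

Lemma entireD F G : entire F -> entire G -> entire (fun z => F z + G z).
Proof. by move=> dF dG z; exact: (@differentiableD _ _ _ (F : Cn -> C^o) (G : Cn -> C^o) z (dF z) (dG z)). Qed.

Lemma entire_cst (c : C) : entire (fun _ : Cn => c).
Proof. by move=> z; exact: differentiable_cst. Qed.

Lemma entire_sum (I : Type) (r : seq I) (F : I -> Cn -> C) :
  (forall i, entire (F i)) -> entire (fun z => \sum_(i <- r) F i z).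
Proof.
move=> dF; elim: r => [|i r IH].
  by under eq_fun do rewrite big_nil; exact: entire_cst.
by under eq_fun do rewrite big_cons; exact: entireD.
Qed.

Lemma entire_coord j : entire (fun z : Cn => z ord0 j).
Proof. by move=> z; exact: (@differentiable_coord C 1 n z ord0 j). Qed.

Lemma entire_hdot (w : Cn) : entire (fun z => hdot z w).
Proof. by apply: entire_sum => j; apply: entireM; [exact: entire_coord|exact: entire_cst]. Qed.

Lemma entire_csq : entire (@csq R n).
Proof. by apply: entire_sum => j; apply: entireM; exact: entire_coord. Qed.

Lemma entire_cexp F : entire F -> entire (fun z => cexp (F z)).
Proof.
move=> dF z.
exact: (@differentiable_comp _ _ _ _ (F : Cn -> C^o) (cexp : C^o -> C^o) z (dF z) (@cexp_differentiable R (F z))).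
Qed.

Lemma entire_shift F (w : Cn) : entire F -> entire (fun z => F (w + z)).
Proof.
move=> dF z.
apply: (@differentiable_comp _ _ _ _ (fun v : Cn => w + v) (F : Cn -> C^o) z _ (dF _)).
by apply: differentiableD => //; exact: differentiable_cst.
Qed.

Lemma entire_line F (z : Cn) : entire F ->
  forall u, differentiable (fun l : C^o => F (l *: z) : C^o) u.
Proof.
move=> dF u.
apply: (@differentiable_comp _ _ _ _ (fun l : C^o => l *: z) (F : Cn -> C^o) u _ (dF _)).
exact: (@differentiableZl _ _ _ (id : C^o -> C^o) z u).
Qed.

End holomorphy.

Section gaussian_mean_value.
Context {R : realType} (n : nat).
Local Notation C := R[i].
Local Notation Cn := 'rV[C]_n.
Local Notation Rn := (n.-tuple R).
Local Notation leb := (lebC n).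
Local Notation mR := (@lebesgue_measure R).
Variables (F : Cn -> C) (d : R).
Hypotheses (dF : entire F) (d0 : 0 < d).

Let E (p : Rn * Rn) := expR (- (d * csqn (cvec p))).
Hypothesis IF : Cintegrable leb (fun p => F (cvec p) * (E p)%:C%C).

Let I2 : set R := `[0, (pi *+ 2)[%classic.
Let ind (s : R) : R := \1_I2 s.

Let mind : measurable_fun setT (ind : measurableTypeR R -> R).
Proof. by apply: measurable_indic; exact: measurable_itv. Qed.

Let ind_ge0 s : 0 <= ind s. Proof. by rewrite /ind indicE; case: (_ \in _). Qed.

Let int_ind : (\int[mR]_s (ind s)%:E = ((pi : R) *+ 2)%:E)%E.
Proof.
rewrite /ind /I2 integral_indic // setIT /= lebesgue_measure_itv /= lte_fin mulrn_wgt0 ?pi_gt0 //.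
by rewrite -EFinB subr0.
Qed.

Lemma Cint_circle (phi : C -> C) : (forall u, differentiable (phi : C^o -> C^o) u) ->
  Cint mR (fun s => (ind s)%:C%C * phi (cexp (0 +i* s)%C)) = (pi *+ 2)%:C%C * phi 0.
Proof.
move=> dphi.
have H k : (\int[mR]_s (ind s * complex.Re (k * phi (cexp (0 +i* s)%C))))%R =
  complex.Re (k * phi 0) * (pi *+ 2).
  rewrite -(circle_mean dphi k) /Iint [RHS]Rintegral_mkcond.
  apply: eq_Rintegral => s _; rewrite patchE /ind indicE -/I2.
  by case: ifPn => _; rewrite ?mul1r ?mul0r.
rewrite /Cint; apply/eqP; rewrite eq_complex /=; apply/andP; split; apply/eqP.
- rewrite ReZ mulrC -[phi 0]mul1r -H.
  by apply: eq_Rintegral => s _; rewrite mul1r ReZ.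
- rewrite ImZ mulrC.
  have -> : complex.Im (phi 0) = complex.Re (- 'i%C * phi 0).
    by case: (phi 0) => a b /=; ring.
  rewrite -H; apply: eq_Rintegral => s _.
  by case: (phi _) => a b /=; ring.
Qed.

Let Phi (q : measurableTypeR R * (Rn * Rn)) : C :=
  (ind q.1)%:C%C * (F (cexp (0 +i* q.1)%C *: cvec q.2) * (E q.2)%:C%C).

Let mE : measurable_fun setT E.
Proof. by apply: measurable_gauss_comp; exact: Vmeas_id. Qed.

Let mPhi : Cmeas Phi.
Proof.
apply: CmeasM.
  by apply: Cmeas_real; exact: (measurableT_comp mind measurable_fst).
apply: CmeasM; last first.
  by apply: Cmeas_real; exact: (measurableT_comp mE measurable_snd).
apply: (Cmeas_entire dF); apply: VmeasZ.
  by apply: Cmeas_cexp; split => /=; [exact: measurable_cst|exact: measurable_fst].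
by apply: Vmeas_cvec; exact: measurable_snd.
Qed.

Let csqn_rot s (p : Rn * Rn) : csqn (cexp (0 +i* s)%C *: cvec p) = csqn (cvec p).
Proof. by rewrite csqnZ cabs_cexp /= expR0 expr1n mul1r. Qed.

Let f p := F (cvec p) * (E p)%:C%C.

Let Phi_rot s p : Phi (s, p) = (ind s)%:C%C * f (rotate (cos s) (sin s) p).
Proof. by rewrite /Phi /f /E cvec_rotate csqn_rot. Qed.

Let rot_pres s : preserves leb (@rotate R n (cos s) (sin s)).
Proof. by apply: preserves_rotate; rewrite cos2Dsin2. Qed.

Let IPhi : Cintegrable (mR \x leb)%E Phi.
Proof.
apply: Cintegrable_prod12 => //.
have [mf fy] := IF.
have A0 : (0 <= \int[leb]_p (cabs (f p))%:E)%E.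
  by apply: integral_ge0 => p _; rewrite lee_fin cabs_ge0.
rewrite (_ : (fun s => _) = (fun s => (ind s)%:E * \int[leb]_p (cabs (f p))%:E)%E).
  rewrite ge0_integralZr //.
  - by rewrite int_ind lte_mul_pinfty // lee_fin mulrn_wge0 // pi_ge0.
  - exact/measurable_EFinP.
  - by move=> s _; rewrite lee_fin.
apply/funext => s.
have mfr : measurable_fun setT (fun p => cabs (f (rotate (cos s) (sin s) p))).
  apply: measurable_cabs; apply: (Cmeas_comp mf); exact: (proj1 (rot_pres s)).
under eq_integral do rewrite Phi_rot cabsM cabs_real ger0_norm //.
rewrite [LHS](ge0_integralZ leb mfr (fun=> cabs_ge0 _) (ind_ge0 s)).
apply: (f_equal (fun x => (ind s)%:E * x)%E).
apply: ((rot_pres s).2 (fun p => (cabs (f p))%:E)).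
- exact/measurable_EFinP/measurable_cabs.
- by move=> p; rewrite lee_fin cabs_ge0.
Qed.

(** The rotations [z |-> exp (i s) z] preserve the Gaussian measure. Averaging over
    them replaces [F z] by its mean over the circle through [z] in the complex line
    of [z], which is [F 0]. *)
Theorem gaussian_mean_value :
  Cint leb f = ((pi / d) ^+ n)%:C%C * F 0.
Proof.
have pi2 : ((pi : R) *+ 2)%:C%C != 0.
  by apply/eqP => /complexI/eqP; rewrite gt_eqF // mulrn_wgt0 // pi_gt0.
apply: (mulfI pi2).
have h1 : Cint mR (fun s => Cint leb (fun p => Phi (s, p))) = (pi *+ 2)%:C%C * Cint leb f.
  transitivity (Cint mR (fun s => Cint leb f * (ind s)%:C%C)).
    apply: eq_Cint => s; under eq_Cint do rewrite Phi_rot.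
    rewrite CintZ; last exact: (Cintegrable_preserves (rot_pres s) IF).
    by rewrite (@Cint_preserves _ _ _ _ f _ (rot_pres s) (proj1 IF)) mulrC.
  rewrite CintZ; last first.
    split; first exact: Cmeas_real.
    under eq_integral do rewrite cabs_real ger0_norm //.
    by rewrite int_ind ltry.
  rewrite mulrC; congr (_ * _).
  rewrite /Cint /=; congr (_ +i* _)%C.
    by rewrite /Rintegral int_ind.
  by rewrite Rintegral_cst // mul0r.
have h2 : Cint leb (fun p => Cint mR (fun s => Phi (s, p))) =
    ((pi *+ 2)%:C%C * F 0) * ((pi / d) ^+ n)%:C%C.
  transitivity (Cint leb (fun p => ((pi *+ 2)%:C%C * F 0) * (E p)%:C%C)).
    apply: eq_Cint => p.
    have dp u : differentiable (fun l : C^o => F (l *: cvec p) * (E p)%:C%C : C^o) u.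
      apply: (@differentiableM _ _ (fun l : C^o => F (l *: cvec p) : C^o) (fun=> (E p)%:C%C : C^o)).
        exact: entire_line.
      exact: differentiable_cst.
    by rewrite (Cint_circle dp) scale0r mulrA.
  rewrite CintZ; last first.
    split; first exact: Cmeas_real.
    under eq_integral do rewrite cabs_real ger0_norm ?expR_ge0 //.
    by rewrite integral_csqn_gauss // ltry.
  congr (_ * _).
  rewrite /Cint /=; congr (_ +i* _)%C.
    by rewrite /Rintegral integral_csqn_gauss.
  by rewrite Rintegral_cst // mul0r.
have h3 := Cfubini IPhi.
by rewrite -h1 [LHS]h3 h2 -mulrA [F 0 * _]mulrC.
Qed.

End gaussian_mean_value.

Section reproducing.
Context {R : realType} (n : nat).
Local Notation C := R[i].
Local Notation Cn := 'rV[C]_n.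
Local Notation Rn := (n.-tuple R).
Local Notation leb := (lebC n).
Implicit Types (F : Cn -> C) (d : R).

Lemma Fock_integrand_shift F d (w : Cn) p :
  let z := w + cvec p in
  F z * cexp (d%:C%C * hdot w z) * (expR (- (d * csqn z)))%:C%C =
  (F z * cexp (- (d%:C%C * hdot (cvec p) w))) * (expR (- (d * csqn (cvec p))))%:C%C.
Proof.
move=> z; rewrite -!mulrA; congr (_ * _).
rewrite -!cexp_real -!cexpD; congr cexp.
rewrite /z !rmorphN !rmorphM /= -!hdotxx hdotDl !hdotDr; ring.
Qed.

Lemma Cmeas_gauss d T0 (T : measurableType T0) (phi : T -> Cn) :
  Vmeas phi -> Cmeas (fun t => (expR (- (d * csqn (phi t))))%:C%C).
Proof. by move=> mp; apply: Cmeas_real; exact: measurable_gauss_comp. Qed.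

Lemma Cmeas_cexp_hdot (a : C) T0 (T : measurableType T0) (phi psi : T -> Cn) :
  Vmeas phi -> Vmeas psi -> Cmeas (fun t => cexp (a * hdot (phi t) (psi t))).
Proof.
move=> mp mq; apply: Cmeas_cexp; apply: CmeasM; first exact: Cmeas_cst.
exact: Cmeas_hdot.
Qed.

Lemma Cintegrable_Fock F d (w : Cn) : 0 < d -> Cmeas (fun p => F (cvec p)) ->
  (\int[leb]_p (cabs (F (cvec p)) ^+ 2 * expR (- (d * csqn (cvec p))))%:E < +oo)%E ->
  Cintegrable leb (fun p => F (cvec p) * cexp (d%:C%C * hdot w (cvec p)) *
     (expR (- (d * csqn (cvec p))))%:C%C).
Proof.
move=> d0 mF Fy; have mI := @Vmeas_id R n.
pose c (p : Rn * Rn) := cexp (d%:C%C * hdot w (cvec p)).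
have mc : Cmeas c by apply: Cmeas_cexp_hdot => //; exact: Vmeas_cst.
pose e (p : Rn * Rn) := expR (- (d / 2 * csqn (cvec p : Cn))).
have me : measurable_fun setT e by exact: measurable_gauss_comp.
have e2 p : e p ^+ 2 = expR (- (d * csqn (cvec p : Cn))).
  by rewrite /e expr2 -expRD; congr expR; lra.
split; first by apply: CmeasM; [exact: CmeasM|exact: Cmeas_gauss].
rewrite (_ : (fun p => _) = (fun p => (cabs (F (cvec p)) * e p * (cabs (c p) * e p))%:E)).
  apply: integral_mul_lty.
  - by apply: measurable_funM => //; exact: measurable_cabs.
  - by apply: measurable_funM => //; exact: measurable_cabs.
  - by move=> p; rewrite mulr_ge0 ?cabs_ge0 ?expR_ge0.
  - by move=> p; rewrite mulr_ge0 ?cabs_ge0 ?expR_ge0.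
  - by under eq_integral do rewrite exprMn e2.
  - rewrite (_ : (fun p => _) = (fun p => (expR (- (d * csqn (cvec p)) +
        2 * complex.Re (hdot (cvec p) (d%:C%C *: w))))%:E)).
      by rewrite integral_gauss_linear // ltry.
    apply/funext => p; rewrite exprMn e2 cabs_cexp expr2 -!expRD; congr (expR _)%:E.
    by rewrite hdotZr conjc_real !ReZ Re_hdotC; ring.
apply/funext => p; rewrite cabsM [cabs (_ * cexp _)]cabsM cabs_real ger0_norm ?expR_ge0 //.
by rewrite -e2 /c; congr (_%:E); ring.
Qed.

(** Translating the centre of the Gaussian to [w] and absorbing the phase in an
    entire factor reduces the formula to the mean value property at the origin. *)
Theorem Fock_reproducing F d (w : Cn) : 0 < d -> entire F ->
  (\int[leb]_p (cabs (F (cvec p)) ^+ 2 * expR (- (d * csqn (cvec p))))%:E < +oo)%E ->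
  Cint leb (fun p => F (cvec p) * cexp (d%:C%C * hdot w (cvec p)) *
     (expR (- (d * csqn (cvec p))))%:C%C) = ((pi / d) ^+ n)%:C%C * F w.
Proof.
move=> d0 dF Fy.
have mF : Cmeas (fun p : Rn * Rn => F (cvec p)).
  by apply: (Cmeas_entire dF); exact: Vmeas_id.
have If := Cintegrable_Fock w d0 mF Fy.
have pw := preserves_translate (uncvec w).
have If' := Cintegrable_preserves pw If.
rewrite -(Cint_preserves pw (proj1 If)).
pose G z := F (w + z) * cexp (- (d%:C%C * hdot z w)).
have dG : entire G.
  apply: entireM; first exact: entire_shift.
  apply: entire_cexp; under eq_fun do rewrite -mulNr.
  by apply: entireM; [exact: entire_cst|exact: entire_hdot].
have EG : (fun p => F (cvec (translate (uncvec w) p)) * cexp (d%:C%C * hdot w (cvec (translate (uncvec w) p))) *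
     (expR (- (d * csqn (cvec (translate (uncvec w) p)))))%:C%C) =
   (fun p => G (cvec p) * (expR (- (d * csqn (cvec p))))%:C%C).
  by apply/funext => p; rewrite cvec_translate uncvecK Fock_integrand_shift.
rewrite EG in If' *.
rewrite (gaussian_mean_value dG d0 If') /G addr0 hdot0l mulr0 oppr0 cexp0 mulr1.
by [].
Qed.

(** Completing the square for a complex-linear exponent; it is the reproducing
    formula for the exponential function [cexp (hdot z A)]. *)
Lemma complex_gauss d (A B : Cn) : 0 < d ->
  Cint leb (fun p => cexp (hdot (cvec p) A + hdot B (cvec p)) *
     (expR (- (d * csqn (cvec p))))%:C%C) =
  ((pi / d) ^+ n)%:C%C * cexp ((d^-1)%:C%C * hdot B A).
Proof.
move=> d0; pose F z := cexp (hdot z A).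
have dF : entire F by apply: entire_cexp; exact: entire_hdot.
pose w := (d^-1)%:C%C *: B.
have dw : d%:C%C * (d^-1)%:C%C = 1 :> C by rewrite -rmorphM /= divff ?gt_eqF.
have -> : (fun p : Rn * Rn => cexp (hdot (cvec p) A + hdot B (cvec p)) *
     (expR (- (d * csqn (cvec p))))%:C%C) =
    (fun p => F (cvec p) * cexp (d%:C%C * hdot w (cvec p)) *
     (expR (- (d * csqn (cvec p))))%:C%C).
  by apply/funext => p; rewrite /F cexpD /w hdotZl mulrA dw mul1r.
rewrite (Fock_reproducing w d0 dF); first by rewrite /F /w hdotZl.
have -> : (fun p : Rn * Rn => (cabs (F (cvec p)) ^+ 2 * expR (- (d * csqn (cvec p))))%:E) =
  (fun p => (expR (- (d * csqn (cvec p)) + 2 * complex.Re (hdot (cvec p) A)))%:E).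
  apply/funext => p; rewrite /F cabs_cexp expr2 -!expRD; congr (expR _)%:E; ring.
by rewrite integral_gauss_linear // ltry.
Qed.

End reproducing.

(** * Lebesgue measurable symbols *)

Section null_sets.
Context {R : realType} d (T : measurableType d) (mu : {measure set T -> \bar R}).
Implicit Types (f g : T -> \bar R) (N : set T).
Local Open Scope ereal_scope.

Import HBNNSimple.

Let ge0_integral_off_null_le N f g : measurable N -> mu N = 0 ->
  (forall x, 0 <= f x) -> (forall x, 0 <= g x) ->
  (forall x, ~ N x -> f x = g x) ->
  \int[mu]_x f x <= \int[mu]_x g x.
Proof.
move=> mN N0 f0 g0 fg.
rewrite [leLHS]ge0_integralTE // [leRHS]ge0_integralTE // /=.
apply: ge_ereal_sup => _ [h /= hf <-].
have mNC : measurable (~` N) by exact: measurableC.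
apply: le_ereal_sup_tmp; exists (sintegral mu (proj_nnsfun h mNC)).
  exists (proj_nnsfun h mNC) => // x; change ((h x * \1_(~` N) x)%:E <= g x); rewrite indicE.
  have [xN|xN] := pselect (N x).
    by rewrite memNset ?mulr0 //; exact: g0.

  by rewrite mem_set // mulr1 -fg.
rewrite -!integralT_nnsfun le_eqVlt; apply/orP; left; apply/eqP.
apply: ae_eq_integral => //; [exact/measurable_EFinP|exact/measurable_EFinP|].
exists N; split => // x /= /not_implyP[_]; apply: contra_notP => xN.
change ((h x)%:E = (h x * \1_(~` N) x)%:E).
by rewrite indicE mem_set // mulr1.
Qed.

(** The integral of a nonnegative function is the supremum over the simple functions
    below it, and truncating a simple function to the complement of [N] does not
    change its integral; so this applies to functions that are not Borel, such as
    those built from a Lebesgue measurable symbol. *)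
Lemma integral_off_null N f g : measurable N -> mu N = 0 ->
  (forall x, ~ N x -> f x = g x) -> \int[mu]_x f x = \int[mu]_x g x.
Proof.
move=> mN N0 fg.
have H (f' g' : T -> \bar R) : (forall x, 0 <= f' x) -> (forall x, 0 <= g' x) ->
    (forall x, ~ N x -> f' x = g' x) -> \int[mu]_x f' x = \int[mu]_x g' x.
  move=> f0 g0 fg'; apply/eqP; rewrite eq_le; apply/andP; split.
    exact: (ge0_integral_off_null_le mN).
  by apply: (ge0_integral_off_null_le mN) => // x xN; rewrite fg'.
rewrite integralE [RHS]integralE; congr (_ - _).
- by apply: H => // x xN; rewrite !funeposE fg.
- by apply: H => // x xN; rewrite !funenegE fg.
Qed.

Local Close Scope ereal_scope.

(** Each set [f > q] with [q] rational is Borel up to a negligible set. Setting the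
    function to [0] on a null set that covers these countably many exceptions makes
    it Borel. *)
Lemma completed_measurable_approx (f : T -> R) :
  (forall B : set R, measurable B -> completed_algebra_gen mu (f @^-1` B)) ->
  exists f' : T -> R, exists N, [/\ measurable_fun setT f', measurable N,
    mu N = 0%E & forall x, ~ N x -> f x = f' x].
Proof.
move=> hf.
pose q (i : nat) : rat := odflt 0 (unpickle i).
have hq i : exists A M, [/\ measurable A, mu.-negligible M &
    f @^-1` `]ratr (q i), +oo[%classic = A `|` M].
  have [A mA [M nM E]] := hf _ (measurable_itv `]ratr (q i), +oo[).
  by exists A, M.
have [A /(_ _)/cid HA] := choice hq.
pose M i := projT1 (HA i).
have HM i : [/\ measurable (A i), mu.-negligible (M i) &
    f @^-1` `]ratr (q i), +oo[%classic = A i `|` M i] by exact: (projT2 (HA i)).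
have : mu.-negligible (\bigcup_i M i).
  by apply: negligible_bigcup => i; have [] := HM i.
move=> [N [mN N0 MN]].
pose f' x := if x \in N then 0 else f x.
exists f', N; split => //; last by move=> x xN; rewrite /f' memNset.
apply: (measurability _ (RGenOInfty.measurableE R)) => _ [_ [y ->] <-].
rewrite setTI (_ : _ @^-1` _ = ((\bigcup_(i in [set i | y <= ratr (q i)]) A i) `\` N)
   `|` (if y < 0 then N else set0)).
  apply: measurableU; last by case: ifP.
  apply: measurableD => //; apply: bigcup_measurable => i _.
  by have [] := HM i.
apply/seteqP; split => x /=; rewrite in_itv /= andbT /f'.
- case: ifPn => [xN y0|xN yf]; first by right; rewrite y0; exact: set_mem.
  left; split; last by move=> /mem_set; apply/negP.
  have [p] := rat_in_itvoo yf; rewrite in_itv /= => /andP[yp pf].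
  have qp : q (pickle p) = p by rewrite /q pickleK.
  exists (pickle p); first by rewrite /= qp ltW.
  have [_ _ E] := HM (pickle p).
  have : (A (pickle p) `|` M (pickle p)) x.
    by rewrite -E /= in_itv /= andbT qp.
  case=> // Mx; exfalso; move/negP: xN; apply; apply/mem_set/MN.
  by exists (pickle p).
- move=> [[[i /= yq Ai] xN]|].
    rewrite memNset //; apply: le_lt_trans yq _.
    have [_ _ E] := HM i.
    have : (f @^-1` `]ratr (q i), +oo[%classic) x by rewrite E; left.
    by rewrite /= in_itv /= andbT.
  by case: ifP => // y0 xN; rewrite mem_set.
Qed.

End null_sets.

Section lebesgue_measurable_symbols.
Context {R : realType} (n : nat).
Local Notation C := R[i].
Local Notation Cn := 'rV[C]_n.
Local Notation Rn := (n.-tuple R).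
Implicit Types g : Cn -> C.

Lemma cintegralE (f : Rn * Rn -> C) : cintegral f = Cint (lebC n) f.
Proof. by []. Qed.

Lemma Cmeas_cmeasurable g : Cmeas (fun p : Rn * Rn => g (cvec p)) -> cmeasurable g.
Proof.
move=> [rg ig] B mB; split.
- exists [set p | B (complex.Re (g (cvec p)))].
    by rewrite -[X in measurable X]setTI; exact: rg.
  by exists set0; [exact: negligible_set0|rewrite setU0].
- exists [set p | B (complex.Im (g (cvec p)))].
    by rewrite -[X in measurable X]setTI; exact: ig.
  by exists set0; [exact: negligible_set0|rewrite setU0].
Qed.

Definition null_eq g g' := exists N : set (Rn * Rn), [/\ measurable N,
  lebC n N = 0%E & forall p, ~ N p -> g (cvec p) = g' (cvec p)].

Lemma cmeasurable_approx g : cmeasurable g ->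
  exists g', Cmeas (fun p : Rn * Rn => g' (cvec p)) /\ null_eq g g'.
Proof.
move=> mg.
have [r [N [mr mN N0 rE]]] := @completed_measurable_approx _ _ _ (lebC n)
  (fun p => complex.Re (g (cvec p))) (fun B mB => (mg B mB).1).
have [i [M [mi mM M0 iE]]] := @completed_measurable_approx _ _ _ (lebC n)
  (fun p => complex.Im (g (cvec p))) (fun B mB => (mg B mB).2).
have cvecK : cancel (@cvec R n) (@uncvec R n).
  by move=> [x y]; congr pair; apply/eq_from_tnth => j; rewrite tnth_mktuple mxE.
exists (fun z => (r (uncvec z) +i* i (uncvec z))%C); split.
  by split; under eq_fun do rewrite cvecK.
exists (N `|` M); split; first exact: measurableU.
  apply/(negligibleP (lebC n)); first exact: measurableU.
  by apply: negligibleU; exact/(negligibleP (lebC n)).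
move=> p NM; rewrite cvecK -rE -?iE ?complex_eta //.
- by move=> Mp; apply: NM; right.
- by move=> Np; apply: NM; left.
Qed.

Lemma Cint_null_eq g g' (h : Rn * Rn -> C -> C) : null_eq g g' ->
  Cint (lebC n) (fun p => h p (g (cvec p))) = Cint (lebC n) (fun p => h p (g' (cvec p))).
Proof.
move=> [N [mN N0 E]]; rewrite /Cint /Rintegral; congr (fine _ +i* fine _)%C.
- by apply: (integral_off_null mN N0) => x xN; rewrite E.
- by apply: (integral_off_null mN N0) => x xN; rewrite E.
Qed.

Lemma integral_null_eq g g' (h : Rn * Rn -> C -> \bar R) : null_eq g g' ->
  (\int[lebC n]_p h p (g (cvec p)) = \int[lebC n]_p h p (g' (cvec p)))%E.
Proof.
by move=> [N [mN N0 E]]; apply: (integral_off_null mN N0) => x xN; rewrite E.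
Qed.

End lebesgue_measurable_symbols.

(** * The reproducing kernel of the Hermite-Bergman space *)

Section conjugation.
Context {R : realType}.
Implicit Types z w : R[i].

Lemma conjM z w : ((z * w)^*)%C = (z^*)%C * (w^*)%C.
Proof. exact: rmorphM. Qed.

Lemma conjV z : ((z^-1)^*)%C = ((z^*)%C)^-1.
Proof. exact: conjc_inv. Qed.

Lemma conjR (r : R) : ((r%:C%C)^*)%C = r%:C%C :> R[i].
Proof. exact: conjc_real. Qed.

Lemma rcM (a b : R) : (a * b)%:C%C = a%:C%C * b%:C%C :> R[i].
Proof. exact: rmorphM. Qed.

Lemma rcD (a b : R) : (a + b)%:C%C = a%:C%C + b%:C%C :> R[i].
Proof. exact: rmorphD. Qed.

Lemma rcN (a : R) : (- a)%:C%C = - a%:C%C :> R[i].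
Proof. exact: rmorphN. Qed.

Lemma conj_inner z w (r : R) : ((z * (w^*)%C * r%:C%C)^*)%C = w * (z^*)%C * r%:C%C.
Proof. by rewrite !conjM conjcK conjR [(z^*)%C * w]mulrC. Qed.

Lemma cabsV z : cabs z^-1 = (cabs z)^-1.
Proof. exact: ComplexField.Normc.normcV. Qed.

End conjugation.

Section hyperbolic.
Context {R : realType}.
Implicit Types u t : R.

Lemma sinh_gt0 u : 0 < u -> 0 < sinh u.
Proof. by move=> u0; rewrite divr_gt0 // subr_gt0 ltr_expR; lra. Qed.

Lemma cosh_gt0 u : 0 < cosh u.
Proof. by rewrite divr_gt0 // addr_gt0 // expR_gt0. Qed.

Lemma cosh_sqr u : cosh u ^+ 2 = 1 + sinh u ^+ 2.
Proof.
rewrite /cosh /sinh; have : expR u * expR (- u) = 1 by rewrite -expRD subrr expR0.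
set a := expR u; set b := expR (- u) => ab.
transitivity (a * b + ((a - b) / 2) ^+ 2); last by rewrite ab.
by field.
Qed.

Lemma sinh2 u : sinh (u + u) = 2 * (sinh u * cosh u).
Proof. by rewrite /cosh /sinh opprD !expRD; field. Qed.

Lemma cosh2 u : cosh (u + u) = 1 + 2 * sinh u ^+ 2.
Proof.
rewrite /cosh /sinh opprD !expRD.
have : expR u * expR (- u) = 1 by rewrite -expRD subrr expR0.
set a := expR u; set b := expR (- u) => ab.
transitivity (a * b + 2 * ((a - b) / 2) ^+ 2); last by rewrite ab.
by field.
Qed.

(** These formulas split the exponent of the density into [- al |z|^2] and the real
    part of a holomorphic quadratic form. *)
Lemma tanh_coth_double t : 0 < t ->
  tanh (2 * t) = coth (4 * t) - (sinh (4 * t))^-1 /\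
  coth (2 * t) = coth (4 * t) + (sinh (4 * t))^-1.
Proof.
move=> t0; have -> : 4 * t = 2 * t + 2 * t by ring.
have u0 : 0 < 2 * t by rewrite mulr_gt0.
set u := 2 * t in u0 *.
have s0 : sinh u != 0 by rewrite gt_eqF // sinh_gt0.
have c0 : cosh u != 0 by rewrite gt_eqF // cosh_gt0.
rewrite /tanh /coth sinh2 cosh2; have := cosh_sqr u.
set s := sinh u in s0 *; set c := cosh u in c0 * => cs.
split; first by field; rewrite s0 c0.
have -> : (1 + 2 * s ^+ 2) / (2 * (s * c)) + (2 * (s * c))^-1 = (1 + s ^+ 2) / (s * c).
  by field; rewrite s0 c0.
by rewrite -cs; field; rewrite s0 c0.
Qed.

End hyperbolic.

Section kernel.
Context {R : realType} (n : nat) (t : R) (t_gt0 : 0 < t).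
Local Notation C := R[i].
Local Notation Cn := 'rV[C]_n.
Local Notation Rn := (n.-tuple R).
Local Notation leb := (lebC n).
Implicit Types (f g : Cn -> C) (z w : Cn).

Definition al : R := (sinh (4 * t))^-1.
Definition be : R := coth (4 * t).
Definition cU : R := 4 ^+ n * (sinh (4 * t) `^ (- (n%:R / 2))).
(** Multiplication by [Mt] identifies the Hermite-Bergman space with the Fock space
    of weight [Ew]. *)
Definition Mt z : C := cexp ((be / 2)%:C%C * csq z).
Definition kap : R := (al / pi) ^+ n / cU.
Definition Kf z w : C :=
  kap%:C%C * (Mt z)^-1 * (((Mt w)^-1)^*)%C * cexp (al%:C%C * hdot z w).

Lemma al_gt0 : 0 < al.
Proof. by rewrite invr_gt0 sinh_gt0 // mulr_gt0. Qed.

Lemma cU_gt0 : 0 < cU.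
Proof. by rewrite mulr_gt0 ?exprn_gt0 // powR_gt0 // sinh_gt0 // mulr_gt0. Qed.

Lemma kap_gt0 : 0 < kap.
Proof. by rewrite divr_gt0 ?cU_gt0 // exprn_gt0 // divr_gt0 ?al_gt0 ?pi_gt0. Qed.

Lemma kap_cU : kap * cU = (al / pi) ^+ n.
Proof. by rewrite /kap divfK // gt_eqF // cU_gt0. Qed.

Lemma al_piM : (al / pi) ^+ n * (pi / al) ^+ n = 1.
Proof.
have p0 : (pi : R) != 0 by rewrite gt_eqF // pi_gt0.
by rewrite -exprMn mulrA divfK // divff ?expr1n // gt_eqF // al_gt0.
Qed.

Definition Ew z : R := expR (- (al * csqn z)).

Lemma Mt_neq0 z : Mt z != 0. Proof. exact: cexp_neq0. Qed.

Lemma Re_csq_cvec (p : Rn * Rn) : complex.Re (csq (cvec p)) = sqn p.1 - sqn p.2.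
Proof.
rewrite /csq /sqn -sumrB.
elim/big_ind2 : _ => //; first by move=> z1 r1 z2 r2 <- <-; rewrite ReD.
by move=> j _; rewrite mxE.
Qed.

Lemma UtE (p : Rn * Rn) : Ut t p = cU * (cabs (Mt (cvec p)) ^+ 2 * Ew (cvec p)).
Proof.
rewrite /Ut -/cU; congr (_ * _); have [-> ->] := tanh_coth_double t_gt0.
rewrite /Mt cabs_cexp ReZ Re_csq_cvec /Ew csqn_cvec expr2 -!expRD; congr expR.
rewrite /al /be; field.
by rewrite gt_eqF // sinh_gt0 // mulr_gt0.
Qed.

Lemma UtCE (p : Rn * Rn) : (Ut t p)%:C%C =
  cU%:C%C * (Mt (cvec p) * ((Mt (cvec p))^*)%C * (Ew (cvec p))%:C%C) :> C.
Proof. by rewrite UtE mulcJ !rmorphM. Qed.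

Lemma Ut_ge0 (p : Rn * Rn) : 0 <= Ut t p.
Proof.
by rewrite UtE mulr_ge0 ?(ltW cU_gt0) // mulr_ge0 ?expR_ge0 // sqr_ge0.
Qed.

Lemma entire_Mt : entire Mt.
Proof. by apply: entire_cexp; apply: entireM; [exact: entire_cst|exact: entire_csq]. Qed.

Lemma entire_invMt : entire (fun z => (Mt z)^-1).
Proof.
rewrite (_ : (fun z => _) = (fun z => cexp ((- (be / 2))%:C%C * csq z))).
  by apply: entire_cexp; apply: entireM; [exact: entire_cst|exact: entire_csq].
by apply/funext => z; rewrite /Mt -cexpN rmorphN mulNr.
Qed.

Lemma Cmeas_Mt d (T : measurableType d) (phi : T -> Cn) :
  Vmeas phi -> Cmeas (fun x => Mt (phi x)).
Proof.
by move=> mp; apply: Cmeas_cexp; apply: CmeasM; [exact: Cmeas_cst|exact: Cmeas_csq].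
Qed.

Lemma measurable_Ew d (T : measurableType d) (phi : T -> Cn) :
  Vmeas phi -> measurable_fun setT (fun x => Ew (phi x)).
Proof. exact: measurable_gauss_comp. Qed.

Definition Fock f z : C := f z * Mt z.

Definition Fnorm2 f : \bar R :=
  (\int[leb]_p (cabs (Fock f (cvec p)) ^+ 2 * Ew (cvec p))%:E)%E.

Lemma measurable_Fnorm2 f : Cmeas (fun p : Rn * Rn => f (cvec p)) ->
  measurable_fun setT (fun p : Rn * Rn => cabs (Fock f (cvec p)) ^+ 2 * Ew (cvec p)).
Proof.
move=> mf; apply: measurable_funM.
  apply: measurable_funX; apply: measurable_cabs; apply: CmeasM => //.
  by apply: Cmeas_Mt; exact: Vmeas_id.
by apply: measurable_Ew; exact: Vmeas_id.
Qed.

Lemma sqintE f : Cmeas (fun p : Rn * Rn => f (cvec p)) ->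
  sqint t f = (cU%:E * Fnorm2 f)%E.
Proof.
move=> mf; rewrite /sqint /Fnorm2.
apply: (eq_trans _ (ge0_integralZ leb (measurable_Fnorm2 mf) _ (ltW cU_gt0))).
  apply: eq_integral => p _; congr (_%:E).
  by rewrite UtE /Fock cabsM exprMn; ring.
by move=> p; rewrite mulr_ge0 ?expR_ge0 // sqr_ge0.
Qed.

Lemma Fnorm2_lty f : Cmeas (fun p : Rn * Rn => f (cvec p)) ->
  (sqint t f < +oo)%E -> (Fnorm2 f < +oo)%E.
Proof.
move=> mf; rewrite sqintE // => h; rewrite ltey; apply/eqP => fy.
by move: h; rewrite fy mulry gtr0_sg ?cU_gt0 // mul1e ltxx.
Qed.

Lemma entire_Cmeas f : entire f -> Cmeas (fun p : Rn * Rn => f (cvec p)).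
Proof. by move=> ef; apply: (Cmeas_entire ef); exact: Vmeas_id. Qed.

Lemma Ht_Fock f : Ht t f -> entire (Fock f) /\ (Fnorm2 f < +oo)%E.
Proof.
move=> [ef [_ fy]]; split; first by apply: entireM => //; exact: entire_Mt.
by apply: Fnorm2_lty => //; exact: entire_Cmeas.
Qed.

Lemma Fock_Ht f : entire f -> (Fnorm2 f < +oo)%E -> Ht t f.
Proof.
move=> ef fy; split => //; split; first exact/Cmeas_cmeasurable/entire_Cmeas.
rewrite sqintE; last exact: entire_Cmeas.
by apply: lte_mul_pinfty => //; rewrite lee_fin ltW // cU_gt0.
Qed.

Lemma Kf_conj z w : ((Kf z w)^*)%C = Kf w z.
Proof.
rewrite /Kf !conjM conjcK conjR -cexp_conj conjM conjR -hdotC.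
by congr (_ * _); rewrite mulrAC.
Qed.

Lemma entire_Kf w : entire (Kf^~ w).
Proof.
apply: entireM.
  apply: entireM; last exact: entire_cst.
  by apply: entireM; [exact: entire_cst|exact: entire_invMt].
by apply: entire_cexp; apply: entireM; [exact: entire_cst|exact: entire_hdot].
Qed.

Lemma Fock_Kf w z : Fock (Kf^~ w) z =
  kap%:C%C * (((Mt w)^-1)^*)%C * cexp (al%:C%C * hdot z w).
Proof. by rewrite /Fock /Kf; field; rewrite ?conjc_eq0 !Mt_neq0. Qed.

Lemma Fnorm2_Kf w : Fnorm2 (Kf^~ w) =
  ((kap ^+ 2 / cabs (Mt w) ^+ 2) * (expR (al * csqn w) * (pi / al) ^+ n))%:E.
Proof.
have a0 := al_gt0.
rewrite EFinM (_ : expR (al * csqn w) = expR (csqn (al%:C%C *: w) / al)); last first.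
  rewrite csqnZ cabs_real ger0_norm ?ltW //; congr expR; field; lra.
rewrite -integral_gauss_linear //.
apply: (eq_trans _ (@ge0_integralZ _ _ _ leb _ _ _ _ _)).
- apply: eq_integral => p _; congr (_%:E); rewrite Fock_Kf !cabsM cabs_real.
  rewrite cabs_conj cabsV cabs_cexp ReZ -exprVn (ger0_norm (ltW kap_gt0)).
  have -> : expR (- (al * csqn (cvec p)) + 2 * complex.Re (hdot (cvec p) (al%:C%C *: w))) =
      expR (al * complex.Re (hdot (cvec p) w)) ^+ 2 * Ew (cvec p).
    rewrite /Ew expr2 -!expRD; congr expR; rewrite hdotZr conjR ReZ; ring.
  by set v := (cabs (Mt w))^-1; ring.
- apply: measurableT_comp => //; apply: measurable_funD.
    apply: measurableT_comp => //; apply: measurable_funM; first exact: measurable_cst.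
    by apply: measurable_csqn_comp; exact: Vmeas_id.
  apply: measurable_funM; first exact: measurable_cst.
  have mw : Vmeas (fun _ : Rn * Rn => al%:C%C *: w) by exact: Vmeas_cst.
  exact: (proj1 (Cmeas_hdot (@Vmeas_id R n) mw)).
- by move=> p; rewrite expR_ge0.
- by rewrite divr_ge0 // sqr_ge0.
Qed.

Lemma Ht_Kf w : Ht t (Kf^~ w).
Proof. by apply: Fock_Ht; [exact: entire_Kf|rewrite Fnorm2_Kf ltry]. Qed.

Lemma Kf_reproducing f w : Ht t f ->
  f w = cintegral_mu t (fun z => f z * ((Kf z w)^*)%C).
Proof.
move=> Hf; have [eF Fy] := Ht_Fock Hf; have a0 := al_gt0.
rewrite /cintegral_mu cintegralE.
pose k := kap%:C%C * cU%:C%C * (Mt w)^-1.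
transitivity (Cint leb (fun p => k * (Fock f (cvec p) * cexp (al%:C%C * hdot w (cvec p)) * (Ew (cvec p))%:C%C))).
  rewrite CintZ; last first.
    by apply: Cintegrable_Fock => //; exact: entire_Cmeas.
  transitivity (k * (((pi / al) ^+ n)%:C%C * Fock f w)); last first.
    by apply: (f_equal (fun x => k * x)); apply/esym; exact: Fock_reproducing.
  rewrite /k -rcM kap_cU /Fock.
  by rewrite mulrACA -rcM al_piM mul1r mulrCA mulVf ?mulr1 // Mt_neq0.
apply: eq_Cint => p; rewrite Kf_conj UtCE /Kf /Fock /k conjV.
by field; rewrite ?conjc_eq0 !Mt_neq0.
Qed.

Lemma Kf_is_reproducing : is_reproducing_kernel t Kf.
Proof. by move=> w; split; [exact: Ht_Kf|move=> f; exact: Kf_reproducing]. Qed.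

Lemma measurable_Ut : measurable_fun setT (@Ut R n t).
Proof.
rewrite (_ : @Ut R n t = fun p => cU * (cabs (Mt (cvec p)) ^+ 2 * Ew (cvec p))); last first.
  by apply/funext => p; exact: UtE.
apply: measurable_funM; first exact: measurable_cst.
apply: measurable_funM; last by apply: measurable_Ew; exact: Vmeas_id.
by apply: measurable_funX; apply: measurable_cabs; apply: Cmeas_Mt; exact: Vmeas_id.
Qed.

Lemma measurable_sqrt_Ut : measurable_fun setT (fun p : Rn * Rn => Num.sqrt (Ut t p)).
Proof.
by apply: (measurableT_comp _ measurable_Ut); apply: continuous_measurable_fun; exact: sqrt_continuous.
Qed.

Lemma cabs_inner f g (p : Rn * Rn) : cabs (f (cvec p) * ((g (cvec p))^*)%C * (Ut t p)%:C%C) =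
  cabs (f (cvec p)) * Num.sqrt (Ut t p) * (cabs (g (cvec p)) * Num.sqrt (Ut t p)).
Proof.
rewrite !cabsM cabs_conj cabs_real ger0_norm ?Ut_ge0 //.
by rewrite -[in LHS](sqr_sqrtr (Ut_ge0 p)); ring.
Qed.

Lemma sqint_sqrE f : sqint t f =
  (\int[leb]_p ((cabs (f (cvec p)) * Num.sqrt (Ut t p)) ^+ 2)%:E)%E.
Proof. by apply: eq_integral => p _; rewrite exprMn sqr_sqrtr // Ut_ge0. Qed.

(** Distributing the square root of the density over the two factors makes each of
    them square integrable. *)
Lemma Cintegrable_inner f g :
  Cmeas (fun p : Rn * Rn => f (cvec p)) -> Cmeas (fun p : Rn * Rn => g (cvec p)) ->
  (sqint t f < +oo)%E -> (sqint t g < +oo)%E ->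
  Cintegrable leb (fun p => f (cvec p) * ((g (cvec p))^*)%C * (Ut t p)%:C%C).
Proof.
rewrite !sqint_sqrE => mf mg fy gy; have mU := measurable_sqrt_Ut; split.
  apply: CmeasM; last by apply: Cmeas_real; exact: measurable_Ut.
  by apply: CmeasM => //; exact: Cmeas_conj.
under eq_integral do rewrite cabs_inner.
apply: integral_mul_lty => //.
- by apply: measurable_funM => //; exact: measurable_cabs.
- by apply: measurable_funM => //; exact: measurable_cabs.
- by move=> p; rewrite mulr_ge0 ?cabs_ge0 ?sqrtr_ge0.
- by move=> p; rewrite mulr_ge0 ?cabs_ge0 ?sqrtr_ge0.
Qed.

(** Each of two reproducing kernels reproduces the other, so they coincide by
    Hermitian symmetry. *)
Lemma KtE : Kt t = Kf :> (Cn -> Cn -> C).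
Proof.
have KP : is_reproducing_kernel t (Kt t : Cn -> Cn -> C).
  exact: (@xgetPex _ (fun _ _ => 0) [set K | is_reproducing_kernel t K] (ex_intro _ Kf Kf_is_reproducing)).
apply/funext => v; apply/funext => w.
have [HK repK] := KP w.
rewrite (Kf_reproducing v HK) -Kf_conj (repK _ (Ht_Kf v)).
have [eK [_ Ky]] := HK; have [eF [_ Fy]] := Ht_Kf v.
rewrite /cintegral_mu !cintegralE -Cint_conj.
  apply: eq_Cint => p; by rewrite conj_inner.
exact: (Cintegrable_inner (entire_Cmeas eF) (entire_Cmeas eK)).
Qed.

End kernel.

(** * Norms and bounded operators *)

Section cauchy_schwarz.
Context {R : realType} d (T : measurableType d) (mu : {measure set T -> \bar R}).

(** The optimal weight is [l = sqrt B / sqrt A]; if [A] or [B] vanishes, [l] tends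
    to infinity or to zero. *)
Lemma le_sqrtM_of_mean (X A B : R) : 0 <= A -> 0 <= B ->
  (forall l, 0 < l -> X <= (l * A + B / l) / 2) -> X <= Num.sqrt A * Num.sqrt B.
Proof.
move=> A0 B0 H.
have small (C : R) : 0 <= C -> (forall l, 0 < l -> X <= l * C) -> X <= 0.
  move=> C0 h; apply/ler_addgt0Pr => e e0; rewrite add0r.
  have C1 : 0 < C + 1 by lra.
  apply: le_trans (h (e / (C + 1)) _) _; first by rewrite divr_gt0.
  by rewrite mulrAC ler_pdivrMr // ler_wpM2l ?(ltW e0) //; lra.
have [A1|A1] := eqVneq A 0.
  rewrite A1 sqrtr0 mul0r; apply: (small B) => // l l0.
  have := H l^-1; rewrite invr_gt0 => /(_ l0); rewrite A1 mulr0 add0r invrK.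
  move/le_trans; apply; have := mulr_ge0 (ltW l0) B0; lra.
have [B1|B1] := eqVneq B 0.
  rewrite B1 sqrtr0 mulr0; apply: (small A) => // l l0.
  have := H l l0; rewrite B1 mul0r addr0.
  move/le_trans; apply; have := mulr_ge0 (ltW l0) A0; lra.
have sA : 0 < Num.sqrt A by rewrite sqrtr_gt0 lt_def A1.
have sB : 0 < Num.sqrt B by rewrite sqrtr_gt0 lt_def B1.
(* This weight makes both terms of the mean equal. *)
apply: le_trans (H (Num.sqrt B / Num.sqrt A) (divr_gt0 sB sA)) _.
have key (u v : R) : 0 < u -> 0 < v -> (v / u * u ^+ 2 + v ^+ 2 / (v / u)) / 2 = u * v.
  by move=> u0 v0; field; rewrite !gt_eqF.
by have := key _ _ sA sB; rewrite !sqr_sqrtr // => ->.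
Qed.

Lemma cauchy_schwarz (a b : T -> R) (A B : R) :
  measurable_fun setT a -> measurable_fun setT b ->
  (forall x, 0 <= a x) -> (forall x, 0 <= b x) -> 0 <= A -> 0 <= B ->
  (\int[mu]_x (a x ^+ 2)%:E <= A%:E)%E -> (\int[mu]_x (b x ^+ 2)%:E <= B%:E)%E ->
  (\int[mu]_x (a x * b x)%:E <= (Num.sqrt A * Num.sqrt B)%:E)%E.
Proof.
move=> ma mb a0 b0 A0 B0 hA hB.
have H l : 0 < l -> (\int[mu]_x (a x * b x)%:E <= ((l * A + B / l) / 2)%:E)%E.
  move=> l0; have l2 : 0 <= l / 2 by rewrite divr_ge0 // ltW.
  have l3 : 0 <= l^-1 / 2 by rewrite divr_ge0 // invr_ge0 ltW.
  apply: (@le_trans _ _ (\int[mu]_x ((l / 2 * a x ^+ 2)%:E + (l^-1 / 2 * b x ^+ 2)%:E))%E).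
    apply: ge0_le_integral => //.
    - by move=> x _; rewrite lee_fin mulr_ge0.
    - by apply/measurable_EFinP; exact: measurable_funM.
    - apply: emeasurable_funD; apply/measurable_EFinP; apply: measurable_funM;
        by [exact: measurable_cst|exact: measurable_funX].
    - move=> x _; rewrite -EFinD lee_fin.
      have := sqr_ge0 (l * a x - b x); rewrite sqrrB => h.
      rewrite -(ler_pM2l l0).
      have -> : l * (l / 2 * a x ^+ 2 + l^-1 / 2 * b x ^+ 2) = ((l * a x) ^+ 2 + b x ^+ 2) / 2.
        by field; rewrite gt_eqF.
      lra.
  rewrite ge0_integralD //.
  - rewrite ge0_integralZ //; [|exact: measurable_funX|by move=> x; exact: sqr_ge0].
    rewrite ge0_integralZ //; [|exact: measurable_funX|by move=> x; exact: sqr_ge0].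
    have -> : (l * A + B / l) / 2 = l / 2 * A + l^-1 / 2 * B by field; rewrite gt_eqF.
    rewrite EFinD !EFinM; apply: leeD; apply: lee_wpmul2l => //; by rewrite -EFinM lee_fin.
  - by move=> x _; rewrite lee_fin mulr_ge0 // sqr_ge0.
  - by apply/measurable_EFinP; apply: measurable_funM; [exact: measurable_cst|exact: measurable_funX].
  - by move=> x _; rewrite lee_fin mulr_ge0 // sqr_ge0.
  - by apply/measurable_EFinP; apply: measurable_funM; [exact: measurable_cst|exact: measurable_funX].
have X0 : (0 <= \int[mu]_x (a x * b x)%:E)%E.
  by apply: integral_ge0 => x _; rewrite lee_fin mulr_ge0.
have Xfin : (\int[mu]_x (a x * b x)%:E)%E \is a fin_num.
  by rewrite ge0_fin_numE //; apply: le_lt_trans (H 1 ltr01) (ltry _).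
rewrite -(fineK Xfin) lee_fin; apply: le_sqrtM_of_mean => // l l0.
by rewrite -lee_fin fineK //; exact: H.
Qed.

End cauchy_schwarz.

Section hilbert_space.
Context {R : realType} (n : nat) (t : R) (t_gt0 : 0 < t).
Local Notation C := R[i].
Local Notation Cn := 'rV[C]_n.
Local Notation Rn := (n.-tuple R).
Local Notation leb := (lebC n).
Implicit Types (f g h : Cn -> C) (z w : Cn).

Lemma sqint_ge0 f : (0 <= sqint t f)%E.
Proof.
by apply: integral_ge0 => p _; rewrite lee_fin mulr_ge0 ?Ut_ge0 // sqr_ge0.
Qed.

Lemma sqint_fin f : Ht t f -> sqint t f = (normL2 t f ^+ 2)%:E.
Proof.
move=> [ef [_ fy]]; rewrite /normL2 sqr_sqrtr; last by rewrite fine_ge0 // sqint_ge0.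
by rewrite fineK // ge0_fin_numE // sqint_ge0.
Qed.

Lemma normL2_ge0 f : 0 <= normL2 t f. Proof. exact: sqrtr_ge0. Qed.

Lemma inner_le f h : Ht t f -> Ht t h ->
  cabs (cintegral_mu t (fun z => f z * ((h z)^*)%C)) <= normL2 t f * normL2 t h.
Proof.
move=> Hf Hh; have [ef [_ fy]] := Hf; have [eh [_ hy]] := Hh.
have mf := entire_Cmeas ef; have mh := entire_Cmeas eh.
have If := Cintegrable_inner t_gt0 mf mh fy hy.
rewrite -lee_fin /cintegral_mu cintegralE; apply: le_trans (cabs_Cint If) _.
have -> : normL2 t f * normL2 t h = Num.sqrt (normL2 t f ^+ 2) * Num.sqrt (normL2 t h ^+ 2).
  by rewrite !sqrtr_sqr !ger0_norm ?normL2_ge0.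
under eq_integral do rewrite cabs_inner //.
have mU := @measurable_sqrt_Ut R n t t_gt0.
apply: cauchy_schwarz.
- by apply: measurable_funM => //; exact: measurable_cabs.
- by apply: measurable_funM => //; exact: measurable_cabs.
- by move=> p; rewrite mulr_ge0 ?cabs_ge0 ?sqrtr_ge0.
- by move=> p; rewrite mulr_ge0 ?cabs_ge0 ?sqrtr_ge0.
- exact: sqr_ge0.
- exact: sqr_ge0.
- by rewrite -sqint_fin // sqint_sqrE.
- by rewrite -sqint_fin // sqint_sqrE.
Qed.

Lemma normL2_Kf w : normL2 t (Kf t ^~ w) = Num.sqrt (complex.Re (Kf t w w)).
Proof.
have Hw := Ht_Kf t_gt0 w.
have := Kf_reproducing t_gt0 w Hw; rewrite /cintegral_mu cintegralE => ->.
have ReE (h : Rn * Rn -> C) : complex.Re (Cint leb h) = (\int[leb]_p complex.Re (h p))%R by [].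
rewrite ReE /normL2 /Rintegral /sqint; congr (Num.sqrt (fine _)).
apply: eq_integral => p _; congr (_%:E).
by rewrite mulcJ -rcM.
Qed.

Lemma Re_Kf w : complex.Re (Kf t w w) =
  kap n t / cabs (Mt t w) ^+ 2 * expR (al t * csqn w).
Proof.
rewrite /Kf -(mulrA (kap n t)%:C%C) mulcJ cabsV hdotxx -!rcM cexp_real -rcM /=.
by rewrite exprVn.
Qed.

Lemma point_eval_le f z : Ht t f ->
  cabs (f z) <= normL2 t f * Num.sqrt (complex.Re (Kf t z z)).
Proof.
move=> Hf; rewrite {1}(Kf_reproducing t_gt0 z Hf) -normL2_Kf.
exact: (@inner_le f (Kf t ^~ z) Hf (Ht_Kf t_gt0 z)).
Qed.

Lemma Ht0 : Ht t (fun _ : Cn => 0).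
Proof.
apply: (Fock_Ht t_gt0 (entire_cst 0)).
rewrite /Fnorm2 /Fock; under eq_integral do rewrite mul0r cabs0 expr0n mul0r.
by rewrite integral0 ltry.
Qed.

Lemma FnormZ (c : C) f : Ht t f -> Fnorm2 t (fun z => c * f z) = ((cabs c ^+ 2)%:E * Fnorm2 t f)%E.
Proof.
move=> [ef _]; rewrite /Fnorm2.
apply: (eq_trans _ (@ge0_integralZ _ _ _ leb _ _ (measurable_Fnorm2 t (entire_Cmeas ef)) _ (sqr_ge0 _))).
  by apply: eq_integral => p _; rewrite /Fock -mulrA cabsM exprMn mulrA.
by move=> p; rewrite mulr_ge0 ?expR_ge0 // sqr_ge0.
Qed.

Lemma HtZ (c : C) f : Ht t f -> Ht t (fun z => c * f z).
Proof.
move=> Hf; have [_ fy] := Ht_Fock t_gt0 Hf; apply: Fock_Ht => //.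
  by apply: entireM; [exact: entire_cst|exact: (proj1 Hf)].
by rewrite FnormZ //; apply: lte_mul_pinfty => //; rewrite lee_fin sqr_ge0.
Qed.

Lemma normL2Z (c : C) f : Ht t f -> normL2 t (fun z => c * f z) = cabs c * normL2 t f.
Proof.
move=> Hf; rewrite -[LHS]ger0_norm ?normL2_ge0 // -sqrtr_sqr.
rewrite -[RHS]ger0_norm ?mulr_ge0 ?cabs_ge0 ?normL2_ge0 // -sqrtr_sqr; congr Num.sqrt.
apply: EFin_inj; rewrite -sqint_fin; last exact: HtZ.
rewrite exprMn EFinM -sqint_fin // !sqintE //; first by rewrite FnormZ // muleCA.
- exact: entire_Cmeas (proj1 Hf).
- exact: entire_Cmeas (proj1 (HtZ c Hf)).
Qed.

Lemma normL20 : normL2 t (fun _ : Cn => 0) = 0.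
Proof.
have := normL2Z 0 Ht0; by rewrite cabs0 !mul0r.
Qed.

Section bounded.
Variables (S : (Cn -> C) -> (Cn -> C)) (bS : bounded_operator t S).

Lemma bounded_operator0 : S (fun=> 0) = (fun=> 0).
Proof.
have [_ lS _] := bS; have := lS 1 _ _ Ht0 Ht0.
rewrite (_ : (fun z => 1 * 0 + 0) = (fun _ : Cn => 0 : C)); last first.
  by apply/funext => z; rewrite mulr0 addr0.
move=> h; apply/funext => z; have := congr1 (fun k => k z) h; rewrite mul1r.
by move/eqP; rewrite -subr_eq0 opprD addrA subrr sub0r oppr_eq0 => /eqP.
Qed.

Lemma bounded_operatorZ (c : C) f : Ht t f -> S (fun z => c * f z) = (fun z => c * S f z).
Proof.
move=> Hf; have [_ lS _] := bS; have := lS c _ _ Hf Ht0.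
rewrite bounded_operator0 => h.
rewrite (_ : (fun z => c * f z) = (fun z => c * f z + 0)); last first.
  by apply/funext => z; rewrite addr0.
by rewrite h; apply/funext => z; rewrite addr0.
Qed.

Let unit_values := [set r | exists f, [/\ Ht t f, normL2 t f <= 1 & r = normL2 t (S f)]].

Let unit_ub : has_ubound unit_values.
Proof.
have [_ _ [M HM]] := bS; exists `|M| => _ [f [Hf f1 ->]].
apply: le_trans (HM f Hf) _; apply: le_trans (ler_norm _) _.
by rewrite normrM ler_piMr // ger0_norm // normL2_ge0.
Qed.

Lemma operator_norm_ge0 : 0 <= operator_norm t S.
Proof.
apply: ub_le_sup => //; exists (fun=> 0); split; [exact: Ht0|by rewrite normL20|].
by rewrite bounded_operator0 normL20.
Qed.

(** The supremum is over the unit ball, so [f] is scaled to norm one; for a function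
    of norm zero the bound of the operator shows that the image has norm zero. *)
Lemma operator_norm_le f : Ht t f -> normL2 t (S f) <= operator_norm t S * normL2 t f.
Proof.
move=> Hf; have [SH lS [M HM]] := bS.
have [f0|f0] := eqVneq (normL2 t f) 0.
  by have := HM f Hf; rewrite f0 !mulr0.
have fp : 0 < normL2 t f by rewrite lt_def f0 normL2_ge0.
rewrite -ler_pdivrMr //.
apply: ub_le_sup => //; exists (fun z => ((normL2 t f)^-1)%:C%C * f z); split.
- exact: HtZ.
- by rewrite normL2Z // cabs_real ger0_norm ?invr_ge0 ?normL2_ge0 // mulVf.
- rewrite bounded_operatorZ // normL2Z; last exact: SH.
  by rewrite cabs_real ger0_norm ?invr_ge0 ?normL2_ge0 // mulrC.
Qed.

End bounded.
End hilbert_space.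

(** * Bounding the heat transform by the operator norm *)

Section complex_gauss_integrable.
Context {R : realType} (n : nat).
Local Notation Cn := 'rV[R[i]]_n.

Definition hdotE := (@hdotZl R n, @hdotZr R n, @hdotDl R n, @hdotDr R n,
  @hdotNl R n, @hdotNr R n, @conjM R, @conjR R).

Lemma Cintegrable_complex_gauss (d : R) (A B : Cn) : 0 < d ->
  Cintegrable (lebC n) (fun p => cexp (hdot (cvec p) A + hdot B (cvec p)) *
     (expR (- (d * csqn (cvec p))))%:C%C).
Proof.
move=> d0; pose F (z : Cn) := cexp (hdot z A).
have dF : entire F by apply: entire_cexp; exact: entire_hdot.
have dw : d%:C%C * (d^-1)%:C%C = 1 :> R[i] by rewrite -rmorphM /= divff ?gt_eqF.
have := @Cintegrable_Fock R n F d ((d^-1)%:C%C *: B) d0 (entire_Cmeas dF).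
have -> : (fun p : n.-tuple R * n.-tuple R => (cabs (F (cvec p)) ^+ 2 * expR (- (d * csqn (cvec p))))%:E) =
  (fun p => (expR (- (d * csqn (cvec p)) + 2 * complex.Re (hdot (cvec p) A)))%:E).
  by apply/funext => p; rewrite /F cabs_cexp expr2 -!expRD; congr (expR _)%:E; ring.
rewrite integral_gauss_linear // ltry => /(_ isT).
congr (Cintegrable _); apply/funext => p.
by rewrite /F hdotZl mulrA dw mul1r cexpD.
Qed.

End complex_gauss_integrable.

Section toeplitz_kernel.
Context {R : realType} (n : nat) (t : R) (t_gt0 : 0 < t).
Local Notation C := R[i].
Local Notation Cn := 'rV[C]_n.
Local Notation Rn := (n.-tuple R).
Local Notation leb := (lebC n).
Local Notation al := (al t).
Local Notation Mt := (Mt t).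
Local Notation Ew := (Ew t).
Local Notation Kf := (Kf t).
Implicit Types (f h : Cn -> C) (z w u : Cn).
Variable g : Cn -> C.

Lemma toeplitzE f z : toeplitz t g f z = Cint leb (fun p =>
  (((al / pi) ^+ n)%:C%C * (Mt z)^-1) *
  (g (cvec p) * Fock t f (cvec p) * cexp (al%:C%C * hdot z (cvec p)) * (Ew (cvec p))%:C%C)).
Proof.
rewrite /toeplitz /cintegral_mu cintegralE KtE //; apply: eq_Cint => p.
rewrite UtCE // -(kap_cU n t_gt0) rcM /Kf /Fock conjV.
by field; rewrite ?conjc_eq0 !Mt_neq0.
Qed.

(** The integral kernel of the Toeplitz operator in the Fock picture; it is
    holomorphic in [z] and antiholomorphic in [u]. *)
Definition bker z u : C := Cint leb (fun p =>
  g (cvec p) * cexp (al%:C%C * hdot (cvec p) u + al%:C%C * hdot z (cvec p)) * (Ew (cvec p))%:C%C).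

Hypothesis mg : Cmeas (fun p : Rn * Rn => g (cvec p)).
Hypothesis Hg : forall v, (\int[leb]_p
  (cabs (g (cvec p)) ^+ 2 * expR (2 * al * complex.Re (hdot (cvec p) v)) * Ew (cvec p))%:E < +oo)%E.

Lemma measurable_expR_hdot d0 (T : measurableType d0) (phi : T -> Cn) (k : R) v : Vmeas phi ->
  measurable_fun setT (fun x => expR (k * complex.Re (hdot (phi x) v))).
Proof.
move=> mp; apply: measurableT_comp => //; apply: measurable_funM; first exact: measurable_cst.
have mv : Vmeas (fun _ : T => v) by exact: Vmeas_cst.
exact: (proj1 (Cmeas_hdot mp mv)).
Qed.

(** The factor [exp (- al |w|^2 / 2)] makes [g] square integrable, and the Gaussian
    that remains has positive rate because [al / 2 < k]. *)
Lemma gauss_tail_finite (k : R) (m : Cn) : al / 2 < k ->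
  (\int[leb]_p (cabs (g (cvec p)) * expR (- (k * csqn (cvec p - m))))%:E < +oo)%E.
Proof.
move=> kal; have a0 := al_gt0 t_gt0; have mI := @Vmeas_id R n.
pose e (p : Rn * Rn) := expR (- (al / 2 * csqn (cvec p : Cn))).
pose f (p : Rn * Rn) := expR (- (k * csqn (cvec p - m))) * expR (- (- (al / 2) * csqn (cvec p))).
have me : measurable_fun setT e by exact: measurable_gauss_comp.
rewrite (_ : (fun p => _) = (fun p => (cabs (g (cvec p)) * e p * f p)%:E)); last first.
  by apply/funext => p; rewrite -mulrA /e /f -!expRD; congr (_ * expR _)%:E; lra.
apply: integral_mul_lty.
- by apply: measurable_funM => //; exact: measurable_cabs.
- apply: measurable_funM; last exact: measurable_gauss_comp.
  by apply: measurable_gauss_comp; apply: VmeasB => //; exact: Vmeas_cst.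
- by move=> p; rewrite mulr_ge0 ?cabs_ge0 ?expR_ge0.
- by move=> p; rewrite mulr_ge0 ?expR_ge0.
- have := Hg 0; congr (_ < _)%E; apply: eq_integral => p _; congr (_%:E).
  rewrite hdot0r mulr0 expR0 mulr1 exprMn /Ew /e [expR _ ^+ 2]expr2 -expRD.
  by congr (_ * expR _); lra.
have mf : measurable_fun setT (fun p : Rn * Rn =>
    expR (- ((2 * k - al) * csqn (cvec p)) + 2 * complex.Re (hdot (cvec p) ((2 * k)%:C%C *: m)))).
  under eq_fun do rewrite expRD.
  by apply: measurable_funM; [exact: measurable_gauss_comp|exact: measurable_expR_hdot].
rewrite (_ : (fun p => _) = (fun p => (expR (- (2 * k * csqn m)) *
    expR (- ((2 * k - al) * csqn (cvec p)) + 2 * complex.Re (hdot (cvec p) ((2 * k)%:C%C *: m))))%:E)).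
  rewrite [X in (X < _)%E](ge0_integralZ leb mf (fun=> expR_ge0 _) (expR_ge0 _)).
  by rewrite integral_gauss_linear ?EFinM ?ltry //; lra.
apply/funext => p; rewrite /f expr2 -!expRD; congr (expR _)%:E.
by rewrite hdotZr conjR ReZ csqnB; lra.
Qed.

Lemma Cintegrable_gauss_tail (k : R) (m : Cn) : al / 2 < k ->
  Cintegrable leb (fun p => g (cvec p) * (expR (- (k * csqn (cvec p - m))))%:C%C).
Proof.
move=> kal; split.
  apply: CmeasM => //; apply: Cmeas_gauss; apply: VmeasB; [exact: Vmeas_id|exact: Vmeas_cst].
under eq_integral do rewrite cabsM cabs_real ger0_norm ?expR_ge0 //.
exact: gauss_tail_finite.
Qed.

Definition mid z u : Cn := (2^-1)%:C%C *: (z + u).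

(** The modulus of the integrand of [bker] is a Gaussian centred at the midpoint of
    [z] and [u]. *)
Lemma Re_bker_exponent z u w :
  complex.Re (al%:C%C * hdot w u + al%:C%C * hdot z w) - al * csqn w =
  - (al * csqn (w - mid z u)) + al * csqn (mid z u).
Proof.
rewrite csqnB ReD !ReZ /mid hdotZr conjR ReZ hdotDr ReD (Re_hdotC w z).
lra.
Qed.

Lemma bker_integrand_abs z u w :
  cabs (g w * cexp (al%:C%C * hdot w u + al%:C%C * hdot z w) * (Ew w)%:C%C) =
  expR (al * csqn (mid z u)) * (cabs (g w) * expR (- (al * csqn (w - mid z u)))).
Proof.
rewrite !cabsM cabs_cexp cabs_real ger0_norm ?expR_ge0 // -mulrA -expRD.
by rewrite Re_bker_exponent mulrCA -expRD addrC.
Qed.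

Lemma Cmeas_bker_integrand z u : Cmeas (fun p : Rn * Rn =>
  g (cvec p) * cexp (al%:C%C * hdot (cvec p) u + al%:C%C * hdot z (cvec p)) * (Ew (cvec p))%:C%C).
Proof.
have mI := @Vmeas_id R n.
have mz : Vmeas (fun _ : Rn * Rn => z) by exact: Vmeas_cst.
have mu : Vmeas (fun _ : Rn * Rn => u) by exact: Vmeas_cst.
apply: CmeasM; last exact: Cmeas_gauss.
apply: CmeasM => //; apply: Cmeas_cexp; apply: CmeasD; apply: CmeasM;
  by [exact: Cmeas_cst|exact: Cmeas_hdot].
Qed.

Lemma Cintegrable_bker z u : Cintegrable leb (fun p =>
  g (cvec p) * cexp (al%:C%C * hdot (cvec p) u + al%:C%C * hdot z (cvec p)) * (Ew (cvec p))%:C%C).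
Proof.
have a0 := al_gt0 t_gt0.
have ka : al / 2 < al by lra.
have [mh hy] := CintegrableM (expR (al * csqn (mid z u)))%:C%C (Cintegrable_gauss_tail (mid z u) ka).
split; first exact: Cmeas_bker_integrand.
apply: le_lt_trans hy; rewrite le_eqVlt; apply/orP; left; apply/eqP.
apply: eq_integral => p _; congr (_%:E); rewrite bker_integrand_abs.
by rewrite !cabsM !cabs_real !ger0_norm ?expR_ge0.
Qed.

Lemma toeplitz_Kf u z : toeplitz t g (Kf ^~ u) z =
  (((al / pi) ^+ n)%:C%C * (Mt z)^-1 * ((kap n t)%:C%C * (((Mt u)^-1)^*)%C)) * bker z u.
Proof.
rewrite toeplitzE -CintZ; last exact: Cintegrable_bker.
by apply: eq_Cint => p; rewrite Fock_Kf // cexpD; ring.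
Qed.

Section lower_bound.
Variables (S : (Cn -> C) -> (Cn -> C)).
Hypotheses (bS : bounded_operator t S)
  (ST : forall u, S (Kf ^~ u) = toeplitz t g (Kf ^~ u)).
Local Notation NS := (operator_norm t S).

(** Up to normalization [bker z u] is the value at [z] of [S] applied to the kernel
    function at [u], which the norm of [S] and point evaluation control. *)
Lemma bker_bound z u : cabs (bker z u) <=
  NS * (pi / al) ^+ n * expR (al * (csqn z + csqn u) / 2).
Proof.
have a0 := al_gt0 t_gt0; have k0 := kap_gt0 n t_gt0.
have [SH _ _] := bS.
have Hu := Ht_Kf t_gt0 u.
have := point_eval_le t_gt0 z (SH _ Hu).
have Mz : 0 < cabs (Mt z) by rewrite cabs_cexp expR_gt0.
have Mu : 0 < cabs (Mt u) by rewrite cabs_cexp expR_gt0.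
have e0 w : 0 <= expR (al * csqn w / 2) by exact: expR_ge0.
have sqE w : 0 < cabs (Mt w) -> Num.sqrt (complex.Re (Kf w w)) =
    Num.sqrt (kap n t) / cabs (Mt w) * expR (al * csqn w / 2).
  move=> Mw; rewrite Re_Kf.
  have -> : kap n t / cabs (Mt w) ^+ 2 * expR (al * csqn w) =
      (Num.sqrt (kap n t) / cabs (Mt w) * expR (al * csqn w / 2)) ^+ 2.
    have e2 : expR (al * csqn w) = expR (al * csqn w / 2) ^+ 2.
      by rewrite expr2 -expRD; congr expR; lra.
    rewrite e2 -{1}(sqr_sqrtr (ltW k0)) -exprVn.
    by set v := (cabs (Mt w))^-1; ring.
  by rewrite sqrtr_sqr ger0_norm // !mulr_ge0 ?sqrtr_ge0 ?invr_ge0 ?cabs_ge0.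
have NK : normL2 t (S (Kf ^~ u)) <= NS * (Num.sqrt (kap n t) / cabs (Mt u) * expR (al * csqn u / 2)).
  by rewrite -sqE // -normL2_Kf //; exact: operator_norm_le.
rewrite {1}ST toeplitz_Kf sqE // !cabsM !cabs_real cabs_conj !cabsV => h.
have {}h := le_trans h (ler_wpM2r _ NK).
have pa0 : 0 < (al / pi) ^+ n by rewrite exprn_gt0 // divr_gt0 // pi_gt0.
rewrite !ger0_norm ?(ltW k0) ?(ltW pa0) // in h.
pose c := (al / pi) ^+ n * (cabs (Mt z))^-1 * (kap n t * (cabs (Mt u))^-1).
have c0 : 0 < c.
  by rewrite /c; repeat apply: mulr_gt0 => //; rewrite invr_gt0.
have sk : kap n t = Num.sqrt (kap n t) ^+ 2 by rewrite sqr_sqrtr // ltW.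
have -> : expR (al * (csqn z + csqn u) / 2) = expR (al * csqn u / 2) * expR (al * csqn z / 2).
  by rewrite -expRD; congr expR; lra.
rewrite -(ler_pM2l c0); apply: le_trans (h _) _.
  by rewrite !mulr_ge0 ?sqrtr_ge0 ?invr_ge0 ?cabs_ge0.
rewrite le_eqVlt; apply/orP; left; apply/eqP; rewrite /c.
transitivity (((al / pi) ^+ n * (pi / al) ^+ n) * (NS * Num.sqrt (kap n t) ^+ 2 / cabs (Mt z) / cabs (Mt u) * expR (al * csqn u / 2) * expR (al * csqn z / 2))).
  by rewrite al_piM //; ring.
rewrite -sk; ring.
Qed.

Variables (a b kp : R) (z0 : Cn).
Hypotheses (ab : a ^+ 2 = b ^+ 2) (a1 : a ^+ 2 < 1)
  (abk : a * b = 1 - kp / al) (abs2 : (a + b) ^+ 2 / 4 < 2^-1).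

Let Psi (q : (Rn * Rn) * (Rn * Rn)) : C :=
  let om := cvec q.1 in let ze := cvec q.2 - z0 in
  g (cvec q.2) * (expR (- (al * csqn ze)))%:C%C *
  cexp (hdot om ((al * b)%:C%C *: ze) + hdot ((al * a)%:C%C *: ze) om) * (Ew om)%:C%C.

Let mPsi : Cmeas Psi.
Proof.
have m1 : Vmeas (fun q : (Rn * Rn) * (Rn * Rn) => cvec q.1 : Cn).
  by apply: Vmeas_cvec; exact: measurable_fst.
have m2 : Vmeas (fun q : (Rn * Rn) * (Rn * Rn) => cvec q.2 - z0 : Cn).
  by apply: VmeasB; [apply: Vmeas_cvec; exact: measurable_snd|exact: Vmeas_cst].
have mZ k : Vmeas (fun q : (Rn * Rn) * (Rn * Rn) => k *: (cvec q.2 - z0) : Cn).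
  by apply: VmeasZ => //; exact: Cmeas_cst.
apply: CmeasM; last exact: Cmeas_gauss.
apply: CmeasM.
  by apply: CmeasM; [exact: (Cmeas_comp mg measurable_snd)|exact: Cmeas_gauss].
by apply: Cmeas_cexp; apply: CmeasD; exact: Cmeas_hdot.
Qed.

Let IPsi : Cintegrable (leb \x leb)%E Psi.
Proof.
have a0 := al_gt0 t_gt0.
apply: Cintegrable_prod21 => //.
pose k := al * (1 - (a + b) ^+ 2 / 4).
have kal : al / 2 < k by rewrite /k ltr_pM2l //; move: abs2; set X := _ / 4; lra.
rewrite (_ : (fun y => _) = (fun p : Rn * Rn => ((pi / al) ^+ n *
   (cabs (g (cvec p)) * expR (- (k * csqn (cvec p - z0)))))%:E)).
  rewrite ge0_integralZ.
  - by apply: lte_mul_pinfty; rewrite ?lee_fin ?exprn_ge0 ?divr_ge0 ?pi_ge0 ?(ltW a0) //; exact: gauss_tail_finite.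
  - apply: measurable_funM; first exact: measurable_cabs.
    by apply: measurable_gauss_comp; apply: VmeasB; [exact: Vmeas_id|exact: Vmeas_cst].
  - by move=> p; rewrite mulr_ge0 ?cabs_ge0 ?expR_ge0.
  - by rewrite exprn_ge0 // divr_ge0 ?pi_ge0 // ltW.
apply/funext => p; set ze := cvec p - z0.
pose c := cabs (g (cvec p)) * expR (- (al * csqn ze)).
pose A := (al * (a + b) / 2)%:C%C *: ze.
transitivity (\int[leb]_x (c * expR (- (al * csqn (cvec x)) + 2 * complex.Re (hdot (cvec x) A)))%:E)%E.
  apply: eq_integral => x _; congr (_%:E).
  rewrite /Psi /= !cabsM !cabs_real !ger0_norm ?expR_ge0 // cabs_cexp -/ze -/c.
  rewrite -mulrA -expRD; congr (_ * expR _).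
  rewrite ReD /A hdotZl !hdotZr !conjR !ReZ (Re_hdotC (cvec x) ze); lra.
rewrite ge0_integralZ.
- rewrite integral_gauss_linear // -EFinM; congr (_%:E).
  rewrite /c /A csqnZ cabs_real real_normK ?num_real //.
  have -> : expR (- (k * csqn ze)) = expR (- (al * csqn ze)) * expR ((al * (a + b) / 2) ^+ 2 * csqn ze / al).
    by rewrite -expRD /k; congr expR; field; rewrite gt_eqF.
  ring.
- under eq_fun do rewrite expRD.
  have mI := @Vmeas_id R n.
  by apply: measurable_funM; [exact: measurable_gauss_comp|exact: measurable_expR_hdot].
- by move=> x; rewrite expR_ge0.
- by rewrite mulr_ge0 ?cabs_ge0 ?expR_ge0.
Qed.

(** The part of the exponent of [Psi] that is linear in [om] or constant, once the
    exponent of [bker] is taken out. *)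
Let phase (om : Cn) : C := cexp (- (al%:C%C * hdot z0 z0) - (al * a)%:C%C * hdot z0 om - (al * b)%:C%C * hdot om z0).

Let Psi_bker x : Cint leb (fun p => Psi (x, p)) =
  phase (cvec x) * (Ew (cvec x))%:C%C * bker (z0 + b%:C%C *: cvec x) (z0 + a%:C%C *: cvec x).
Proof.
rewrite -CintZ; last exact: Cintegrable_bker.
apply: eq_Cint => p; rewrite /Psi /phase /= /Ew.
set om := cvec x; set w := cvec p.
rewrite -!cexp_real.
rewrite (_ : _ * _ * _ * _ = g w * (cexp (- (al * csqn (w - z0)))%:C%C * cexp (hdot om ((al * b)%:C%C *: (w - z0)) +
  hdot ((al * a)%:C%C *: (w - z0)) om) * cexp (- (al * csqn om))%:C%C)); last by ring.
rewrite [RHS](_ : _ = g w * (cexp (- (al%:C%C * hdot z0 z0) - (al * a)%:C%C * hdot z0 om - (al * b)%:C%C * hdot om z0) * cexp (- (al * csqn om))%:C%C *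
  cexp (al%:C%C * hdot w (z0 + a%:C%C *: om) + al%:C%C * hdot (z0 + b%:C%C *: om) w) * cexp (- (al * csqn w))%:C%C)); last by ring.
rewrite -!cexpD; congr (_ * cexp _).
rewrite !rcN !rcM -!hdotxx !hdotE; ring.
Qed.

Let Psi_gauss p : Cint leb (fun x => Psi (x, p)) =
  ((pi / al) ^+ n)%:C%C * (g (cvec p) * (expR (- (kp * csqn (cvec p - z0))))%:C%C).
Proof.
have a0 := al_gt0 t_gt0.
set ze := cvec p - z0; pose c := g (cvec p) * (expR (- (al * csqn ze)))%:C%C.
transitivity (Cint leb (fun x => c * (cexp (hdot (cvec x) ((al * b)%:C%C *: ze) + hdot ((al * a)%:C%C *: ze) (cvec x)) *
     (expR (- (al * csqn (cvec x))))%:C%C))).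
  by apply: eq_Cint => x; rewrite /Psi /= -/ze -/c mulrA.
rewrite CintZ; last exact: Cintegrable_complex_gauss.
rewrite complex_gauss // /c hdotZl hdotZr conjR hdotxx -!rcM cexp_real.
have -> : expR (- (kp * csqn ze)) = expR (- (al * csqn ze)) * expR (al^-1 * (al * a * (al * b * csqn ze))).
  rewrite -expRD; congr expR.
  have -> : al^-1 * (al * a * (al * b * csqn ze)) = al * (a * b) * csqn ze by field; rewrite gt_eqF.
  by rewrite abk; field; rewrite gt_eqF.
by rewrite rcM; ring.
Qed.

(** The double integral of [Psi] is computed twice. Integrating over the Gaussian
    variable first leaves the heat integral of [g]; integrating over the variable
    of [g] first leaves values of [bker], and the condition [a ^+ 2 = b ^+ 2] makes
    the terms linear in the Gaussian variable cancel in the bound. *)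
Lemma heat_integral_bound :
  cabs (Cint leb (fun p => g (cvec p) * (expR (- (kp * csqn (cvec p - z0))))%:C%C)) <=
  (pi / (al * (1 - a ^+ 2))) ^+ n * NS.
Proof.
have a0 := al_gt0 t_gt0.
have pa0 : 0 < (pi / al) ^+ n by rewrite exprn_gt0 // divr_gt0 // pi_gt0.
have kpE : kp = al * (1 - a * b) by rewrite abk; field; rewrite gt_eqF.
have kal : al / 2 < kp.
  rewrite kpE ltr_pM2l //; move: abs2; have := sqr_ge0 (a - b); lra.
set X := Cint leb _.
have E : Cint leb (fun p => Cint leb (fun x => Psi (x, p))) = ((pi / al) ^+ n)%:C%C * X.
  exact: (eq_trans (eq_Cint leb Psi_gauss) (CintZ _ (Cintegrable_gauss_tail z0 kal))).
have F : Cint leb (fun x => Cint leb (fun p => Psi (x, p))) = ((pi / al) ^+ n)%:C%C * X.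
  by rewrite -E; exact: (Cfubini IPsi).
have d0 : 0 < al * (1 - a ^+ 2) by rewrite mulr_gt0 // subr_gt0.
pose M := NS * (pi / al) ^+ n.
have M0 : 0 <= M by rewrite mulr_ge0 ?(ltW pa0) //; exact: operator_norm_ge0.
have mE := measurable_gauss_comp (al * (1 - a ^+ 2)) (@Vmeas_id R n).
have Eint : (\int[leb]_x (M * expR (- (al * (1 - a ^+ 2) * csqn (cvec x))))%:E =
    (M * (pi / (al * (1 - a ^+ 2))) ^+ n)%:E)%E.
  by rewrite (ge0_integralZ leb mE (fun=> expR_ge0 _) M0) integral_csqn_gauss.
have bnd x : cabs (Cint leb (fun p => Psi (x, p))) <= M * expR (- (al * (1 - a ^+ 2) * csqn (cvec x))).
  rewrite Psi_bker !cabsM cabs_real ger0_norm ?expR_ge0 //.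
  apply: le_trans (ler_wpM2l _ (bker_bound _ _)) _; first by rewrite mulr_ge0 ?cabs_ge0 ?expR_ge0.
  rewrite -/M /phase cabs_cexp /Ew mulrCA ler_wpM2l // -!expRD ler_expR.
  rewrite le_eqVlt; apply/orP; left; apply/eqP.
  rewrite !ReD !ReN !ReZ hdotxx (Re_hdotC z0 (cvec x)) !csqnD !csqnZ !cabs_real !real_normK ?num_real //.
  rewrite !hdotZr !conjR !ReZ -ab (Re_hdotC (cvec x) z0) /=; lra.
have Ix : Cintegrable leb (fun x => Cint leb (fun p => Psi (x, p))).
  apply: (Cintegrable_le (Cmeas_fubini1 IPsi) _ bnd).
    by apply: measurable_funM => //; exact: measurable_cst.
  by rewrite Eint ltry.
have := cabs_Cint Ix; rewrite F cabsM cabs_real ger0_norm ?(ltW pa0) // => h.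
have {}h : (((pi / al) ^+ n * cabs X)%:E <= (M * (pi / (al * (1 - a ^+ 2))) ^+ n)%:E)%E.
  apply: le_trans h _; rewrite -Eint; apply: ge0_le_integral => //.
  - by move=> x _; rewrite lee_fin cabs_ge0.
  - apply/measurable_EFinP/measurable_cabs; exact: (proj1 Ix).
  - by apply/measurable_EFinP; apply: measurable_funM => //; exact: measurable_cst.
  - by move=> x _; rewrite lee_fin; exact: bnd.
rewrite lee_fin /M in h.
by rewrite -(ler_pM2l pa0); apply: le_trans h _; rewrite le_eqVlt; apply/orP; left; apply/eqP; ring.
Qed.

End lower_bound.
End toeplitz_kernel.

(** * Holomorphic dependence of exponential integrals on the parameter *)

Section sign_corners.
Context {R : realType} (n : nat).
Local Notation C := R[i].
Local Notation Cn := 'rV[C]_n.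
Implicit Types (z w : Cn).

Definition l1norm w : R := \sum_(j < n) (`|complex.Re (w ord0 j)| + `|complex.Im (w ord0 j)|).

Definition sign_corner (e : {ffun 'I_n -> bool * bool}) : Cn :=
  \row_j ((-1) ^+ (e j).1 +i* (-1) ^+ (e j).2)%C.

Lemma l1norm_ge0 w : 0 <= l1norm w.
Proof. by apply: sumr_ge0 => j _; rewrite addr_ge0. Qed.

Lemma cabs_coord_le w j : cabs (w ord0 j) <= l1norm w.
Proof.
rewrite /l1norm (bigD1 j) //=; apply: le_trans (cabs_le_ReIm _) _.
by rewrite lerDl sumr_ge0 // => i _; rewrite addr_ge0.
Qed.

(** In each coordinate the exponential of an absolute value is at most the sum of
    the exponentials over both signs; the product over the coordinates expands into
    exponentials of real linear forms. *)
Lemma expR_l1norm_le (k : R) w : 0 <= k ->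
  expR (k * l1norm w) <= \sum_e expR (k * complex.Re (hdot w (sign_corner e))).
Proof.
move=> k0; pose a j (b : bool * bool) : R :=
  (-1) ^+ b.1 * complex.Re (w ord0 j) + (-1) ^+ b.2 * complex.Im (w ord0 j).
have E e : expR (k * complex.Re (hdot w (sign_corner e))) = \prod_(j < n) expR (k * a j (e j)).
  rewrite -expR_sum; congr expR; rewrite -mulr_sumr; congr (_ * _).
  rewrite /hdot; elim/big_ind2 : _ => //; first by move=> z1 r1 z2 r2 <- <-; rewrite ReD.
  by move=> j _; rewrite mxE ReM /a /=; ring.
rewrite (eq_bigr _ (fun e _ => E e)) -(bigA_distr_bigA (fun j b => expR (k * a j b))) /=.
rewrite /l1norm mulr_sumr expR_sum; apply: ler_prod => j _; rewrite expR_ge0 /=.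
rewrite (bigD1 (complex.Re (w ord0 j) < 0, complex.Im (w ord0 j) < 0)) //=.
have -> : a j (complex.Re (w ord0 j) < 0, complex.Im (w ord0 j) < 0) =
    `|complex.Re (w ord0 j)| + `|complex.Im (w ord0 j)|.
  by rewrite /a /= !normrEsign // ?num_real.
by rewrite lerDl; apply: sumr_ge0 => i _; rewrite expR_ge0.
Qed.

End sign_corners.

Section holomorphic_integral.
Context {R : realType} (n : nat) d (T : measurableType d) (mu : {measure set T -> \bar R}).
Local Notation C := R[i].
Local Notation Cn := 'rV[C]_n.
Variables (k : R) (G : T -> C) (phi : T -> Cn).
Hypotheses (k_gt0 : 0 < k) (mG : Cmeas G) (mphi : Vmeas phi).
Hypothesis dom : forall z, (\int[mu]_x
  (cabs (G x) * expR (k * complex.Re (hdot z (phi x)) + 2 * k * l1norm (phi x)))%:E < +oo)%E.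

Let mzphi z : Cmeas (fun x => hdot z (phi x)).
Proof. by apply: Cmeas_hdot => //; exact: Vmeas_cst. Qed.

Let mGe z : Cmeas (fun x => G x * cexp (k%:C%C * hdot z (phi x))).
Proof. by apply: CmeasM => //; apply: Cmeas_cexp; apply: CmeasM; [exact: Cmeas_cst|exact: mzphi]. Qed.

Lemma measurable_l1norm : measurable_fun setT (fun x => l1norm (phi x)).
Proof.
apply: measurable_sum => j.
by apply: measurable_funD; apply: measurableT_comp => //; have [] := mphi j.
Qed.

Let mdom z : measurable_fun setT (fun x => cabs (G x) * expR (k * complex.Re (hdot z (phi x)) + 2 * k * l1norm (phi x))).
Proof.
apply: measurable_funM; first exact: measurable_cabs.
apply: measurableT_comp => //; apply: measurable_funD; apply: measurable_funM => //.
  exact: (mzphi z).1.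
exact: measurable_l1norm.
Qed.

Lemma Cintegrable_laplace (a : T -> C) (c : R) z : Cmeas a -> 0 <= c ->
  (forall x, cabs (a x) <= c * expR (2 * k * l1norm (phi x))) ->
  Cintegrable mu (fun x => G x * cexp (k%:C%C * hdot z (phi x)) * a x).
Proof.
move=> ma c0 ac.
apply: (@Cintegrable_le _ _ _ _ _ (fun x => c * (cabs (G x) * expR (k * complex.Re (hdot z (phi x)) + 2 * k * l1norm (phi x))))).
- by apply: CmeasM.
- by apply: measurable_funM; [exact: measurable_cst|exact: mdom].
- move=> x; rewrite !cabsM cabs_cexp ReZ expRD.
  rewrite [X in _ <= X](_ : _ = cabs (G x) * expR (k * complex.Re (hdot z (phi x))) * (c * expR (2 * k * l1norm (phi x)))); last by ring.
  by rewrite ler_wpM2l // mulr_ge0 ?cabs_ge0 ?expR_ge0.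
- rewrite [X in (X < _)%E](ge0_integralZ mu (mdom z) _ c0); last first.
    by move=> x; rewrite mulr_ge0 ?cabs_ge0 ?expR_ge0.
  by apply: lte_mul_pinfty; rewrite ?lee_fin.
Qed.

Definition laplace z : C := Cint mu (fun x => G x * cexp (k%:C%C * hdot z (phi x))).

Lemma Cintegrable_laplace1 z : Cintegrable mu (fun x => G x * cexp (k%:C%C * hdot z (phi x))).
Proof.
rewrite (_ : (fun x => _) = (fun x => G x * cexp (k%:C%C * hdot z (phi x)) * 1)); last first.
  by apply/funext => x; rewrite mulr1.
apply: (@Cintegrable_laplace (fun=> 1) 1 z (@Cmeas_cst R d T 1) ler01).
move=> x; rewrite cabs1 mul1r -expR0 ler_expR !mulr_ge0 ?(ltW k_gt0) //; exact: l1norm_ge0.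
Qed.

Let grad z j : C := Cint mu (fun x => G x * cexp (k%:C%C * hdot z (phi x)) * (k%:C%C * ((phi x ord0 j)^*)%C)).

Let Igrad z j : Cintegrable mu (fun x => G x * cexp (k%:C%C * hdot z (phi x)) * (k%:C%C * ((phi x ord0 j)^*)%C)).
Proof.
apply: (@Cintegrable_laplace _ 1) => //.
  by apply: CmeasM; [exact: Cmeas_cst|exact/Cmeas_conj/mphi].
move=> x; rewrite mul1r cabsM cabs_real cabs_conj (ger0_norm (ltW k_gt0)).
have l0 := l1norm_ge0 (phi x).
apply: le_trans (_ : k * l1norm (phi x) <= _).
  by rewrite ler_wpM2l ?(ltW k_gt0) // cabs_coord_le.
apply: le_trans (_ : expR (k * l1norm (phi x)) <= _).
  by apply: le_trans (expR_ge1Dx _); rewrite lerDr.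
by rewrite ler_expR -mulrA ler_peMl ?mulr_ge0 ?(ltW k_gt0) // ler1n.
Qed.

Lemma Cint_sum (I : Type) (r : seq I) (F : I -> T -> C) : (forall i, Cintegrable mu (F i)) ->
  Cintegrable mu (fun x => \sum_(i <- r) F i x) /\
  Cint mu (fun x => \sum_(i <- r) F i x) = \sum_(i <- r) Cint mu (F i).
Proof.
move=> IF; elim: r => [|i r [IH1 IH2]].
  rewrite big_nil; split.
    split; first by under eq_fun do rewrite big_nil; exact: Cmeas_cst.
    by under eq_integral do rewrite big_nil cabs0; rewrite integral0 ltry.
  rewrite /Cint; congr (_ +i* _)%C; under eq_Rintegral do rewrite big_nil;
    by rewrite /Rintegral /= integral0.
have -> : (fun x => \sum_(j <- i :: r) F j x) = (fun x => F i x + \sum_(j <- r) F j x).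
  by apply/funext => x; rewrite big_cons.
by split; [exact: CintegrableD|rewrite CintD // big_cons IH2].
Qed.

Let L z (h : Cn) : C := \sum_(j < n) h ord0 j * grad z j.

Let LE z h : L z h = Cint mu (fun x => G x * cexp (k%:C%C * hdot z (phi x)) * (k%:C%C * hdot h (phi x))) /\
  Cintegrable mu (fun x => G x * cexp (k%:C%C * hdot z (phi x)) * (k%:C%C * hdot h (phi x))).
Proof.
have := @Cint_sum _ (index_enum 'I_n) _ (fun j => CintegrableM (h ord0 j) (Igrad z j)).
rewrite (_ : (fun x => \sum_(j <- _) _) = (fun x => G x * cexp (k%:C%C * hdot z (phi x)) * (k%:C%C * hdot h (phi x)))); last first.
  apply/funext => x; rewrite /hdot !mulr_sumr; apply: eq_bigr => j _; ring.
move=> [h1 h2]; split => //; rewrite h2; apply: eq_bigr => j _.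
by rewrite CintZ.
Qed.

Let remainder_le x (h : Cn) (r : R) : 0 <= r -> r <= 1 -> `|h| = r%:C%C ->
  cabs (cexp (k%:C%C * hdot h (phi x)) - 1 - k%:C%C * hdot h (phi x)) <=
  12 * r ^+ 2 * expR (2 * k * l1norm (phi x)).
Proof.
move=> r0 r1 hr; set a := k%:C%C * _; set W := l1norm _.
have W0 : 0 <= W by exact: l1norm_ge0.
have kW : 0 <= k * W by rewrite mulr_ge0 // ltW.
have aW : cabs a <= r * (k * W).
  rewrite /a cabsM cabs_real (ger0_norm (ltW k_gt0)) mulrCA ler_wpM2l ?(ltW k_gt0) //.
  rewrite /W /l1norm mulr_sumr /hdot.
  elim/big_rec2 : _ => [|j y1 y2 _ IH]; first by rewrite cabs0.
  apply: le_trans (cabsD _ _) _; apply: lerD => //.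
  rewrite cabsM cabs_conj; apply: ler_pM; rewrite ?cabs_ge0 //; last exact: cabs_le_ReIm.
  by rewrite -lecR -normCE -hr; exact: le_coord_norm.
have ae : cabs a <= k * W by apply: le_trans aW _; rewrite ler_piMl.
apply: le_trans (cexp_taylor1_le a) _.
have h1 : (k * W) ^+ 2 <= 4 * expR (k * W).
  have e1 : k * W / 2 <= expR (k * W / 2) by apply: le_trans (expR_ge1Dx _); rewrite lerDr.
  have -> : expR (k * W) = expR (k * W / 2) ^+ 2 by rewrite expr2 -expRD; congr expR; lra.
  have -> : (k * W) ^+ 2 = 4 * (k * W / 2) ^+ 2 by field.
  by rewrite ler_wpM2l // ler_pXn2r ?nnegrE ?expR_ge0 // divr_ge0.
have h2 : cabs a ^+ 2 <= r ^+ 2 * (4 * expR (k * W)).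
  apply: le_trans (_ : (r * (k * W)) ^+ 2 <= _).
    by rewrite ler_pXn2r ?nnegrE ?cabs_ge0 // mulr_ge0.
  by rewrite exprMn ler_wpM2l // sqr_ge0.
have -> : 2 * k * W = k * W + k * W by ring.
rewrite expRD.
have -> : 12 * r ^+ 2 * (expR (k * W) * expR (k * W)) = 3 * (r ^+ 2 * (4 * expR (k * W))) * expR (k * W) by ring.
apply: ler_pM; rewrite ?expR_ge0 //.
- by rewrite mulr_ge0 // sqr_ge0.
- by rewrite ler_wpM2l.
- by rewrite ler_expR.
Qed.

(** The Taylor remainder of the exponential is quadratic in the increment times an
    exponential of [k * l1norm]; a second such factor absorbs the square of
    [l1norm]. This is why the domination is assumed with the factor [2 * k]. *)
Lemma entire_laplace : entire laplace.
Proof.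
move=> z.
have lin_d : linear (L z : Cn -> C^o).
  move=> a u v; rewrite /L scaler_sumr -big_split; apply: eq_bigr => j _.
  by rewrite !mxE /GRing.scale /=; ring.
pose V : normedModType C := Cn.
have Lc : continuous (L z : V -> C^o).
  have eL : entire (L z).
    by apply: entire_sum => j; apply: entireM; [exact: entire_coord|exact: entire_cst].
  by move=> v; exact: differentiable_continuous (eL v).
apply: (@differentiable_intro _ V C^o laplace (L z) z lin_d Lc) => e /posC[e' e0 ->].
pose D x := cabs (G x) * expR (k * complex.Re (hdot z (phi x)) + 2 * k * l1norm (phi x)).
pose A := fine (\int[mu]_x (D x)%:E)%E.
have D0 x : 0 <= D x by rewrite mulr_ge0 ?cabs_ge0 ?expR_ge0.
have AE : (\int[mu]_x (D x)%:E = A%:E)%E.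
  rewrite fineK // ge0_fin_numE; first exact: dom.
  by apply: integral_ge0 => x _; rewrite lee_fin.
have A0 : 0 <= A by apply: fine_ge0; apply: integral_ge0 => x _; rewrite lee_fin.
(* The remainder is at most [12 * A * `|h| ^+ 2]; adding [1] makes [M] positive. *)
pose M := 12 * A + 1.
have M0 : 0 < M by rewrite ltr_wpDl // mulr_ge0.
pose del := Num.min 1 (e' / M).
have d0 : 0 < del by rewrite lt_min ltr01 divr_gt0.
apply/nbhs_ballP; exists del%:C%C; first by rewrite /= ltcR.
move=> h; rewrite -ball_normE /= sub0r normrN => hd.
have [h0|hn] := eqVneq `|h| 0.
  move/normr0_eq0: h0 => ->.
  by rewrite add0r subrr /L big1 ?subrr ?normr0 ?mulr0 // => j _; rewrite mxE mul0r.
have hp : 0 < `|h| by rewrite lt_def hn normr_ge0.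
have [r r0 hr] := posC hp.
rewrite hr ltcR lt_min in hd; move/andP: hd => [r1 rM].
rewrite hr -rmorphM normCE lecR.
have [LE1 LE2] := LE z h.
have E : laplace (h + z) - laplace z - L z h = Cint mu (fun x => G x * cexp (k%:C%C * hdot z (phi x)) *
   (cexp (k%:C%C * hdot h (phi x)) - 1 - k%:C%C * hdot h (phi x))).
  have I0 := Cintegrable_laplace1 z; have I1 := Cintegrable_laplace1 (h + z).
  have I2 := CintegrableM (-1) I0; have I3 := CintegrableM (-1) LE2.
  rewrite LE1 /laplace -[X in _ - X - _]mul1r -[X in _ - _ - X]mul1r -!mulNr -(CintZ _ I0) -(CintZ _ LE2).
  rewrite -CintD // -CintD //; last exact: CintegrableD.
  by apply: eq_Cint => x; rewrite hdotDl mulrDr cexpD; ring.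
rewrite E.
have mR : Cmeas (fun x => G x * cexp (k%:C%C * hdot z (phi x)) *
   (cexp (k%:C%C * hdot h (phi x)) - 1 - k%:C%C * hdot h (phi x))).
  apply: CmeasM => //.
  have mk : Cmeas (fun x => k%:C%C * hdot h (phi x)) by apply: CmeasM; [exact: Cmeas_cst|exact: mzphi].
  by apply: CmeasB => //; apply: CmeasB; [exact: Cmeas_cexp|exact: Cmeas_cst].
have bnd x : cabs (G x * cexp (k%:C%C * hdot z (phi x)) *
   (cexp (k%:C%C * hdot h (phi x)) - 1 - k%:C%C * hdot h (phi x))) <= 12 * r ^+ 2 * D x.
  rewrite !cabsM cabs_cexp ReZ /D expRD.
  rewrite [X in _ <= X](_ : _ = cabs (G x) * expR (k * complex.Re (hdot z (phi x))) * (12 * r ^+ 2 * expR (2 * k * l1norm (phi x)))); last by ring.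
  by rewrite ler_wpM2l ?remainder_le ?(ltW r0) ?(ltW r1) // mulr_ge0 ?cabs_ge0 ?expR_ge0.
have c0 : 0 <= 12 * r ^+ 2 by rewrite mulr_ge0 // sqr_ge0.
have intE : (\int[mu]_x (12 * r ^+ 2 * D x)%:E = (12 * r ^+ 2 * A)%:E)%E.
  by rewrite (ge0_integralZ mu (mdom z) D0 c0) AE.
have IR : Cintegrable mu (fun x => G x * cexp (k%:C%C * hdot z (phi x)) *
   (cexp (k%:C%C * hdot h (phi x)) - 1 - k%:C%C * hdot h (phi x))).
  apply: (Cintegrable_le mR _ bnd); last by rewrite intE ltry.
  by apply: measurable_funM; [exact: measurable_cst|exact: mdom].
have := cabs_Cint IR.
move/le_trans => /(_ (12 * r ^+ 2 * A)%:E) H.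
have {}H : cabs (Cint mu (fun x => G x * cexp (k%:C%C * hdot z (phi x)) *
   (cexp (k%:C%C * hdot h (phi x)) - 1 - k%:C%C * hdot h (phi x)))) <= 12 * r ^+ 2 * A.
  rewrite -lee_fin; apply: H; rewrite -intE; apply: ge0_le_integral => //.
  - by move=> x _; rewrite lee_fin cabs_ge0.
  - exact/measurable_EFinP/measurable_cabs.
  - by apply/measurable_EFinP; apply: measurable_funM; [exact: measurable_cst|exact: mdom].
  - by move=> x _; rewrite lee_fin.
apply: le_trans H _.
have -> : 12 * r ^+ 2 * A = (12 * A * r) * r by ring.
rewrite ler_wpM2r ?(ltW r0) //.
apply: le_trans (_ : M * r <= _); first by rewrite ler_wpM2r ?(ltW r0) // lerDl.
by rewrite mulrC -ler_pdivlMr // ltW.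
Qed.

End holomorphic_integral.

(** * Convolution with a Gaussian *)

Section gaussian_convolution.
Context {R : realType} (n : nat).
Local Notation C := R[i].
Local Notation Cn := 'rV[C]_n.
Local Notation Rn := (n.-tuple R).
Local Notation leb := (lebC n).
Variables (c : R) (c_gt0 : 0 < c).

Lemma measurable_gauss_diff : measurable_fun setT
  (fun q : (Rn * Rn) * (Rn * Rn) => expR (- (c * csqn (cvec q.1 - cvec q.2 : Cn)))).
Proof.
apply: measurable_gauss_comp; apply: VmeasB; apply: Vmeas_cvec;
  by [exact: measurable_fst|exact: measurable_snd].
Qed.

Lemma measurable_gauss_section (z : Cn) :
  measurable_fun setT (fun p : Rn * Rn => expR (- (c * csqn (z - cvec p)))).
Proof.
by apply: measurable_gauss_comp; apply: VmeasB; [exact: Vmeas_cst|exact: Vmeas_id].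
Qed.

Lemma integral_gauss_section (z : Cn) :
  (\int[leb]_p (expR (- (c * csqn (z - cvec p))))%:E = ((pi / c) ^+ n)%:E)%E.
Proof. by under eq_integral do rewrite csqn_distC; rewrite integral_gauss_shift. Qed.

Lemma integral_gauss_right (A : Rn * Rn -> R) : measurable_fun setT A ->
  (forall p, 0 <= A p) ->
  (\int[leb]_p \int[leb]_q (A q * expR (- (c * csqn (cvec p - cvec q))))%:E =
   ((pi / c) ^+ n)%:E * \int[leb]_q (A q)%:E)%E.
Proof.
move=> mA A0.
have mm : measurable_fun setT (fun q : (Rn * Rn) * (Rn * Rn) =>
    (A q.2 * expR (- (c * csqn (cvec q.1 - cvec q.2 : Cn))))%:E).
  apply/measurable_EFinP; apply: measurable_funM; last exact: measurable_gauss_diff.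
  exact: (measurableT_comp mA measurable_snd).
have m0 q : (0 <= (A q.2 * expR (- (c * csqn (cvec q.1 - cvec q.2 : Cn))))%:E)%E.
  by rewrite lee_fin mulr_ge0 ?expR_ge0.
have F1 := @fubini_tonelli1 _ _ _ _ _ leb leb _ mm m0.
have F2 := @fubini_tonelli2 _ _ _ _ _ leb leb _ mm m0.
rewrite -[LHS]F1 F2 /fubini_G /=.
rewrite -(ge0_integralZ leb mA A0); last by rewrite exprn_ge0 // divr_ge0 ?pi_ge0 ?ltW.
apply: eq_integral => q _.
rewrite [LHS](ge0_integralZ leb _ (fun=> expR_ge0 _) (A0 q)).
  by rewrite integral_gauss_shift // -EFinM mulrC.
apply: measurable_gauss_comp; apply: VmeasB; [exact: Vmeas_id|exact: Vmeas_cst].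
Qed.

Lemma integral_gauss_left (A : Rn * Rn -> R) : measurable_fun setT A ->
  (forall p, 0 <= A p) ->
  (\int[leb]_p \int[leb]_q (A p * expR (- (c * csqn (cvec p - cvec q))))%:E =
   ((pi / c) ^+ n)%:E * \int[leb]_q (A q)%:E)%E.
Proof.
move=> mA A0.
rewrite -(ge0_integralZ leb mA A0); last by rewrite exprn_ge0 // divr_ge0 ?pi_ge0 ?ltW.
apply: eq_integral => p _.
rewrite [LHS](ge0_integralZ leb (measurable_gauss_section _) (fun=> expR_ge0 _) (A0 p)).
by rewrite integral_gauss_section -EFinM mulrC.
Qed.

(** Cauchy-Schwarz, with half of the Gaussian on each factor, bounds the square of
    the convolution by a convolution of squares, and Tonelli's theorem integrates
    the latter. *)
Lemma gauss_young (phi G : Rn * Rn -> R) (B : R) :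
  measurable_fun setT phi -> (forall p, 0 <= phi p) -> 0 <= B ->
  measurable_fun setT G -> (forall p, 0 <= G p) ->
  (\int[leb]_p (phi p ^+ 2)%:E < +oo)%E ->
  (forall p, ((G p)%:E <= B%:E * \int[leb]_q (phi q * expR (- (c * csqn (cvec p - cvec q))))%:E)%E) ->
  (\int[leb]_p (G p ^+ 2)%:E <= ((B * (pi / c) ^+ n) ^+ 2)%:E * \int[leb]_p (phi p ^+ 2)%:E)%E.
Proof.
move=> mphi phi0 B0 mG G0 phiy HG.
have mphi2 : measurable_fun setT (fun p => phi p ^+ 2) by exact: measurable_funX.
have P0 : 0 <= (pi / c) ^+ n :> R by rewrite exprn_ge0 // divr_ge0 ?pi_ge0 ?ltW.
set P := (pi / c) ^+ n in P0 *.
pose I p := (\int[leb]_q (phi q ^+ 2 * expR (- (c * csqn (cvec p - cvec q))))%:E)%E.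
have mI2 p : measurable_fun setT (fun q => phi q ^+ 2 * expR (- (c * csqn (cvec p - cvec q : Cn)))).
  by apply: measurable_funM => //; exact: measurable_gauss_section.
have I0 p : (0 <= I p)%E.
  by apply: integral_ge0 => q _; rewrite lee_fin mulr_ge0 ?expR_ge0 // sqr_ge0.
have Iy p : (I p < +oo)%E.
  apply: le_lt_trans phiy; apply: ge0_le_integral => //.
  - by move=> q _; rewrite lee_fin mulr_ge0 ?expR_ge0 // sqr_ge0.
  - exact/measurable_EFinP.
  - exact/measurable_EFinP.
  - move=> q _; rewrite lee_fin ler_piMr ?sqr_ge0 // -expR0 ler_expR oppr_le0.
    by rewrite mulr_ge0 ?(ltW c_gt0) // csqn_ge0.
have Ifin p : I p = (fine (I p))%:E by rewrite fineK // ge0_fin_numE.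
have key p : ((G p ^+ 2)%:E <= (B ^+ 2 * P)%:E * I p)%E.
  pose e q := expR (- (c / 2 * csqn (cvec p - cvec q : Cn))).
  have ee q : e q ^+ 2 = expR (- (c * csqn (cvec p - cvec q : Cn))).
    by rewrite /e expr2 -expRD; congr expR; lra.
  have me : measurable_fun setT e.
    by apply: measurable_gauss_comp; apply: VmeasB; [exact: Vmeas_cst|exact: Vmeas_id].
  have CS : (\int[leb]_q (phi q * expR (- (c * csqn (cvec p - cvec q))))%:E <=
     (Num.sqrt (fine (I p)) * Num.sqrt P)%:E)%E.
    rewrite (_ : (fun q => _) = (fun q => (phi q * e q * e q)%:E)); last first.
      by apply/funext => q; rewrite -ee expr2 mulrA.
    apply: (@cauchy_schwarz _ _ _ leb (fun q => phi q * e q) e).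
    - exact: measurable_funM.
    - exact: me.
    - by move=> q; rewrite mulr_ge0 ?expR_ge0.
    - by move=> q; rewrite expR_ge0.
    - by rewrite fine_ge0.
    - exact: P0.
    - by rewrite -Ifin; under eq_integral do rewrite exprMn ee.
    - by under eq_integral do rewrite ee; rewrite integral_gauss_section.
  have h : G p <= B * (Num.sqrt (fine (I p)) * Num.sqrt P).
    rewrite -lee_fin; apply: le_trans (HG p) _; rewrite EFinM.
    by apply: lee_wpmul2l => //; rewrite lee_fin.
  rewrite Ifin -EFinM lee_fin.
  have -> : B ^+ 2 * P * fine (I p) = (B * (Num.sqrt (fine (I p)) * Num.sqrt P)) ^+ 2.
    by rewrite !exprMn !sqr_sqrtr ?fine_ge0 //; ring.
  by rewrite ler_pXn2r ?nnegrE // !mulr_ge0 ?sqrtr_ge0.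
have mI : measurable_fun setT I.
  have mm : measurable_fun setT (fun q : (Rn * Rn) * (Rn * Rn) =>
      (phi q.2 ^+ 2 * expR (- (c * csqn (cvec q.1 - cvec q.2 : Cn))))%:E).
    apply/measurable_EFinP; apply: measurable_funM; last exact: measurable_gauss_diff.
    exact: (measurableT_comp mphi2 measurable_snd).
  apply: (@measurable_fun_fubini_tonelli_F _ _ _ _ _ leb _ mm).
  by move=> q; rewrite lee_fin mulr_ge0 ?expR_ge0 // sqr_ge0.
have BP0 : (0 <= (B ^+ 2 * P)%:E)%E by rewrite lee_fin mulr_ge0 // sqr_ge0.
apply: (@le_trans _ _ (\int[leb]_p ((B ^+ 2 * P)%:E * I p))%E).
  apply: ge0_le_integral => //.
  - by move=> p _; rewrite lee_fin sqr_ge0.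
  - by apply/measurable_EFinP; exact: measurable_funX.
  - by apply: emeasurable_funM.
rewrite ge0_integralZl //.
rewrite integral_gauss_right //; last by move=> p; exact: sqr_ge0.
rewrite muleA -EFinM -/P le_eqVlt; apply/orP; left; apply/eqP.
by congr (_%:E * _)%E; ring.
Qed.

End gaussian_convolution.

(** * Toeplitz operators as integral operators *)

Section toeplitz_action.
Context {R : realType} (n : nat) (t : R) (t_gt0 : 0 < t).
Local Notation C := R[i].
Local Notation Cn := 'rV[C]_n.
Local Notation Rn := (n.-tuple R).
Local Notation leb := (lebC n).
Local Notation al := (al t).
Local Notation Mt := (Mt t).
Local Notation Ew := (Ew t).
Implicit Types (f h : Cn -> C) (z w u : Cn).
Variable g : Cn -> C.

Hypothesis mg : Cmeas (fun p : Rn * Rn => g (cvec p)).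
Hypothesis Hg : forall v, (\int[leb]_p
  (cabs (g (cvec p)) ^+ 2 * expR (2 * al * complex.Re (hdot (cvec p) v)) * Ew (cvec p))%:E < +oo)%E.

Let mI := @Vmeas_id R n.
Let mEw := measurable_Ew t mI.
Let mcg := measurable_cabs mg.

Let mg2 v : measurable_fun setT (fun p : Rn * Rn =>
  cabs (g (cvec p)) ^+ 2 * expR (2 * al * complex.Re (hdot (cvec p) v)) * Ew (cvec p)).
Proof.
apply: measurable_funM => //; apply: measurable_funM; first exact: measurable_funX.
exact: measurable_expR_hdot.
Qed.

Let ml1 : measurable_fun setT (fun p : Rn * Rn => l1norm (cvec p : Cn)).
Proof. exact: measurable_l1norm. Qed.

(** The weight is dominated by finitely many exponentials of linear forms, each
    covered by the hypothesis at a shifted point. *)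
Lemma symbol_l1_finite v : (\int[leb]_p
  (cabs (g (cvec p)) ^+ 2 * expR (2 * al * complex.Re (hdot (cvec p) v) + 4 * al * l1norm (cvec p)) *
   Ew (cvec p))%:E < +oo)%E.
Proof.
have a0 := al_gt0 t_gt0.
pose T2 e p := cabs (g (cvec p)) ^+ 2 *
  expR (2 * al * complex.Re (hdot (cvec p) (v + (2 : R)%:C%C *: sign_corner e))) * Ew (cvec p).
have T20 e p : 0 <= T2 e p.
  by rewrite mulr_ge0 ?expR_ge0 // mulr_ge0 ?expR_ge0 // sqr_ge0.
have mT2 e : measurable_fun setT (fun p => (T2 e p)%:E).
  by apply/measurable_EFinP; exact: (mg2 (v + (2 : R)%:C%C *: sign_corner e)).
apply: (@le_lt_trans _ _ (\int[leb]_p (\sum_(e : {ffun 'I_n -> bool * bool}) (T2 e p)%:E))%E); last first.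
  rewrite ge0_integral_sum //.
  - by apply: lte_sum_pinfty => e _; exact: Hg.
  - by move=> e p _; rewrite lee_fin.
apply: ge0_le_integral => //.
- by move=> p _; rewrite lee_fin mulr_ge0 ?expR_ge0 // mulr_ge0 ?expR_ge0 // sqr_ge0.
- apply/measurable_EFinP; apply: measurable_funM => //; apply: measurable_funM.
    exact: measurable_funX.
  under eq_fun do rewrite expRD.
  apply: measurable_funM; first exact: measurable_expR_hdot.
  by apply: measurableT_comp => //; apply: measurable_funM.
- by apply: emeasurable_sum; exact: mT2.
- move=> p _; rewrite sumEFin lee_fin -mulr_suml ler_wpM2r ?expR_ge0 // -mulr_sumr.
  rewrite ler_wpM2l ?sqr_ge0 // expRD.
  have k0 : 0 <= 4 * al by rewrite mulr_ge0 // ltW.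
  apply: le_trans (ler_wpM2l (expR_ge0 _) (expR_l1norm_le (cvec p) k0)) _.
  rewrite mulr_sumr le_eqVlt; apply/orP; left; apply/eqP; apply: eq_bigr => e _.
  by rewrite -expRD; congr expR; rewrite hdotDr hdotZr conjR ReD ReZ; ring.
Qed.

Section fixed_function.
Variable f : Cn -> C.
Hypothesis Hf : Ht t f.
Local Notation F := (Fock t f).

Let mF : Cmeas (fun p : Rn * Rn => F (cvec p)).
Proof. by apply: entire_Cmeas; have [] := Ht_Fock t_gt0 Hf. Qed.

Let Fy : (Fnorm2 t f < +oo)%E. Proof. by have [] := Ht_Fock t_gt0 Hf. Qed.

Let hw (p : Rn * Rn) : R := expR (- (al / 2 * csqn (cvec p : Cn))).

Let hw2 p : hw p ^+ 2 = Ew (cvec p).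
Proof. by rewrite /hw /Ew expr2 -expRD; congr expR; lra. Qed.

Let mhw : measurable_fun setT hw. Proof. exact: measurable_gauss_comp. Qed.

Let phi (p : Rn * Rn) : R := cabs (F (cvec p)) * hw p.

Let phi2 p : phi p ^+ 2 = cabs (F (cvec p)) ^+ 2 * Ew (cvec p).
Proof. by rewrite /phi exprMn hw2. Qed.

Let mphi : measurable_fun setT phi.
Proof. by apply: measurable_funM => //; exact: measurable_cabs. Qed.

Let phi0 p : 0 <= phi p.
Proof. by rewrite mulr_ge0 ?cabs_ge0 ?expR_ge0. Qed.

Let G (p : Rn * Rn) : C := g (cvec p) * F (cvec p) * (Ew (cvec p))%:C%C.

Let sqrM3 (a b c : R) : (a * (b * c)) ^+ 2 = a ^+ 2 * b ^+ 2 * c ^+ 2.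
Proof. by ring. Qed.

Let mG : Cmeas G.
Proof. by apply: CmeasM; [exact: CmeasM|exact: Cmeas_real]. Qed.

(** [g] with the exponential weight and [Fock t f] are both square integrable for
    the weight [Ew]. *)
Lemma toeplitz_dominated z : (\int[leb]_p
  (cabs (G p) * expR (al * complex.Re (hdot z (cvec p)) + 2 * al * l1norm (cvec p)))%:E < +oo)%E.
Proof.
pose ex (p : Rn * Rn) := expR (al * complex.Re (hdot (cvec p) z) + 2 * al * l1norm (cvec p)).
have ex2 p : ex p ^+ 2 = expR (2 * al * complex.Re (hdot (cvec p) z) + 4 * al * l1norm (cvec p)).
  by rewrite /ex expr2 -expRD; congr expR; lra.
have mex : measurable_fun setT ex.
  rewrite /ex; under eq_fun do rewrite expRD.
  apply: measurable_funM; first exact: measurable_expR_hdot.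
  by apply: measurableT_comp => //; apply: measurable_funM.
rewrite (_ : (fun p => _) = (fun p => (cabs (g (cvec p)) * (ex p * hw p) * phi p)%:E)); last first.
  apply/funext => p; rewrite /G /phi cabsM [cabs (g _ * _)]cabsM cabs_real.
  rewrite ger0_norm ?expR_ge0 // -hw2 (Re_hdotC (cvec p) z) -/(ex p); congr (_%:E); ring.
apply: integral_mul_lty => //.
- by apply: measurable_funM => //; exact: measurable_funM.
- by move=> p; rewrite mulr_ge0 ?cabs_ge0 // mulr_ge0 ?expR_ge0.
- by under eq_integral do rewrite sqrM3 ex2 hw2; exact: symbol_l1_finite.
- by under eq_integral do rewrite phi2.
Qed.

Lemma Cintegrable_toeplitz z : Cintegrable leb (fun p =>
  g (cvec p) * F (cvec p) * cexp (al%:C%C * hdot z (cvec p)) * (Ew (cvec p))%:C%C).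
Proof.
have := Cintegrable_laplace1 (al_gt0 t_gt0) mG mI toeplitz_dominated z.
by congr Cintegrable; apply/funext => p; rewrite /G mulrAC.
Qed.

Lemma toeplitz_laplace z : toeplitz t g f z =
  (((al / pi) ^+ n)%:C%C * (Mt z)^-1) * laplace leb al G (@cvec R n) z.
Proof.
rewrite toeplitzE // CintZ; last exact: Cintegrable_toeplitz.
by congr (_ * _); apply: eq_Cint => p; rewrite /G mulrAC.
Qed.

Lemma entire_toeplitz : entire (toeplitz t g f).
Proof.
rewrite (_ : toeplitz t g f = (fun z => (((al / pi) ^+ n)%:C%C * (Mt z)^-1) * laplace leb al G (@cvec R n) z)).
  apply: entireM.
    by apply: entireM; [exact: entire_cst|exact: entire_invMt].
  exact: (entire_laplace (al_gt0 t_gt0) mG mI toeplitz_dominated).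
by apply/funext => z; exact: toeplitz_laplace.
Qed.

Let Theta z (q : (Rn * Rn) * (Rn * Rn)) : C :=
  g (cvec q.1) * cexp (al%:C%C * hdot z (cvec q.1)) * (Ew (cvec q.1))%:C%C *
  (F (cvec q.2) * cexp (al%:C%C * hdot (cvec q.1) (cvec q.2)) * (Ew (cvec q.2))%:C%C).

Let V1 : Vmeas (fun q : (Rn * Rn) * (Rn * Rn) => cvec q.1 : Cn).
Proof. by apply: Vmeas_cvec; exact: measurable_fst. Qed.

Let V2 : Vmeas (fun q : (Rn * Rn) * (Rn * Rn) => cvec q.2 : Cn).
Proof. by apply: Vmeas_cvec; exact: measurable_snd. Qed.

Let mTheta z : Cmeas (Theta z).
Proof.
apply: CmeasM.
  apply: CmeasM; last exact: Cmeas_gauss.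
  apply: CmeasM; first exact: (Cmeas_comp mg measurable_fst).
  by apply: Cmeas_cexp_hdot => //; exact: Vmeas_cst.
apply: CmeasM; last exact: Cmeas_gauss.
apply: CmeasM; first exact: (Cmeas_comp mF measurable_snd).
exact: Cmeas_cexp_hdot.
Qed.

Let ITheta z : Cintegrable (leb \x leb)%E (Theta z).
Proof.
have a0 := al_gt0 t_gt0; have a2 : 0 < al / 2 by rewrite divr_gt0.
pose e (q : (Rn * Rn) * (Rn * Rn)) := expR (- (al / 4 * csqn (cvec q.1 - cvec q.2 : Cn))).
have e2 q : e q ^+ 2 = expR (- (al / 2 * csqn (cvec q.1 - cvec q.2 : Cn))).
  by rewrite /e expr2 -expRD; congr expR; lra.
have me : measurable_fun setT e by exact: measurable_gauss_diff.
pose x p := expR (al * complex.Re (hdot (cvec p) z)).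
have x2 p : x p ^+ 2 = expR (2 * al * complex.Re (hdot (cvec p) z)).
  by rewrite /x expr2 -expRD; congr expR; lra.
pose a p := cabs (g (cvec p)) * (x p * hw p).
have ma : measurable_fun setT a.
  by apply: measurable_funM => //; apply: measurable_funM => //; exact: measurable_expR_hdot.
have a_ge0 p : 0 <= a p by rewrite mulr_ge0 ?cabs_ge0 // mulr_ge0 ?expR_ge0.
have P0 : (0 <= ((pi / (al / 2)) ^+ n)%:E :> \bar R)%E.
  by rewrite lee_fin exprn_ge0 // divr_ge0 ?pi_ge0 ?ltW.
have m1 : measurable_fun setT (fun q => a q.1 * e q).
  by apply: measurable_funM => //; exact: (measurableT_comp ma measurable_fst).
have m2 : measurable_fun setT (fun q => phi q.2 * e q).
  by apply: measurable_funM => //; exact: (measurableT_comp mphi measurable_snd).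
split=> //; rewrite (_ : (fun q => _) = (fun q => (a q.1 * e q * (phi q.2 * e q))%:E)); last first.
  apply/funext => q; rewrite /Theta /a /phi -/(x q.1); congr (_%:E).
  set w := cvec q.1; set u := cvec q.2; set Fu := Fock t f u; clearbody Fu.
  rewrite !cabsM !cabs_cexp !ReZ !cabs_real !(ger0_norm (expR_ge0 _)).
  rewrite [LHS](_ : _ = cabs (g w) * cabs Fu * (expR (al * complex.Re (hdot z w)) *
    expR (- (al * csqn w)) * expR (al * complex.Re (hdot w u)) * expR (- (al * csqn u)))); last by ring.
  rewrite [RHS](_ : _ = cabs (g w) * cabs Fu * (x q.1 * hw q.1 * e q * (hw q.2 * e q))); last by ring.
  rewrite /x /hw /e -/w -/u -!expRD; congr (_ * expR _).
  by rewrite csqnB (Re_hdotC w z); lra.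
apply: integral_mul_lty => //.
- by move=> q; rewrite mulr_ge0 ?expR_ge0.
- by move=> q; rewrite mulr_ge0 ?expR_ge0.
- rewrite (@fubini_tonelli1 _ _ _ _ _ leb leb); last 2 first.
  + by apply/measurable_EFinP; exact: measurable_funX.
  + by move=> q; rewrite lee_fin sqr_ge0.
  rewrite /fubini_F /=; under eq_integral do under eq_integral do rewrite exprMn e2.
  rewrite [X in (X < _)%E](integral_gauss_left a2 (measurable_funX _ ma) (fun=> sqr_ge0 _)).
  apply: lte_mul_pinfty => //; under eq_integral do rewrite sqrM3 x2 hw2.
  exact: Hg.
- rewrite (@fubini_tonelli1 _ _ _ _ _ leb leb); last 2 first.
  + by apply/measurable_EFinP; exact: measurable_funX.
  + by move=> q; rewrite lee_fin sqr_ge0.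
  rewrite /fubini_F /=; under eq_integral do under eq_integral do rewrite exprMn e2.
  rewrite [X in (X < _)%E](integral_gauss_right a2 (measurable_funX _ mphi) (fun=> sqr_ge0 _)).
  by apply: lte_mul_pinfty => //; under eq_integral do rewrite phi2.
Qed.

(** The reproducing formula for [F] turns the Toeplitz integral into an integral
    operator with kernel [bker]. *)
Lemma Fock_toeplitz z : Fock t (toeplitz t g f) z =
  (((al / pi) ^+ n) ^+ 2)%:C%C * Cint leb (fun p => F (cvec p) * (Ew (cvec p))%:C%C * bker t g z (cvec p)) /\
  Cintegrable leb (fun p => F (cvec p) * (Ew (cvec p))%:C%C * bker t g z (cvec p)).
Proof.
have a0 := al_gt0 t_gt0; have [eF _] := Ht_Fock t_gt0 Hf.
have E1 p : Cint leb (fun q => Theta z (p, q)) =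
    ((pi / al) ^+ n)%:C%C * (g (cvec p) * F (cvec p) * cexp (al%:C%C * hdot z (cvec p)) * (Ew (cvec p))%:C%C).
  rewrite /Theta /= CintZ; last exact: Cintegrable_Fock.
  by rewrite Fock_reproducing //; ring.
have Isec q : Cintegrable leb (fun p => Theta z (p, q)).
  have := CintegrableM (F (cvec q) * (Ew (cvec q))%:C%C) (Cintegrable_bker t_gt0 mg Hg z (cvec q)).
  by congr Cintegrable; apply/funext => p; rewrite /Theta /= cexpD; ring.
have E2 q : Cint leb (fun p => Theta z (p, q)) = F (cvec q) * (Ew (cvec q))%:C%C * bker t g z (cvec q).
  rewrite -CintZ; last exact: Cintegrable_bker.
  by apply: eq_Cint => p; rewrite /Theta /= cexpD; ring.
have I2 := Cmeas_fubini2 (ITheta z).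
have FF : ((pi / al) ^+ n)%:C%C * Cint leb (fun p => g (cvec p) * F (cvec p) * cexp (al%:C%C * hdot z (cvec p)) * (Ew (cvec p))%:C%C) =
   Cint leb (fun p => F (cvec p) * (Ew (cvec p))%:C%C * bker t g z (cvec p)).
  rewrite -(CintZ _ (Cintegrable_toeplitz z)).
  apply: (eq_trans (esym (eq_Cint leb E1))).
  by apply: (eq_trans (Cfubini (ITheta z))); exact: eq_Cint.
split.
  rewrite -FF /Fock toeplitzE // CintZ; last exact: Cintegrable_toeplitz.
  rewrite expr2 rcM -[RHS]mulrA [in RHS](mulrA _ _ (Cint leb _)) -rcM al_piM // mul1r.
  rewrite -!mulrA; congr (_ * _); rewrite mulrC -mulrA.
  by rewrite mulfV ?mulr1 // Mt_neq0.
have [_ iy] := ITheta z.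
split; first by under eq_fun do rewrite -E2.
apply: le_lt_trans iy.
have mc := measurable_cabs (@mTheta z).
rewrite (@fubini_tonelli2 _ _ _ _ _ leb leb) //; last 2 first.
- exact/measurable_EFinP.
- by move=> q; rewrite lee_fin cabs_ge0.
apply: ge0_le_integral => //.
- by move=> p _; rewrite lee_fin cabs_ge0.
- by apply/measurable_EFinP; apply: measurable_cabs; under eq_fun do rewrite -E2.
- apply: measurable_fun_fubini_tonelli_G; last by move=> q; rewrite lee_fin cabs_ge0.
  exact/measurable_EFinP.
- by move=> p _; rewrite -E2; exact: cabs_Cint (Isec p).
Qed.


Section gaussian_kernel.
Variables (c B : R).
Hypotheses (c_gt0 : 0 < c) (B_ge0 : 0 <= B).
Hypothesis bker_le : forall z u,
  cabs (bker t g z u) <= B * expR (al * (csqn z + csqn u) / 2 - c * csqn (z - u)).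

Lemma Fnorm2_toeplitz_le : (Fnorm2 t (toeplitz t g f) <=
  ((((al / pi) ^+ n) ^+ 2 * B * (pi / c) ^+ n) ^+ 2)%:E * Fnorm2 t f)%E.
Proof.
have a0 := al_gt0 t_gt0.
have k0 : 0 <= ((al / pi) ^+ n) ^+ 2 by exact: sqr_ge0.
set k := ((al / pi) ^+ n) ^+ 2 in k0 *.
have mT : Cmeas (fun p : Rn * Rn => Fock t (toeplitz t g f) (cvec p)).
  apply: entire_Cmeas; apply: entireM; [exact: entire_toeplitz|exact: entire_Mt].
pose GG (p : Rn * Rn) := cabs (Fock t (toeplitz t g f) (cvec p)) * expR (- (al / 2 * csqn (cvec p : Cn))).
have GG2 p : GG p ^+ 2 = cabs (Fock t (toeplitz t g f) (cvec p)) ^+ 2 * Ew (cvec p).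
  by rewrite /GG /Ew exprMn [expR _ ^+ 2]expr2 -expRD; congr (_ * expR _); lra.
have phiE : (\int[leb]_p (phi p ^+ 2)%:E = Fnorm2 t f)%E.
  by apply: eq_integral => p _; rewrite phi2.
rewrite (_ : Fnorm2 t (toeplitz t g f) = \int[leb]_p (GG p ^+ 2)%:E)%E; last first.
  by apply: eq_integral => p _; rewrite GG2.
rewrite -phiE; apply: (gauss_young c_gt0 mphi phi0).
- by rewrite mulr_ge0.
- by apply: measurable_funM; [exact: measurable_cabs|exact: measurable_gauss_comp].
- by move=> p; rewrite mulr_ge0 ?cabs_ge0 ?expR_ge0.
- by rewrite phiE.
move=> p; set z := cvec p.
have [E I] := Fock_toeplitz z.
have mphie : measurable_fun setT (fun q => phi q * expR (- (c * csqn (z - cvec q)))).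
  by apply: measurable_funM => //; exact: measurable_gauss_section.
have X0 q : 0 <= phi q * expR (- (c * csqn (z - cvec q))) by rewrite mulr_ge0 ?expR_ge0.
have e0 : 0 < expR (al / 2 * csqn z) by exact: expR_gt0.
have h : ((cabs (Cint leb (fun p => F (cvec p) * (Ew (cvec p))%:C%C * bker t g z (cvec p))))%:E <=
   (B * expR (al / 2 * csqn z))%:E * \int[leb]_q (phi q * expR (- (c * csqn (z - cvec q))))%:E)%E.
  apply: le_trans (cabs_Cint I) _.
  have Be0 : 0 <= B * expR (al / 2 * csqn z) by rewrite mulr_ge0 // ltW.
  rewrite -(ge0_integralZ leb mphie X0 Be0).
  apply: ge0_le_integral => //.
  - by move=> q _; rewrite lee_fin cabs_ge0.
  - by apply/measurable_EFinP; apply: measurable_cabs; exact: (proj1 I).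
  - by apply/measurable_EFinP; apply: measurable_funM => //; exact: measurable_cst.
  - move=> q _; rewrite lee_fin cabsM [cabs (F _ * _)]cabsM cabs_real ger0_norm ?expR_ge0 //.
    apply: le_trans (ler_wpM2l _ (bker_le _ _)) _; first by rewrite mulr_ge0 ?cabs_ge0 ?expR_ge0.
    rewrite /phi /hw /Ew; set X := cabs _.
    rewrite [X in X <= _](_ : _ = X * B * (expR (- (al * csqn (cvec q))) * expR (al * (csqn z + csqn (cvec q)) / 2 - c * csqn (z - cvec q)))); last by ring.
    rewrite [X in _ <= X](_ : _ = X * B * (expR (al / 2 * csqn z) * expR (- (al / 2 * csqn (cvec q))) * expR (- (c * csqn (z - cvec q))))); last by ring.
    by rewrite -!expRD le_eqVlt; apply/orP; left; apply/eqP; congr (_ * expR _); lra.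
rewrite /GG -/z E cabsM cabs_real (ger0_norm k0).
set X := cabs _ in h *; set Y := (\int[leb]_q _)%E in h *.
have -> : k * X * expR (- (al / 2 * csqn z)) = k * expR (- (al / 2 * csqn z)) * X by ring.
rewrite EFinM; apply: (@le_trans _ _ ((k * expR (- (al / 2 * csqn z)))%:E * ((B * expR (al / 2 * csqn z))%:E * Y))%E).
  by apply: lee_wpmul2l => //; rewrite lee_fin mulr_ge0 // expR_ge0.
rewrite muleA -EFinM le_eqVlt; apply/orP; left; apply/eqP; congr (_%:E * _)%E.
rewrite [LHS](_ : _ = k * B * (expR (- (al / 2 * csqn z)) * expR (al / 2 * csqn z))); last by ring.
by rewrite -expRD addNr expR0 mulr1.
Qed.

Lemma Ht_toeplitz : Ht t (toeplitz t g f).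
Proof.
apply: (Fock_Ht t_gt0 entire_toeplitz); apply: le_lt_trans Fnorm2_toeplitz_le _.
by apply: lte_mul_pinfty => //; rewrite lee_fin sqr_ge0.
Qed.

Lemma normL2_toeplitz_le : normL2 t (toeplitz t g f) <=
  ((al / pi) ^+ n) ^+ 2 * B * (pi / c) ^+ n * normL2 t f.
Proof.
pose K := ((al / pi) ^+ n) ^+ 2 * B * (pi / c) ^+ n; rewrite -/K.
have K0 : 0 <= K.
  by rewrite mulr_ge0 ?exprn_ge0 ?divr_ge0 ?pi_ge0 ?(ltW c_gt0) // mulr_ge0 // sqr_ge0.
have FK : (Fnorm2 t (toeplitz t g f) <= (K ^+ 2)%:E * Fnorm2 t f)%E by exact: Fnorm2_toeplitz_le.
clearbody K.
rewrite -(@ler_pXn2r _ 2) ?nnegrE ?mulr_ge0 ?normL2_ge0 // exprMn.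
rewrite -lee_fin [X in (_ <= X)%E]EFinM -!sqint_fin //; last exact: Ht_toeplitz.
rewrite !sqintE //; last 2 first.
- exact: entire_Cmeas (proj1 Hf).
- exact: entire_Cmeas entire_toeplitz.
rewrite muleCA; apply: lee_wpmul2l; first by rewrite lee_fin ltW // cU_gt0.
exact: FK.
Qed.

End gaussian_kernel.
End fixed_function.

Lemma toeplitz_linear (a : C) f h : Ht t f -> Ht t h ->
  toeplitz t g (fun z => a * f z + h z) = (fun z => a * toeplitz t g f z + toeplitz t g h z).
Proof.
move=> Hf Hh; apply/funext => z; rewrite !toeplitzE //.
have If := Cintegrable_toeplitz Hf z; have Ih := Cintegrable_toeplitz Hh z.
rewrite (CintZ _ If) (CintZ _ Ih) mulrCA -mulrDr -(CintZ a If).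
rewrite -CintD //; last exact: CintegrableM.
rewrite -CintZ; last by apply: CintegrableD => //; exact: CintegrableM.
by apply: eq_Cint => p; rewrite /Fock; ring.
Qed.

(** The factor [al (|z|^2 + |u|^2) / 2] in the bound is split between the weights of
    the two norms, which leaves a convolution with a Gaussian. *)
Lemma toeplitz_bounded (c B : R) : 0 < c -> 0 <= B ->
  (forall z u, cabs (bker t g z u) <= B * expR (al * (csqn z + csqn u) / 2 - c * csqn (z - u))) ->
  bounded_operator t (toeplitz t g) /\
  operator_norm t (toeplitz t g) <= ((al / pi) ^+ n) ^+ 2 * B * (pi / c) ^+ n.
Proof.
move=> c0 B0 H; set K := (X in _ <= X).
have HK f : Ht t f -> normL2 t (toeplitz t g f) <= K * normL2 t f.
  by move=> Hf; exact: normL2_toeplitz_le.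
have K0 : 0 <= K.
  by rewrite mulr_ge0 ?exprn_ge0 ?divr_ge0 ?pi_ge0 ?(ltW c0) // mulr_ge0 // sqr_ge0.
split.
  split; first by move=> f Hf; exact: (Ht_toeplitz Hf c0 B0 H).
    by move=> a f h; exact: toeplitz_linear.
  by exists K.
apply: ge_sup; first by exists (normL2 t (toeplitz t g (fun=> 0))), (fun=> 0); split;
  [exact: Ht0|by rewrite normL20|].
move=> _ [f [Hf f1 ->]]; apply: le_trans (HK f Hf) _.
by rewrite ler_piMr.
Qed.

End toeplitz_action.

(** * Decay of the kernel of a Toeplitz operator *)

Section midpoint.
Context {R : realType} (n : nat).
Implicit Types z u w : 'rV[R[i]]_n.

(** Polarization around the midpoint: the modulus of the sesquilinear Gaussian is a
    real Gaussian times a factor that grows with the distance of [z] and [u]. *)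
Lemma Re_hdot_mid z u w : complex.Re (hdot (w - z) (w - u)) =
  csqn (w - mid z u) - csqn (z - u) / 4.
Proof.
rewrite /mid !csqnB !csqnZ cabs_real ger0_norm // csqnD hdotZr conjR ReZ.
rewrite !(hdotDl, hdotDr, hdotNl, hdotNr, ReD, ReN) -csqnE (Re_hdotC w z); lra.
Qed.

End midpoint.

Section gaussian_composition.
Context {R : realType} (n : nat).
Local Notation C := R[i].
Local Notation Cn := 'rV[C]_n.
Local Notation Rn := (n.-tuple R).
Local Notation leb := (lebC n).
Variables (kp gam : R) (kp_gt0 : 0 < kp) (gam_gt0 : 0 < gam).
Implicit Types z u w : Cn.

Let d := kp + gam.
Let d_gt0 : 0 < d. Proof. by rewrite addr_gt0. Qed.

(** Completing the square, with a complex shift of the centre: convolving the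
    Gaussian of rate [gam] in the sesquilinear form against the real Gaussian of
    rate [kp] adds the reciprocals of the rates. *)
Lemma gaussian_composition z u w :
  Cintegrable leb (fun p => (expR (- (kp * csqn (cvec p - w))))%:C%C *
      cexp (- (gam%:C%C * hdot (cvec p - z) (cvec p - u)))) /\
  Cint leb (fun p => (expR (- (kp * csqn (cvec p - w))))%:C%C *
      cexp (- (gam%:C%C * hdot (cvec p - z) (cvec p - u)))) =
  ((pi / d) ^+ n)%:C%C * cexp (- ((kp * gam / d)%:C%C * hdot (w - z) (w - u))).
Proof.
pose D := hdot (w - z) (w - u).
pose A := (- gam)%:C%C *: (w - u); pose B := (- gam)%:C%C *: (w - z).
pose f (p : Rn * Rn) := cexp (- (gam%:C%C * D)) * (cexp (hdot (cvec p) A + hdot B (cvec p)) *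
   (expR (- (d * csqn (cvec p))))%:C%C).
pose h (p : Rn * Rn) := (expR (- (kp * csqn (cvec p - w))))%:C%C *
      cexp (- (gam%:C%C * hdot (cvec p - z) (cvec p - u))).
have If : Cintegrable leb f by apply: CintegrableM; exact: Cintegrable_complex_gauss.
have hf p : h p = f (translate (uncvec (- w)) p).
  rewrite /h /f cvec_translate uncvecK (addrC (- w)); set e := cvec p - w.
  have -> : cvec p - z = e + (w - z) by rewrite /e addrA subrK.
  have -> : cvec p - u = e + (w - u) by rewrite /e addrA subrK.
  rewrite -!cexp_real -!cexpD /A /B /D; congr cexp.
  set v1 := w - z; set v2 := w - u; clearbody v1 v2 e.
  rewrite hdotZl hdotZr conjR hdotDl !hdotDr /d !rcN !rcM rcD -!hdotxx; ring.
have pw := preserves_translate (uncvec (- w)).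
have -> : (fun p => (expR (- (kp * csqn (cvec p - w))))%:C%C *
      cexp (- (gam%:C%C * hdot (cvec p - z) (cvec p - u)))) = (fun p => f (translate (uncvec (- w)) p)).
  by apply/funext => p; exact: hf.
split; first exact: Cintegrable_preserves.
rewrite (Cint_preserves pw (proj1 If)) /f CintZ; last exact: Cintegrable_complex_gauss.
rewrite complex_gauss // mulrCA -cexpD; congr (_ * cexp _).
rewrite /A /B hdotZl hdotZr conjR -/D.
have -> : kp * gam / d = gam + - (d^-1 * (gam * gam)).
  by have := d_gt0; rewrite /d => d0; field; rewrite gt_eqF.
by rewrite rcD !rcN !rcM; ring.
Qed.

End gaussian_composition.

Section upper_bound.
Context {R : realType} (n : nat) (t : R) (t_gt0 : 0 < t).
Local Notation C := R[i].
Local Notation Cn := 'rV[C]_n.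
Local Notation Rn := (n.-tuple R).
Local Notation leb := (lebC n).
Local Notation al := (al t).
Implicit Types (z w u : Cn).
Variable g : Cn -> C.
Hypothesis mg : Cmeas (fun p : Rn * Rn => g (cvec p)).
Hypothesis Hg : forall v, (\int[leb]_p
  (cabs (g (cvec p)) ^+ 2 * expR (2 * al * complex.Re (hdot (cvec p) v)) * Ew t (cvec p))%:E < +oo)%E.

Variables (kp gam M : R).
Hypotheses (kp_gt0 : 0 < kp) (gam_gt0 : 0 < gam) (M_ge0 : 0 <= M).
Hypothesis rates : kp * gam / (kp + gam) = al.

Let heat q : C := Cint leb (fun p => g (cvec p) * (expR (- (kp * csqn (cvec p - q))))%:C%C).

Hypothesis hM : {ae leb, forall q, cabs (heat (cvec q)) <= M}.

Let d := kp + gam.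
Let d_gt0 : 0 < d. Proof. exact: addr_gt0. Qed.

Let kp_large : al / 2 < kp.
Proof.
have a0 := al_gt0 t_gt0.
(* The rates say [1 / al = 1 / kp + 1 / gam]; in particular [al < kp]. *)
have h : (kp - al) * gam = al * kp.
  have := d_gt0; rewrite -rates /d => d0; field.
  by rewrite gt_eqF.
have : 0 < (kp - al) * gam by rewrite h mulr_gt0.
rewrite pmulr_lgt0 //; lra.
Qed.

Let e z u w : C := cexp (- (gam%:C%C * hdot (w - z) (w - u))).

Let cabs_e z u w : cabs (e z u w) = expR (gam * csqn (z - u) / 4) * expR (- (gam * csqn (w - mid z u))).
Proof. by rewrite /e cabs_cexp ReN ReZ Re_hdot_mid -expRD; congr expR; lra. Qed.

Let Psi z u (q : (Rn * Rn) * (Rn * Rn)) : C :=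
  g (cvec q.1) * ((expR (- (kp * csqn (cvec q.2 - cvec q.1))))%:C%C * e z u (cvec q.2)).

Let V1 : Vmeas (fun q : (Rn * Rn) * (Rn * Rn) => cvec q.1 : Cn).
Proof. by apply: Vmeas_cvec; exact: measurable_fst. Qed.

Let V2 : Vmeas (fun q : (Rn * Rn) * (Rn * Rn) => cvec q.2 : Cn).
Proof. by apply: Vmeas_cvec; exact: measurable_snd. Qed.

Let me d0 (T : measurableType d0) (phi : T -> Cn) z u : Vmeas phi -> Cmeas (fun x => e z u (phi x)).
Proof.
move=> mp; apply: Cmeas_cexp; apply: CmeasN; apply: CmeasM; first exact: Cmeas_cst.
by apply: Cmeas_hdot; apply: VmeasB => //; exact: Vmeas_cst.
Qed.

Let mPsi z u : Cmeas (Psi z u).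
Proof.
apply: CmeasM; first exact: (Cmeas_comp mg measurable_fst).
by apply: CmeasM; [apply: Cmeas_gauss; exact: VmeasB|exact: me].
Qed.

Let IPsi z u : Cintegrable (leb \x leb)%E (Psi z u).
Proof.
have a0 := al_gt0 t_gt0.
apply: Cintegrable_prod12 => //.
have kal : al / 2 < al by lra.
have Pd0 : 0 <= (pi / d) ^+ n :> R by rewrite exprn_ge0 // divr_ge0 ?pi_ge0 ?(ltW d_gt0).
pose K := expR (gam * csqn (z - u) / 4) * (pi / d) ^+ n.
have K0 : 0 <= K by rewrite mulr_ge0 ?expR_ge0.
rewrite (_ : (fun x => _) = (fun p : Rn * Rn => (K * (cabs (g (cvec p)) * expR (- (al * csqn (cvec p - mid z u)))))%:E)).
  rewrite ge0_integralZ.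
  - apply: lte_mul_pinfty => //; exact: (gauss_tail_finite t_gt0 mg Hg (mid z u) kal).
  - apply: measurable_funM; first exact: measurable_cabs.
    by apply: measurable_gauss_comp; apply: VmeasB; [exact: Vmeas_id|exact: Vmeas_cst].
  - by move=> p; rewrite mulr_ge0 ?cabs_ge0 ?expR_ge0.
  - exact: K0.
apply/funext => p; set w := cvec p; set m := mid z u.
pose c := cabs (g w) * expR (gam * csqn (z - u) / 4) * expR (- (kp * csqn w) - gam * csqn m).
pose A := kp%:C%C *: w + gam%:C%C *: m.
transitivity (\int[leb]_x (c * expR (- (d * csqn (cvec x)) + 2 * complex.Re (hdot (cvec x) A)))%:E)%E.
  apply: eq_integral => x _; congr (_%:E).
  rewrite /Psi /= !cabsM cabs_real ger0_norm ?expR_ge0 // cabs_e -/w -/m /c.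
  rewrite [LHS](_ : _ = cabs (g w) * expR (gam * csqn (z - u) / 4) *
    (expR (- (kp * csqn (cvec x - w))) * expR (- (gam * csqn (cvec x - m))))); last by ring.
  rewrite -[RHS]mulrA -!expRD; congr (_ * expR _).
  rewrite !csqnB /A hdotDr ReD !hdotZr !conjR !ReZ /d; lra.
rewrite ge0_integralZ.
- rewrite integral_gauss_linear // -EFinM; congr (_%:E).
  rewrite /c /K [LHS](_ : _ = cabs (g w) * expR (gam * csqn (z - u) / 4) * (pi / d) ^+ n *
     (expR (- (kp * csqn w) - gam * csqn m) * expR (csqn A / d))); last by ring.
  rewrite [RHS](_ : _ = cabs (g w) * expR (gam * csqn (z - u) / 4) * (pi / d) ^+ n *
     expR (- (al * csqn (w - m)))); last by ring.
  rewrite -expRD; congr (_ * expR _).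
  rewrite -rates -/d /A; clearbody m w.
  rewrite csqnB csqnD !csqnZ !cabs_real !ger0_norm ?(ltW kp_gt0) ?(ltW gam_gt0) //.
  rewrite hdotZl hdotZr conjR !ReZ.
  have := gt_eqF d_gt0; rewrite /d => d0; field.
  by rewrite d0.
- under eq_fun do rewrite expRD.
  by apply: measurable_funM; [apply: measurable_gauss_comp; exact: Vmeas_id|exact: measurable_expR_hdot (@Vmeas_id R n)].
- by move=> x; rewrite expR_ge0.
- by rewrite !mulr_ge0 ?cabs_ge0 ?expR_ge0.
Qed.

Let Psi1 z u p : Cint leb (fun q => Psi z u (p, q)) =
  (((pi / d) ^+ n)%:C%C * cexp (- (al%:C%C * hdot z u))) *
  (g (cvec p) * cexp (al%:C%C * hdot (cvec p) u + al%:C%C * hdot z (cvec p)) * (Ew t (cvec p))%:C%C).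
Proof.
have [I E] := gaussian_composition kp_gt0 gam_gt0 z u (cvec p).
rewrite /Psi /= (CintZ _ I) E rates -/d /Ew -cexp_real.
rewrite [RHS](_ : _ = g (cvec p) * (((pi / d) ^+ n)%:C%C * (cexp (- (al%:C%C * hdot z u)) *
  cexp (al%:C%C * hdot (cvec p) u + al%:C%C * hdot z (cvec p)) * cexp (- (al * csqn (cvec p)))%:C%C))); last by ring.
rewrite -!cexpD; congr (_ * (_ * cexp _)).
rewrite rcN rcM -hdotxx hdotDl !hdotDr !hdotNl !hdotNr; ring.
Qed.

Let Psi2 z u q : Cint leb (fun p => Psi z u (p, q)) = e z u (cvec q) * heat (cvec q).
Proof.
rewrite /heat -(CintZ _ (Cintegrable_gauss_tail t_gt0 mg Hg (cvec q) kp_large)).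
by apply: eq_Cint => p; rewrite /Psi /= csqn_distC; ring.
Qed.

(** The Gaussian weight of the kernel is a composition of two Gaussians, so the
    kernel is an integral of [heat]. *)
Lemma bker_decay z u : cabs (bker t g z u) <=
  ((pi / gam) ^+ n / (pi / (kp + gam)) ^+ n * M) *
  expR (al * (csqn z + csqn u) / 2 - (2 * al - gam) / 4 * csqn (z - u)).
Proof.
rewrite -/d; have Pd : 0 < (pi / d) ^+ n :> R by rewrite exprn_gt0 // divr_gt0 // pi_gt0.
have E1 : Cint leb (fun p => Cint leb (fun q => Psi z u (p, q))) =
   ((pi / d) ^+ n)%:C%C * cexp (- (al%:C%C * hdot z u)) * bker t g z u.
  exact: (eq_trans (eq_Cint leb (Psi1 z u)) (CintZ _ (Cintegrable_bker t_gt0 mg Hg z u))).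
have E2 := eq_trans (esym E1) (Cfubini (IPsi z u)).
have m2 := Cmeas_fubini2 (IPsi z u).
pose K := M * expR (gam * csqn (z - u) / 4).
have K0 : 0 <= K by rewrite mulr_ge0 ?expR_ge0.
have mgm : measurable_fun setT (fun q : Rn * Rn => expR (- (gam * csqn (cvec q - mid z u)))).
  by apply: measurable_gauss_comp; apply: VmeasB; [exact: Vmeas_id|exact: Vmeas_cst].
have bound : (\int[leb]_q (cabs (Cint leb (fun p => Psi z u (p, q))))%:E <= (K * (pi / gam) ^+ n)%:E)%E.
  rewrite EFinM -(integral_gauss_shift (mid z u) gam_gt0).
  rewrite -(ge0_integralZ leb mgm (fun=> expR_ge0 _) K0).
  apply: ae_ge0_le_integral => //.
  - by move=> q _; rewrite lee_fin cabs_ge0.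
  - exact/measurable_EFinP/measurable_cabs.
  - by move=> q _; rewrite lee_fin mulr_ge0 ?expR_ge0.
  - by apply/measurable_EFinP; apply: measurable_funM => //; exact: measurable_cst.
  - apply: filterS hM => q hq _; rewrite lee_fin Psi2 cabsM cabs_e /K.
    rewrite [X in X <= _]mulrC mulrA ler_wpM2r ?expR_ge0 // ler_wpM2r ?expR_ge0 //.
have I2 : Cintegrable leb (fun q => Cint leb (fun p => Psi z u (p, q))).
  by split => //; apply: le_lt_trans bound (ltry _).
have h : cabs (((pi / d) ^+ n)%:C%C * cexp (- (al%:C%C * hdot z u)) * bker t g z u) <= K * (pi / gam) ^+ n.
  by rewrite E2 -lee_fin; exact: le_trans (cabs_Cint I2) bound.
rewrite cabsM [cabs (_ * cexp _)]cabsM cabs_real (ger0_norm (ltW Pd)) cabs_cexp ReN ReZ in h.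
have e0 : 0 < (pi / d) ^+ n * expR (- (al * complex.Re (hdot z u))) by rewrite mulr_gt0 // expR_gt0.
rewrite -(ler_pM2l e0); apply: le_trans h _; rewrite le_eqVlt; apply/orP; left; apply/eqP.
have Pn : (pi / d) ^+ n != 0 :> R by rewrite gt_eqF.
move: Pn; set P := (pi / d) ^+ n => Pn.
set Q := (pi / gam) ^+ n; rewrite /K.
set x2 := expR (al * _ / 2 - _).
transitivity (Q * M * (expR (- (al * complex.Re (hdot z u))) * x2)).
  rewrite /x2 -expRD mulrAC [Q * M]mulrC; congr (_ * expR _).
  by rewrite csqnB; lra.
by field.
Qed.

End upper_bound.

(** * Both inequalities *)

Section sup_norm.
Context {R : realType} (n : nat).
Local Notation C := R[i].
Local Notation Cn := 'rV[C]_n.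
Local Notation Rn := (n.-tuple R).
Implicit Types f : Cn -> C.

Lemma norm_infty_le f (K : R) : 0 <= K ->
  (forall p : Rn * Rn, cabs (f (cvec p)) <= K) -> (norm_infty f <= K%:E)%E.
Proof.
move=> K0 fK; rewrite /norm_infty unlock; case: ifP => _; last by rewrite lee_fin.
by apply/ess_supP; apply: nearW => p /=; rewrite lee_fin ger0_norm ?cabs_ge0.
Qed.

Lemma norm_infty_ae f : (norm_infty f < +oo)%E ->
  exists2 M : R, 0 <= M & norm_infty f = M%:E /\
    {ae lebC n, forall p, cabs (f (cvec p)) <= M}.
Proof.
move=> fy; have f0 : (0 <= norm_infty f)%E by exact: Lnorm_ge0.
have fM : norm_infty f = (fine (norm_infty f))%:E by rewrite fineK // ge0_fin_numE.
exists (fine (norm_infty f)); first exact: fine_ge0.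
split => //; set M := fine _ in fM *.
move: fM; rewrite /norm_infty unlock; case: ifPn => [_ E|]; last first.
  rewrite -leNgt => mu0 _; exists setT; split => //.
  by apply/eqP; rewrite eq_le mu0 measure_ge0.
have /ess_supP : (ess_sup (lebC n) (abse \o (fun p : Rn * Rn => (cabs (f (cvec p)))%:E)) <= M%:E)%E.
  by rewrite -E.
by apply: filterS => p /=; rewrite lee_fin ger0_norm ?cabs_ge0.
Qed.

End sup_norm.

Section constants.
Context {R : realType} (n : nat) (t : R).

(** The bound of [heat_integral_bound] for [a ^+ 2 = `|1 - (4 * s)^-1 / al|]
    together with the normalization of the heat kernel. *)
Definition heat_const (s : R) : R :=
  (4 * pi * s) ^- n * (pi / (al t * (1 - `|1 - (4 * s)^-1 / al t|))) ^+ n.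

(** The bound of [toeplitz_bounded] for the kernel estimate of [bker_decay]; the
    factor [(4 * pi * s) ^+ n] undoes the normalization of the heat kernel. *)
Definition toeplitz_const (s : R) : R :=
  let gam := (sinh (4 * t) - 4 * s)^-1 in
  ((al t / pi) ^+ n) ^+ 2 *
  ((pi / gam) ^+ n / (pi / ((4 * s)^-1 + gam)) ^+ n * (4 * pi * s) ^+ n) *
  (pi / ((2 * al t - gam) / 4)) ^+ n.

End constants.

Section borel_symbol.
Context {R : realType} (n : nat) (t : R) (t_gt0 : 0 < t).
Local Notation C := R[i].
Local Notation Cn := 'rV[C]_n.
Local Notation Rn := (n.-tuple R).
Local Notation leb := (lebC n).
Local Notation al := (al t).
Local Notation Kf := (Kf t).
Variable g : Cn -> C.
Hypothesis mg : Cmeas (fun p : Rn * Rn => g (cvec p)).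

(** Dividing by the factors of the kernel that depend on [v] alone. *)
Lemma symbol_kernel_finite v : (sqint t (fun z => (g z * Kf z v)%R) < +oo)%E ->
  (\int[leb]_p (cabs (g (cvec p)) ^+ 2 * expR (2 * al * complex.Re (hdot (cvec p) v)) * Ew t (cvec p))%:E < +oo)%E.
Proof.
pose k := kap n t ^+ 2 * cU n t / cabs (Mt t v) ^+ 2.
have Mv : 0 < cabs (Mt t v) by rewrite cabs_cexp expR_gt0.
have k0 : 0 < k.
  by rewrite divr_gt0 ?exprn_gt0 // mulr_gt0 ?exprn_gt0 ?kap_gt0 ?cU_gt0.
pose X (p : Rn * Rn) := cabs (g (cvec p)) ^+ 2 * expR (2 * al * complex.Re (hdot (cvec p) v)) * Ew t (cvec p).
have mX : measurable_fun setT X.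
  apply: measurable_funM; last by apply: measurable_Ew; exact: Vmeas_id.
  apply: measurable_funM; last exact: measurable_expR_hdot (@Vmeas_id R n).
  by apply: measurable_funX; exact: measurable_cabs.
have X0 p : 0 <= X p by rewrite mulr_ge0 ?expR_ge0 // mulr_ge0 ?expR_ge0 // sqr_ge0.
have -> : (sqint t (fun z => (g z * Kf z v)%R) = k%:E * \int[leb]_p (X p)%:E)%E.
  rewrite -(ge0_integralZ leb mX X0 (ltW k0)); apply: eq_integral => p _; congr (_%:E).
  have Mp : cabs (Mt t (cvec p : Cn)) != 0 by rewrite cabs_cexp gt_eqF // expR_gt0.
  have Mv0 : cabs (Mt t v) != 0 by rewrite gt_eqF.
  rewrite UtE // /k /X cabsM /Kf 3!cabsM cabs_real cabs_conj !cabsV cabs_cexp ReZ.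
  rewrite ger0_norm ?(ltW (kap_gt0 n t_gt0)) //.
  have -> : expR (2 * al * complex.Re (hdot (cvec p) v)) = expR (al * complex.Re (hdot (cvec p) v)) ^+ 2.
    by rewrite expr2 -expRD; congr expR; lra.
  by field; rewrite Mp Mv0.
by move=> h; rewrite ltey; apply/eqP => Iy; move: h; rewrite [X in (_ * X)%E]Iy mulry gtr0_sg // mul1e ltxx.
Qed.

Hypothesis Hg : forall v, (\int[leb]_p
  (cabs (g (cvec p)) ^+ 2 * expR (2 * al * complex.Re (hdot (cvec p) v)) * Ew t (cvec p))%:E < +oo)%E.

Lemma heat_convE s q : 0 < s -> al / 2 < (4 * s)^-1 -> heat_conv g s q =
  ((4 * pi * s) ^- n)%:C%C * Cint leb (fun p => g (cvec p) * (expR (- ((4 * s)^-1 * csqn (cvec p - q))))%:C%C).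
Proof.
move=> s0 sl; rewrite -(CintZ _ (Cintegrable_gauss_tail t_gt0 mg Hg q sl)).
apply: eq_Cint => p; rewrite /heat_kernel csqn_distC rcM [_ / (4 * s)]mulrC; ring.
Qed.

(** The numbers [a] and [b] of [heat_integral_bound] have product [rho] and equal
    squares, so they are [sqrt `|rho|] and its product with the sign of [rho]. *)
Lemma heat_conv_le (S : (Cn -> C) -> (Cn -> C)) s z0 :
  bounded_operator t S -> (forall u, S (Kf ^~ u) = toeplitz t g (Kf ^~ u)) ->
  sinh (4 * t) / 8 < s < sinh (4 * t) / 2 ->
  cabs (heat_conv g s z0) <= heat_const n t s * operator_norm t S.
Proof.
move=> bS ST /andP[s1 s2].
have sg0 : 0 < sinh (4 * t) by rewrite sinh_gt0 // mulr_gt0.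
have s0 : 0 < s by apply: lt_trans s1; rewrite divr_gt0.
have a0 := al_gt0 t_gt0.
set kp := (4 * s)^-1; pose rho := 1 - kp / al.
have kpal : kp / al = sinh (4 * t) / (4 * s) by rewrite /kp /al invrK mulrC.
have k1 : 2^-1 < kp / al by rewrite kpal ltr_pdivlMr ?mulr_gt0 //; lra.
have k2 : kp / al < 2 by rewrite kpal ltr_pdivrMr ?mulr_gt0 //; lra.
have r1 : `|rho| < 1 by rewrite ltr_norml /rho; lra.
have kl : al / 2 < kp by move: k1; rewrite ltr_pdivlMr // mulrC.
pose a := Num.sqrt `|rho|; pose b := if 0 <= rho then a else - a.
have a2 : a ^+ 2 = `|rho| by rewrite sqr_sqrtr.
have b2 : a ^+ 2 = b ^+ 2 by rewrite /b; case: ifP => // _; rewrite sqrrN.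
have ab : a * b = 1 - kp / al.
  rewrite -/rho /b; case: ifPn => [r0|]; first by rewrite -expr2 a2 ger0_norm.
  by rewrite -ltNge => r0; rewrite mulrN -expr2 a2 ltr0_norm // opprK.
have abs2 : (a + b) ^+ 2 / 4 < 2^-1.
  rewrite /b; case: ifPn => [r0|_]; last by rewrite subrr expr0n /= mul0r.
  have -> : (a + a) ^+ 2 / 4 = a ^+ 2 by field.
  by rewrite a2 ger0_norm // /rho; lra.
have a21 : a ^+ 2 < 1 by rewrite a2.
have := heat_integral_bound t_gt0 mg Hg bS ST z0 b2 a21 ab abs2.
rewrite heat_convE // -/kp cabsM cabs_real a2 => h.
have H0 : 0 <= (4 * pi * s) ^- n :> R by rewrite invr_ge0 exprn_ge0 // !mulr_ge0 ?pi_ge0 // ltW.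
rewrite ger0_norm // /heat_const -/kp -/rho -(mulrA ((4 * pi * s) ^- n)).
exact: ler_wpM2l.
Qed.

Lemma toeplitz_le s (M : R) : 0 < s < sinh (4 * t) / 8 -> 0 <= M ->
  {ae leb, forall p, cabs (heat_conv g s (cvec p)) <= M} ->
  bounded_operator t (toeplitz t g) /\
  operator_norm t (toeplitz t g) <= toeplitz_const n t s * M.
Proof.
move=> /andP[s0 s1] M0 hM.
have sg0 : 0 < sinh (4 * t) by rewrite sinh_gt0 // mulr_gt0.
set kp := (4 * s)^-1; pose gam := (sinh (4 * t) - 4 * s)^-1.
have gs : 0 < sinh (4 * t) - 4 * s by lra.
have kp0 : 0 < kp by rewrite invr_gt0 mulr_gt0.
have gam0 : 0 < gam by rewrite invr_gt0.
have rates : kp * gam / (kp + gam) = al.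
  rewrite /kp /gam /al; field.
  by rewrite ?(gt_eqF sg0) ?(gt_eqF gs) ?(gt_eqF s0).
have kl : al / 2 < kp.
  have s2 : 0 < 4 * s by rewrite mulr_gt0.
  have sg2 : 0 < sinh (4 * t) * 2 by rewrite mulr_gt0.
  by rewrite /kp /al -invfM ltf_pV2 ?posrE //; lra.
have c0 : 0 < (2 * al - gam) / 4.
  rewrite divr_gt0 // subr_gt0 /gam -[2 * al]invrK invfM /al invrK.
  have sg2 : 0 < 2^-1 * sinh (4 * t) by rewrite mulr_gt0 // invr_gt0.
  by rewrite ltf_pV2 ?posrE //; lra.
have H0 : 0 < (4 * pi * s) ^+ n by rewrite exprn_gt0 // !mulr_gt0 // pi_gt0.
have hM' : {ae leb, forall q, cabs (Cint leb (fun p => g (cvec p) *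
    (expR (- (kp * csqn (cvec p - cvec q))))%:C%C)) <= (4 * pi * s) ^+ n * M}.
  apply: filterS hM => q; rewrite heat_convE // cabsM cabs_real ger0_norm ?invr_ge0 ?(ltW H0) //.
  by rewrite ler_pdivrMl.
have HM0 : 0 <= (4 * pi * s) ^+ n * M by rewrite mulr_ge0 // ltW.
have B0 : 0 <= (pi / gam) ^+ n / (pi / (kp + gam)) ^+ n * ((4 * pi * s) ^+ n * M).
  rewrite mulr_ge0 // divr_ge0 // exprn_ge0 // divr_ge0 ?pi_ge0 ?(ltW gam0) //.
  by rewrite addr_ge0 // ltW.
have [bT oT] := toeplitz_bounded t_gt0 mg Hg c0 B0 (bker_decay t_gt0 mg Hg kp0 gam0 HM0 rates hM').
split => //; apply: le_trans oT _; rewrite /toeplitz_const -/kp -/gam.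
by rewrite le_eqVlt; apply/orP; left; apply/eqP; ring.
Qed.

End borel_symbol.

Section null_modification.
Context {R : realType} (n : nat) (t : R).
Local Notation C := R[i].
Local Notation Cn := 'rV[C]_n.
Variables g g' : Cn -> C.
Hypothesis gg' : null_eq g g'.

Lemma toeplitz_null_eq : toeplitz t g = toeplitz t g'.
Proof.
apply/funext => f; apply/funext => z; rewrite /toeplitz /cintegral_mu !cintegralE.
exact: (Cint_null_eq (fun p x => x * f (cvec p) * Kt t z (cvec p) * (Ut t p)%:C%C) gg').
Qed.

Lemma heat_conv_null_eq s : heat_conv g s = heat_conv g' s.
Proof.
apply/funext => z; rewrite /heat_conv !cintegralE.
exact: (Cint_null_eq (fun p x => x * (heat_kernel s (z - cvec p))%:C%C) gg').
Qed.

Lemma sqint_null_eq f : sqint t (fun z => g z * f z) = sqint t (fun z => g' z * f z).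
Proof.
exact: (integral_null_eq (fun p x => (cabs (x * f (cvec p)) ^+ 2 * Ut t p)%:E) gg').
Qed.

End null_modification.

Theorem theorem3p2 (R : realType) (n : nat) (t : R) (t_gt0 : 0 < t) :
  exists c : R -> R,
  forall g : 'rV[R[i]]_n -> R[i],
    cmeasurable g ->
    (forall w, L2mu t (fun z => g z * Kt t z w)) ->
    (forall S, bounded_extension t g S ->
      forall s, sinh (4 * t) / 8 < s < sinh (4 * t) / 2 ->
        (norm_infty (heat_conv g s) <= (c s * operator_norm t S)%:E)%E) /\
    (forall s, 0 < s < sinh (4 * t) / 8 ->
      (norm_infty (heat_conv g s) < +oo)%E ->
      exists S, bounded_extension t g S /\
        ((operator_norm t S)%:E <= (c s)%:E * norm_infty (heat_conv g s))%E).
Proof.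
(* The two ranges of [s] are disjoint, so one function carries both constants. *)
exists (fun s => if s < sinh (4 * t) / 8 then toeplitz_const n t s else heat_const n t s).
move=> g mg gK.
have [g' [mg' gg']] := cmeasurable_approx mg.
have Hg v : (\int[lebC n]_p (cabs (g' (cvec p)) ^+ 2 *
    expR (2 * al t * complex.Re (hdot (cvec p) v)) * Ew t (cvec p))%:E < +oo)%E.
  apply: (symbol_kernel_finite t_gt0 mg'); rewrite -(sqint_null_eq _ gg') -KtE //.
  exact: (gK v).2.
rewrite /bounded_extension (toeplitz_null_eq t gg').
split=> [S [bS ST] s|s] hs; rewrite (heat_conv_null_eq gg' s).
- have /andP[s1 _] := hs; rewrite ltNge (ltW s1) /=.
  have SK u : S (Kf t ^~ u) = toeplitz t g' (Kf t ^~ u).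
    by apply: ST; split; [exact: Ht_Kf|rewrite -KtE //; exact: gK].
  have H z0 := heat_conv_le t_gt0 mg' Hg z0 bS SK hs.
  by apply: norm_infty_le => [|p]; [exact: le_trans (cabs_ge0 _) (H 0)|exact: H].
- move=> /norm_infty_ae[M M0 [-> hM]]; have /andP[_ ->] := hs.
  have [bT oT] := toeplitz_le t_gt0 mg' Hg hs M0 hM.
  exists (toeplitz t g'); split; first by split.
  by rewrite -EFinM lee_fin.
Qed.
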